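(* Let $\mathbf{k}$ be a field with $\mathrm{char}(\mathbf{k})\neq 2$, and let $r$ be the cardinality of $\mathbf{k}^*/(\mathbf{k}^* )^2$. Then there are exactly $26+4r$ isomorphism classes of $6$-dimensional minimal algebras over $\mathbf{k}$ generated in degree $1$.
   Context: A minimal algebra over $\mathbf{k}$ generated in degree $1$ of dimension $n$ is a commutative differential graded algebra $(\wedge V,d)$ where $V$ is an $n$-dimensional $\mathbf{k}$-vector space concentrated in degree $1$ (so $\wedge V$ is the exterior algebra on $V$), $d$ is a degree $+1$ derivation with $d^2=0$, and there is a basis $x_1,\dots,x_n$ of $V$ with $dx_i\in\wedge^2\langle x_1,\dots,x_{i-1}\rangle$ for all $i$. Isomorphism means isomorphism of differential graded algebras over $\mathbf{k}$. *)

(* Defs.v *)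
From HB Require Import structures.
From mathcomp Require Import all_boot all_order all_algebra.
Set Implicit Arguments. Unset Strict Implicit. Unset Printing Implicit Defensive.
Import GRing.Theory.
Local Open Scope ring_scope.

(* Concrete model of the exterior algebra  /\V  on an n-dimensional space
   V = F^n (standard basis e_0,...,e_{n-1}, in degree 1): an element is the
   family of its coordinates on the basis monomials e_S, S a subset of 'I_n,
   e_S = e_{s1} /\ ... /\ e_{sp} for s1 < ... < sp.  e_S has degree #|S|. *)
Notation ext F n := {ffun {set 'I_n} -> F%type}.

Definition escale (F : fieldType) (n : nat) (a : F) (x : ext F n) : ext F n :=
  [ffun S : {set 'I_n} => a * x S].

(* sign of e_A /\ e_B = sgn A B * e_{A u B} for disjoint A, B *)
Definition wsgn (F : fieldType) (n : nat) (A B : {set 'I_n}) : F :=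
  (-1) ^+ #|[set p : 'I_n * 'I_n | [&& p.1 \in A, p.2 \in B & (p.2 < p.1)%N]]|.

Definition wedge (F : fieldType) (n : nat) (a b : ext F n) : ext F n :=
  [ffun S : {set 'I_n} => \sum_(A : {set 'I_n} | A \subset S)
      wsgn F A (S :\: A) * a A * b (S :\: A)].

Definition ext1 (F : fieldType) (n : nat) : ext F n :=
  [ffun S : {set 'I_n} => (S == set0)%:R].

Definition homog (F : fieldType) (n : nat) (p : nat) (x : ext F n) : Prop :=
  forall S : {set 'I_n}, #|S| != p -> x S = 0.

Definition is_linear_map (F : fieldType) (n : nat) (f : ext F n -> ext F n) : Prop :=
  forall (a : F) (x y : ext F n), f (escale a x + y) = escale a (f x) + f y.

Definition is_cdga_differential (F : fieldType) (n : nat) (d : ext F n -> ext F n) : Prop :=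
  [/\ is_linear_map d,
      (forall p x, homog p x -> homog p.+1 (d x)),
      (forall p x y, homog p x ->
          d (wedge x y) = wedge (d x) y + escale ((-1) ^+ p) (wedge x (d y)))
    & (forall x, d (d x) = 0)].

Definition is_minimal_algebra (F : fieldType) (n : nat) (d : ext F n -> ext F n) : Prop :=
  is_cdga_differential d /\
  exists x : 'I_n -> ext F n,
    [/\ (forall i, homog 1 (x i)),
        (forall c : 'I_n -> F, \sum_i escale (c i) (x i) = 0 -> forall i, c i = 0)
      & (forall i : 'I_n, exists c : 'I_n -> 'I_n -> F,
           d (x i) = \sum_(j : 'I_n | (j < i)%N) \sum_(k : 'I_n | (k < i)%N)
                        escale (c j k) (wedge (x j) (x k)))].

Definition dga_iso (F : fieldType) (n : nat) (d d' : ext F n -> ext F n) : Prop :=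
  exists phi : ext F n -> ext F n,
    [/\ is_linear_map phi /\ bijective phi,
        phi (ext1 F n) = ext1 F n,
        (forall x y, phi (wedge x y) = wedge (phi x) (phi y)),
        (forall p x, homog p x -> homog p (phi x))
      & (forall x, phi (d x) = d' (phi x))].

(* Index set  'I_26 + 'I_4 x F (second component restricted to nonzero u);
   its quotient by [sq_rel] is 26 points disjoint union 4 copies of the
   square-class group F^x / (F^x)^2, a set of cardinality 26 + 4r. *)
Definition valid_index (F : fieldType) (t : ('I_26 + 'I_4 * F)%type) : Prop :=
  match t with inl _ => True | inr (_, u) => u != 0 end.

Definition sq_rel (F : fieldType) (t t' : ('I_26 + 'I_4 * F)%type) : Prop :=
  match t, t' with
  | inl i, inl j => i = j
  | inr (i, u), inr (j, v) => i = j /\ exists w : F, w != 0 /\ u = v * w ^+ 2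
  | _, _ => False
  end.

(* Main.v *)
(* Dually, the theorem classifies 6-dimensional nilpotent Lie algebras.  In a triangular basis the
   first m generators span a minimal algebra A, and the differential of the next one is a closed
   2-form on A, which matters only modulo exact forms, automorphisms of A and scaling.  Solving this
   successively for m = 2, ..., 5 yields 2, 3, 9 and finally the 26 + 4r normal forms; square classes
   enter through binary quadratic forms and pencils of 2-forms.  Conversely, the dimensions of five
   characteristic subspaces of the Lie algebra tell the normal forms apart, up to the parameter of
   the four families, which is recovered up to squares as a discriminant. *)
Require Import Defs.
From HB Require Import structures.
From mathcomp Require Import all_boot all_order all_algebra.
From mathcomp Require Import ring.
Set Implicit Arguments. Unset Strict Implicit. Unset Printing Implicit Defensive.
Import GRing.Theory.
Local Open Scope ring_scope.

(** * The exterior algebra *)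

(** Every reduction step is an explicit substitution together with its inverse; once unfolded, the
    chain map condition and the inverse condition are finitely many identities in the field. The
    obstacle is that a normalization of the first m generators must leave the remaining ones
    tractable: [approx] therefore records only triangularity there, which survives every change
    among the first m generators. Characteristic different from 2 enters mainly where a binary
    quadratic form is diagonalized, a pencil is made traceless, or a mixed term is split into
    halves. In the converse direction the characteristic subspaces are coordinate subspaces computed
    from the supports of the differentials alone, hence uniformly in the parameter. Their dimensions
    do not separate the last two families from their members at parameter zero, which count among
    the 26; there the discriminant argument is run with parameter zero allowed on one side. *)

Section Exterior.
Variables (F : fieldType) (n : nat).
Local Notation E := (ext F n).
Implicit Types (x y z : E) (A B S : {set 'I_n}) (a : F).

Lemma escaleA a b x : escale a (escale b x) = escale (a * b) x.
Proof. by apply/ffunP=> S; rewrite !ffunE mulrA. Qed.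
Lemma escale1 x : escale 1 x = x.
Proof. by apply/ffunP=> S; rewrite ffunE mul1r. Qed.
Lemma escale0 x : escale 0 x = 0.
Proof. by apply/ffunP=> S; rewrite !ffunE mul0r. Qed.
Lemma escaler0 a : escale a (0 : E) = 0.
Proof. by apply/ffunP=> S; rewrite !ffunE mulr0. Qed.
Lemma escaleDr a x y : escale a (x + y) = escale a x + escale a y.
Proof. by apply/ffunP=> S; rewrite !ffunE mulrDr. Qed.
Lemma escaleDl a b x : escale (a + b) x = escale a x + escale b x.
Proof. by apply/ffunP=> S; rewrite !ffunE mulrDl. Qed.
Lemma escaleN1 x : escale (-1) x = - x.
Proof. by apply/ffunP=> S; rewrite !ffunE mulN1r. Qed.

Section Linear.
Variable f : E -> E.
Hypothesis f_lin : is_linear_map f.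

Lemma linD x y : f (x + y) = f x + f y.
Proof. by rewrite -{1}[x]escale1 f_lin escale1. Qed.
Lemma lin0 : f 0 = 0.
Proof. by apply: (@addrI _ (f 0)); rewrite -linD !addr0. Qed.
Lemma linZ a x : f (escale a x) = escale a (f x).
Proof. by rewrite -[escale a x]addr0 f_lin lin0 addr0. Qed.
Lemma linN x : f (- x) = - f x.
Proof. by rewrite -!escaleN1 linZ. Qed.
Lemma lin_sum I (r : seq I) (P : pred I) (G : I -> E) :
  f (\sum_(i <- r | P i) G i) = \sum_(i <- r | P i) f (G i).
Proof.
apply: (big_morph f linD lin0).
Qed.
End Linear.

Lemma escale_lin a : is_linear_map (@escale F n a).
Proof. by move=> b x y; rewrite escaleDr !escaleA mulrC. Qed.

Lemma escale_sum a I (r : seq I) (P : pred I) (G : I -> E) :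
  escale a (\sum_(i <- r | P i) G i) = \sum_(i <- r | P i) escale a (G i).
Proof. exact: (lin_sum (@escale_lin a)). Qed.

Lemma wedge_linr x : is_linear_map (wedge x).
Proof.
move=> a y z; apply/ffunP=> S; rewrite !ffunE mulr_sumr -big_split /=.
by apply: eq_bigr => A _; rewrite !ffunE; ring.
Qed.

Lemma wedge_linl y : is_linear_map (fun x => wedge x y).
Proof.
move=> a x z; apply/ffunP=> S; rewrite !ffunE mulr_sumr -big_split /=.
by apply: eq_bigr => A _; rewrite !ffunE; ring.
Qed.

Definition wedgeDr x := linD (wedge_linr x).
Definition wedgeDl x y z : wedge (x + y) z = wedge x z + wedge y z :=
  linD (wedge_linl z) x y.
Definition wedgeZr x := linZ (wedge_linr x).
Definition wedgeZl a x y : wedge (escale a x) y = escale a (wedge x y) :=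
  linZ (wedge_linl y) a x.
Definition wedge0r x := lin0 (wedge_linr x).
Definition wedge0l x : wedge 0 x = 0 := lin0 (wedge_linl x).
Definition wedgeNr x := linN (wedge_linr x).
Definition wedgeNl x y : wedge (- x) y = - wedge x y := linN (wedge_linl y) x.
Definition wedge_sumr x := lin_sum (wedge_linr x).
Lemma wedge_suml I (r : seq I) (P : pred I) (G : I -> E) y :
  wedge (\sum_(i <- r | P i) G i) y = \sum_(i <- r | P i) wedge (G i) y.
Proof. exact: (lin_sum (wedge_linl y)). Qed.

Definition mono S : E := [ffun T => (T == S)%:R].

Lemma ext_sum x : x = \sum_S escale (x S) (mono S).
Proof.
apply/ffunP=> T; rewrite sum_ffunE (bigD1 T) //= !ffunE eqxx mulr1.
by rewrite big1 ?addr0 // => S; rewrite !ffunE eq_sym => /negPf->; rewrite mulr0.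
Qed.

Lemma mono_homog S : homog #|S| (mono S).
Proof. by move=> T nT; rewrite ffunE; case: (T =P S) nT => // ->; rewrite eqxx. Qed.

Lemma wsgnUl A A' B : [disjoint A & A'] ->
  wsgn F (A :|: A') B = wsgn F A B * wsgn F A' B.
Proof.
move=> dA; rewrite /wsgn -exprD -cardsUI.
set X := (_ :&: _); have -> : X = set0.
  apply/setP=> -[i j]; rewrite !inE /=; apply/negbTE/negP.
  by case/andP=> /and3P[iA _ _] /and3P[iA' _ _]; have := disjointFr dA iA; rewrite iA'.
rewrite cards0 addn0; congr (_ ^+ _); apply: eq_card => -[i j]; rewrite !inE /=.
by case: (i \in A); case: (i \in A'); rewrite /= ?orbF ?orbb.
Qed.

Lemma wsgnUr A B B' : [disjoint B & B'] ->
  wsgn F A (B :|: B') = wsgn F A B * wsgn F A B'.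
Proof.
move=> dA; rewrite /wsgn -exprD -cardsUI.
set X := (_ :&: _); have -> : X = set0.
  apply/setP=> -[i j]; rewrite !inE /=; apply/negbTE/negP.
  by case/andP=> /and3P[_ iA _] /and3P[_ iA' _]; have := disjointFr dA iA; rewrite iA'.
rewrite cards0 addn0; congr (_ ^+ _); apply: eq_card => -[i j]; rewrite !inE /=.
by case: (i \in A); case: (j \in B); case: (j \in B'); rewrite /= ?orbF ?orbb.
Qed.

Lemma wsgn0 A : wsgn F set0 A = 1.
Proof.
by rewrite /wsgn eq_card0 // => -[i j]; rewrite !inE.
Qed.

Lemma wedge_mono A B : wedge (mono A) (mono B) =
  if [disjoint A & B] then escale (wsgn F A B) (mono (A :|: B)) else 0.
Proof.
apply/ffunP=> S; rewrite ffunE.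
have [sAS|nAS] := boolP (A \subset S); last first.
  rewrite big1 => [|A' sA']; last first.
    by rewrite !ffunE; case: eqP => [AE|]; [rewrite -AE sA' in nAS | rewrite mulr0 mul0r].
  case: ifP => _; rewrite !ffunE //; case: eqP nAS => [->|_ _]; last by rewrite mulr0.
  by rewrite subsetUl.
rewrite (bigD1 A) //= big1 ?addr0 => [|A' /andP[_ /negPf nA]]; last first.
  by rewrite !ffunE nA mulr0 mul0r.
rewrite !ffunE eqxx mulr1; case: ifP => dAB; rewrite !ffunE.
  have -> : (S :\: A == B) = (S == A :|: B).
    apply/eqP/eqP=> [<-|->]; first by rewrite setDE setUIr setUCr setIT; apply/esym/setUidPr.
    by rewrite setDUl setDv set0U; apply/setDidPl; rewrite disjoint_sym.
  by case: eqP => [->|]; rewrite ?mulr0 // setDUl setDv set0U (setDidPl _) // disjoint_sym.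
case: eqP => [BE|]; rewrite ?mulr0 //.
by move: dAB; rewrite -BE disjoints_subset setCD subsetUr.
Qed.

(** Trilinearity reduces this to monomials. Both sides vanish unless the three supports are pairwise
    disjoint, and then the signs agree because inversion counts add up over disjoint unions. *)
Lemma wedgeA x y z : wedge x (wedge y z) = wedge (wedge x y) z.
Proof.
rewrite [x]ext_sum !wedge_suml; apply: eq_bigr => A _; rewrite !wedgeZl; congr escale.
rewrite [y]ext_sum !wedge_suml !wedge_sumr !wedge_suml; apply: eq_bigr => B _.
rewrite !wedgeZl !wedgeZr !wedgeZl; congr escale.
rewrite [z]ext_sum !wedge_sumr; apply: eq_bigr => C _; rewrite !wedgeZr; congr escale.
rewrite !wedge_mono.
have dU (X Y Z : {set 'I_n}) : [disjoint X :|: Y & Z] = [disjoint X & Z] && [disjoint Y & Z].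
  by rewrite -!setI_eq0 setIUl setU_eq0.
have dV (X Y Z : {set 'I_n}) : [disjoint X & Y :|: Z] = [disjoint X & Y] && [disjoint X & Z].
  by rewrite -!setI_eq0 setIUr setU_eq0.
case: ifPn => [dBC|nBC]; case: ifPn => [dAB|nAB]; rewrite ?wedge0l ?wedge0r //.
- rewrite wedgeZr wedgeZl !wedge_mono dU dV dAB dBC andbT /=.
  case: ifP => dAC; last by rewrite !escaler0.
  by rewrite !escaleA setUA wsgnUl // wsgnUr //; congr escale; ring.
- by rewrite wedgeZr wedge_mono dV (negPf nAB) escaler0.
- by rewrite wedgeZl wedge_mono dU (negPf nBC) andbF escaler0.
Qed.

Lemma ext1E : ext1 F n = mono set0.
Proof. by apply/ffunP=> S; rewrite !ffunE. Qed.

Lemma wedge1l x : wedge (ext1 F n) x = x.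
Proof.
rewrite ext1E [x in LHS]ext_sum wedge_sumr [RHS]ext_sum; apply: eq_bigr => S _.
by rewrite wedgeZr wedge_mono -setI_eq0 set0I eqxx wsgn0 escale1 set0U.
Qed.

Definition gen (i : 'I_n) : E := mono [set i].
Definition nlt S (i : 'I_n) := #|[set j in S | (j < i)%N]|.

Lemma gen_homog i : homog 1 (gen i).
Proof. by rewrite -(cards1 i); apply: mono_homog. Qed.

Lemma wsgn1 i S : wsgn F [set i] S = (-1) ^+ nlt S i.
Proof.
rewrite /wsgn /nlt; congr (_ ^+ _).
rewrite -(card_imset (mem [set j in S | (j < i)%N]) (f := fun j => (i, j))); last by move=> j k [].
apply: eq_card => -[j k]; rewrite !inE /=; apply/idP/imsetP => [/and3P[/eqP-> kS ki]|[l]].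
  by exists k; rewrite ?inE ?kS.
by rewrite !inE => /andP[lS li] [-> ->]; rewrite eqxx lS.
Qed.

Lemma wedge_gen_mono i S : wedge (gen i) (mono S) =
  if i \in S then 0 else escale ((-1) ^+ nlt S i) (mono (i |: S)).
Proof. by rewrite wedge_mono disjoints1 wsgn1; case: (i \in S). Qed.

(** Each monomial is, up to sign, a product of generators applied to the unit. This induction spares
    later proofs the signs of monomials. *)
Lemma ext_ind (P : E -> Prop) :
  (forall a x y, P x -> P y -> P (escale a x + y)) -> P (ext1 F n) ->
  (forall i x, P x -> P (wedge (gen i) x)) -> forall x, P x.
Proof.
move=> Plin P1 Pgen.
have P0 : P 0.
  have -> : 0 = escale (-1) (ext1 F n) + ext1 F n by rewrite escaleN1 addNr.
  exact: Plin.
have PZ a x : P x -> P (escale a x) by move=> Px; rewrite -[escale _ _]addr0; apply: Plin.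
have PD x y : P x -> P y -> P (x + y) by move=> Px Py; rewrite -[x]escale1; apply: Plin.
have Pm : forall m S, #|S| = m -> P (mono S).
  elim=> [|m IH] S cS; first by rewrite (cards0_eq cS) -ext1E.
  have [i iS] : exists i, i \in S by apply/card_gt0P; rewrite cS.
  have := PZ ((-1) ^+ nlt (S :\ i) i) _ (Pgen i (mono (S :\ i)) _).
  rewrite wedge_gen_mono setD11 escaleA -expr2 sqrr_sign escale1 setD1K //; apply.
  by apply: IH; apply/eqP; rewrite -eqSS -cS [in X in _ == X](cardsD1 i) iS.
move=> x; rewrite [x]ext_sum; apply: (big_ind P) => // S _.
by apply: PZ; apply: Pm.
Qed.

Lemma wedge1r x : wedge x (ext1 F n) = x.
Proof.
elim/ext_ind: x => [a x y Px Py||i x Px]; first by rewrite wedgeDl wedgeZl Px Py.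
  exact: wedge1l.
by rewrite -wedgeA Px.
Qed.

Lemma wedge_genE i y S : wedge (gen i) y S =
  if i \in S then (-1) ^+ nlt S i * y (S :\ i) else 0.
Proof.
have nltD T : nlt (T :\ i) i = nlt T i.
  by rewrite /nlt; apply: eq_card => j; rewrite !inE; case: eqP => //= ->; rewrite ltnn andbF.
rewrite [y in LHS]ext_sum wedge_sumr sum_ffunE; case: ifP => iS.
  rewrite (bigD1 (S :\ i)) //= big1 ?addr0 => [|T nT].
    rewrite wedgeZr wedge_gen_mono setD11 !ffunE setD1K // eqxx mulr1 nltD; ring.
  rewrite wedgeZr wedge_gen_mono; case: ifP => iT; rewrite !ffunE ?mulr0 //.
  case: (S =P i |: T) nT => [->|]; last by rewrite !mulr0.
  by rewrite setU1K ?iT // eqxx.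
rewrite big1 // => T _; rewrite wedgeZr wedge_gen_mono; case: ifP => iT; rewrite !ffunE ?mulr0 //.
by case: (S =P i |: T) iS => [->|]; rewrite ?mulr0 // setU11.
Qed.

Lemma homogD p x y : homog p x -> homog p y -> homog p (x + y).
Proof. by move=> hx hy S nS; rewrite ffunE hx ?hy ?addr0. Qed.
Lemma homogZ p a x : homog p x -> homog p (escale a x).
Proof. by move=> hx S nS; rewrite ffunE hx ?mulr0. Qed.
Lemma homog0 p : homog p (0 : E).
Proof. by move=> S _; rewrite ffunE. Qed.
Lemma homog_sum p I (r : seq I) (P : pred I) (G : I -> E) :
  (forall i, P i -> homog p (G i)) -> homog p (\sum_(i <- r | P i) G i).
Proof. by move=> hG; apply: big_ind => //; [exact: homog0 | exact: homogD]. Qed.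

Lemma homogM p q x y : homog p x -> homog q y -> homog (p + q) (wedge x y).
Proof.
move=> hx hy S nS; rewrite ffunE big1 // => A sAS.
have [cA|/hx->] := eqVneq #|A| p; last by rewrite mulr0 mul0r.
have [cB|/hy->] := eqVneq #|S :\: A| q; last by rewrite mulr0.
by case/eqP: nS; rewrite -cA -cB -(cardsID A S) (setIidPr sAS).
Qed.

Lemma homog1 : homog 0 (ext1 F n).
Proof. by rewrite ext1E -(@cards0 'I_n); apply: mono_homog. Qed.

End Exterior.

(** * Graded derivations built from contractions *)

Section Derivation.
Variables (F : fieldType) (n : nat).
Local Notation E := (ext F n).
Implicit Types (x y z : E) (S : {set 'I_n}) (a : F) (i j : 'I_n).

Lemma gen_anti i j : wedge (gen F i) (gen F j) = - wedge (gen F j) (gen F i).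
Proof.
rewrite !wedge_gen_mono !inE [j == i]eq_sym; case: eqP => [_|/eqP nij]; first by rewrite oppr0.
have nlt1 (k l : 'I_n) : nlt [set k] l = (k < l)%N.
  rewrite /nlt; case: ltnP => kl.
    by rewrite -[RHS](cards1 k); apply: eq_card => m; rewrite !inE; case: eqP => // ->; rewrite kl.
  by apply: eq_card0 => m; rewrite !inE; case: eqP => // ->; rewrite ltnNge kl.
rewrite !nlt1 setUC -escaleN1 escaleA; congr escale.
by case: (ltngtP i j) nij => [_ _|_ _|/val_inj->]; rewrite ?eqxx //=; ring.
Qed.

Lemma gen_genA i j x : wedge (gen F i) (wedge (gen F j) x) = - wedge (gen F j) (wedge (gen F i) x).
Proof. by rewrite !wedgeA gen_anti wedgeNl. Qed.

(** The grading automorphism. It carries the sign of the graded Leibniz rule, so that [leibniz] can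
    be stated for inhomogeneous elements and proved with [ext_ind]. *)
Definition grade_inv x : E := [ffun S : {set 'I_n} => (-1) ^+ #|S| * x S].

Lemma invE x S : grade_inv x S = (-1) ^+ #|S| * x S.
Proof. by rewrite ffunE. Qed.
Lemma addE x y S : (x + y) S = x S + y S.
Proof. by rewrite ffunE. Qed.
Lemma oppE x S : (- x) S = - x S.
Proof. by rewrite ffunE. Qed.
Lemma escaleE a x S : escale a x S = a * x S.
Proof. by rewrite ffunE. Qed.

Lemma inv_lin : is_linear_map grade_inv.
Proof. by move=> a x y; apply/ffunP=> S; rewrite !ffunE; ring. Qed.

Lemma inv_homog p x : homog p x -> grade_inv x = escale ((-1) ^+ p) x.
Proof.
move=> hx; apply/ffunP=> S; rewrite !ffunE.
by have [->//|/hx->] := eqVneq #|S| p; rewrite !mulr0.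
Qed.

Lemma inv1 : grade_inv (ext1 F n) = ext1 F n.
Proof. by rewrite (inv_homog (@homog1 F n)) escale1. Qed.

Lemma inv_gen i x : grade_inv (wedge (gen F i) x) = - wedge (gen F i) (grade_inv x).
Proof.
apply/ffunP=> S; rewrite !(invE, oppE, wedge_genE).
case: ifP => iS; rewrite ?mulr0 ?oppr0 // (cardsD1 i) iS exprS; ring.
Qed.

Lemma wedge_gen_r x i : wedge x (gen F i) = wedge (gen F i) (grade_inv x).
Proof.
elim/ext_ind: x => [a x y Px Py||j x Px].
- by rewrite inv_lin wedgeDl wedgeZl Px Py wedgeDr wedgeZr.
- by rewrite inv1 wedge1l wedge1r.
- by rewrite -wedgeA Px inv_gen wedgeNr -gen_genA.
Qed.

(** Interior product with the i-th vector of the dual basis. *)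
Definition contr i x : E :=
  [ffun S : {set 'I_n} => if i \in S then 0 else (-1) ^+ nlt S i * x (i |: S)].

Lemma contrE i x S :
  contr i x S = if i \in S then 0 else (-1) ^+ nlt S i * x (i |: S).
Proof. by rewrite ffunE. Qed.

Lemma contr_lin i : is_linear_map (contr i).
Proof. by move=> a x y; apply/ffunP=> S; rewrite !ffunE; case: ifP => _; ring. Qed.

Lemma contr1 i : contr i (ext1 F n) = 0.
Proof.
apply/ffunP=> S; rewrite !ffunE; case: ifP => // _.
by rewrite (_ : (_ == set0) = false) ?mulr0 //; apply/negbTE/set0Pn; exists i; rewrite setU11.
Qed.

Lemma nltU S (i j : 'I_n) : i \notin S -> nlt (i |: S) j = ((i < j) + nlt S j)%N.
Proof.
move=> iS; rewrite /nlt (cardsD1 i) !inE eqxx /=; congr (_ + _)%N.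
apply: eq_card => k; rewrite !inE; case: eqP => // ->.
by rewrite (negPf iS).
Qed.

Lemma nltDU S (i j : 'I_n) : j \in S -> nlt S i = ((j < i) + nlt (S :\ j) i)%N.
Proof. by move=> jS; rewrite -{1}(setD1K jS) nltU // setD11. Qed.

(** Contraction is an antiderivation; this is its Leibniz rule against a generator. If i differs
    from j, the sign comes from the one inversion between i and j that is gained or lost. *)
Lemma contr_gen i j x : contr i (wedge (gen F j) x) =
  escale (i == j)%:R x - wedge (gen F j) (contr i x).
Proof.
apply/ffunP=> S; rewrite addE oppE escaleE contrE !wedge_genE.
have [<-|nij] := eqVneq i j.
  rewrite setU11 mul1r; case: ifP => iS.
    rewrite contrE setD11 setD1K // (nltDU i iS) ltnn add0n mulrA -expr2 sqrr_sign mul1r.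
    by rewrite subrr.
  rewrite subr0 setU1K ?iS // nltU ?iS // ltnn add0n mulrA -expr2 sqrr_sign mul1r //.
rewrite mul0r add0r !inE (eq_sym j) (negPf nij) /=.
case: (boolP (j \in S)) => jS; last by rewrite mulr0 oppr0; case: ifP.
rewrite contrE !inE nij /=; case: ifP => iS; first by rewrite mulr0 oppr0.
have -> : (i |: S) :\ j = i |: S :\ j.
  by apply/setP=> k; rewrite !inE; case: (eqVneq k i) => // ->; rewrite nij.
rewrite (nltDU i jS) nltU ?iS // !exprD.
by case: (ltngtP i j) nij => [_ _|_ _|/val_inj->]; rewrite ?eqxx //=; ring.
Qed.

Lemma contr_homog i p x : homog p.+1 x -> homog p (contr i x).
Proof.
move=> hx S nS; rewrite contrE; case: ifPn => // iS.
by rewrite hx ?mulr0 // cardsU1 iS.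
Qed.

Lemma homog0E x : homog 0 x -> x = escale (x set0) (ext1 F n).
Proof.
move=> hx; apply/ffunP=> S; rewrite !ffunE; case: eqP => [->|/eqP nS].
  by rewrite mulr1.
by rewrite mulr0; apply: hx; rewrite cards_eq0; exact: nS.
Qed.

Definition leibniz (d : E -> E) := forall x y, d (wedge x y) = wedge (d x) y + wedge (grade_inv x) (d y).

Lemma leibniz1 d : is_linear_map d -> leibniz d -> d (ext1 F n) = 0.
Proof.
move=> dl dM; apply: (@addrI _ (d (ext1 F n))).
by rewrite addr0 -{3}(wedge1l (ext1 F n)) dM inv1 wedge1r wedge1l.
Qed.

Lemma leibniz_gen d i x : leibniz d ->
  d (wedge (gen F i) x) = wedge (d (gen F i)) x - wedge (gen F i) (d x).
Proof. by move->; rewrite (inv_homog (@gen_homog F n i)) wedgeZl escaleN1. Qed.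

Lemma cdga_leibniz d : is_cdga_differential d -> leibniz d.
Proof.
case=> dl _ dM _; have inv0 := lin0 inv_lin.
have gM p x y : homog p x -> d (wedge x y) = wedge (d x) y + wedge (grade_inv x) (d y).
  by move=> hx; rewrite (dM p) // (inv_homog hx) wedgeZl.
move=> x y; rewrite [x]ext_sum wedge_suml !(lin_sum dl) (lin_sum inv_lin) !wedge_suml -big_split.
by apply: eq_bigr => S _ /=; apply: (gM #|S|); apply/homogZ/mono_homog.
Qed.

Section Build.
Variable w : 'I_n -> E.
Hypothesis w2 : forall i, homog 2 (w i).

(** The derivation that sends the i-th generator to [w i], written with contractions so that
    linearity and the degree shift need no choice of monomials. *)
Definition extder x : E := \sum_i wedge (w i) (contr i x).

Lemma extder_lin : is_linear_map extder.
Proof.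
move=> a x y; rewrite /extder escale_sum -big_split; apply: eq_bigr => i _ /=.
by rewrite contr_lin wedgeDr wedgeZr.
Qed.

Lemma extder_mul_gen i x : extder (wedge (gen F i) x) = wedge (w i) x - wedge (gen F i) (extder x).
Proof.
rewrite /extder wedge_sumr (eq_bigr (fun j => escale (j == i)%:R (wedge (w j) x)
   - wedge (gen F i) (wedge (w j) (contr j x)))) => [|j _]; last first.
  rewrite contr_gen wedgeDr wedgeZr wedgeNr !wedgeA; congr (_ - wedge _ _).
  by rewrite wedge_gen_r (inv_homog (w2 j)) sqrrN expr1n escale1.
rewrite big_split sumrN (bigD1 i) //= eqxx escale1 big1 ?addr0 // => j /negPf->.
exact: escale0.
Qed.

Lemma extder1 : extder (ext1 F n) = 0.
Proof. by rewrite /extder big1 // => i _; rewrite contr1 wedge0r. Qed.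

Lemma extder_gen i : extder (gen F i) = w i.
Proof. by rewrite -[gen F i in LHS]wedge1r extder_mul_gen extder1 wedge0r subr0 wedge1r. Qed.

Lemma extder_leibniz : leibniz extder.
Proof.
move=> x y; elim/ext_ind: x => [a x z Px Pz||i x Px].
- by rewrite extder_lin inv_lin !wedgeDl !wedgeZl extder_lin Px Pz escaleDr addrACA.
- by rewrite extder1 inv1 wedge0l add0r !wedge1l.
- rewrite -wedgeA !extder_mul_gen Px inv_gen wedgeDr wedgeDl !wedgeNl !wedgeA opprD.
  by rewrite addrA.
Qed.

Lemma extder_homog p x : homog p x -> homog p.+1 (extder x).
Proof.
move=> hx; apply: homog_sum => i _; case: p hx => [/homog0E->|p hx].
  by rewrite (linZ (contr_lin i)) contr1 escaler0 wedge0r; apply: homog0.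
by rewrite -[p.+2]/(2 + p)%N; apply: homogM => //; apply: contr_homog.
Qed.

(** The square of an odd derivation is again a derivation, so it vanishes as soon as it vanishes on
    the generators. *)
Lemma extder_cdga : (forall i, extder (w i) = 0) -> is_cdga_differential extder.
Proof.
move=> dw; split; [exact: extder_lin | exact: extder_homog | | ].
  by move=> p x y hx; rewrite extder_leibniz (inv_homog hx) wedgeZl.
elim/ext_ind => [a x y Px Py||i x Px].
- by rewrite !extder_lin Px Py escaler0 addr0.
- by rewrite extder1 (lin0 extder_lin).
rewrite extder_mul_gen -escaleN1 addrC extder_lin extder_mul_gen Px wedge0r subr0.
rewrite extder_leibniz dw wedge0l add0r (inv_homog (w2 i)) sqrrN expr1n escale1.
by rewrite escaleN1 addNr.
Qed.
End Build.

End Derivation.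

(** * Algebra morphisms given by matrices on degree 1 *)

Section Morphism.
Variables (F : fieldType) (n : nat).
Hypothesis two_neq0 : (2%:R : F) != 0.
Local Notation E := (ext F n).
Implicit Types (x y z : E) (S : {set 'I_n}) (a : F) (i j : 'I_n) (u v : 'rV[F]_n) (P Q : 'M[F]_n).

Definition lform u : E := \sum_i escale (u 0 i) (gen F i).

Lemma lformE u i : lform u [set i] = u 0 i.
Proof.
rewrite /lform sum_ffunE (bigD1 i) //= big1 ?addr0 => [|j nij]; rewrite !ffunE.
  by rewrite eqxx mulr1.
by rewrite (inj_eq set1_inj) eq_sym (negPf nij) mulr0.
Qed.

Lemma lform_homog u : homog 1 (lform u).
Proof. by apply: homog_sum => i _; apply/homogZ/gen_homog. Qed.

Lemma homog1E x : homog 1 x -> x = lform (\row_i x [set i]).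
Proof.
move=> hx; apply/ffunP=> S; have [/cards1P[i ->]|nS] := boolP (#|S| == 1)%N.
  by rewrite lformE mxE.
by rewrite hx // (lform_homog _ nS).
Qed.

Lemma lform_lin a u v : lform (a *: u + v) = escale a (lform u) + lform v.
Proof.
rewrite /lform escale_sum -big_split; apply: eq_bigr => i _ /=.
by rewrite !mxE escaleDl escaleA.
Qed.

Lemma lform_delta i : lform (delta_mx 0 i) = gen F i.
Proof.
rewrite /lform (bigD1 i) //= mxE !eqxx escale1 big1 ?addr0 // => j nij.
by rewrite mxE eqxx (negPf nij) escale0.
Qed.

Lemma lform_mul u P : lform (u *m P) = \sum_i escale (u 0 i) (lform (row i P)).
Proof.
rewrite /lform; under eq_bigr do rewrite mxE.
under [RHS]eq_bigr do rewrite escale_sum.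
rewrite exchange_big /=; apply: eq_bigr => j _.
apply/ffunP=> S; rewrite sum_ffunE escaleE mulr_suml; apply: eq_bigr => i _.
by rewrite !escaleE mxE mulrA.
Qed.

Lemma lform_anti u v : wedge (lform u) (lform v) = - wedge (lform v) (lform u).
Proof.
rewrite /lform !wedge_suml -sumrN; under eq_bigr do rewrite wedge_sumr.
under [RHS]eq_bigr do rewrite wedge_sumr -sumrN.
rewrite exchange_big; apply: eq_bigr => i _; apply: eq_bigr => j _ /=.
by rewrite !wedgeZl !wedgeZr gen_anti -!escaleN1 !escaleA; congr escale; ring.
Qed.

(** Anticommutativity makes the square equal to its own opposite, and 2 is invertible. *)
Lemma lform_sqr u : wedge (lform u) (lform u) = 0.
Proof.
apply/ffunP=> S; have /ffunP/(_ S) := lform_anti u u; rewrite oppE => /eqP.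
by rewrite -subr_eq0 opprK -mulr2n -mulr_natl mulf_eq0 (negPf two_neq0) /= => /eqP->; rewrite ffunE.
Qed.

Section Extension.
Variable P : 'M[F]_n.
Local Notation p i := (lform (row i P)).

Definition wprod (s : seq 'I_n) : E := foldr (fun i x => wedge (p i) x) (ext1 F n) s.

Fixpoint insert i (s : seq 'I_n) : seq 'I_n :=
  if s is j :: s' then (if (i < j)%N then i :: s else j :: insert i s') else [:: i].

(** Moving the new factor to its sorted place crosses exactly the factors of smaller index, at the
    cost of one sign each. The second alternative stands for a sortedness hypothesis on [s]. *)
Lemma wprod_insert i s : i \notin s ->
  wedge (p i) (wprod s) = escale ((-1) ^+ count (fun j : 'I_n => (j < i)%N) s) (wprod (insert i s))
  \/ ~~ sorted ltn (map val s).
Proof.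
elim: s => [|j s IH]; first by left; rewrite /= escale1.
rewrite inE negb_or => /andP[nij nis] /=.
case: (boolP (path ltn (val j) (map val s))) => js; last by right.
left; case: (ltnP i j) => ij /=.
  rewrite ltnNge (ltnW ij) /= (eq_in_count (a2 := pred0)) ?count_pred0 ?escale1 //.
  move=> k ks /=; apply/negbTE; rewrite -leqNgt; apply: ltnW; apply: (ltn_trans ij).
  by have /order_path_min/allP/(_ (val k)) := js; apply; [exact: ltn_trans | exact: map_f].
have ji : (j < i)%N by rewrite ltn_neqAle ij andbT; apply: contra nij => /eqP/val_inj->.
rewrite ji /= wedgeA lform_anti wedgeNl -wedgeA.
case: (IH nis) => [->|]; last by rewrite (path_sorted js).
by rewrite wedgeZr -escaleN1 escaleA -exprS.
Qed.

Lemma wprod_mem i s : i \in s -> wedge (p i) (wprod s) = 0.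
Proof.
elim: s => //= j s IH; rewrite inE => /orP[/eqP<-|/IH eq0].
  by rewrite wedgeA lform_sqr wedge0l.
by rewrite wedgeA lform_anti wedgeNl -wedgeA eq0 wedge0r oppr0.
Qed.

Lemma sorted_enum S : sorted ltn (map val (enum S)).
Proof.
have -> : enum S = [seq i <- enum 'I_n | i \in S] by rewrite enumT.
rewrite sorted_map; apply: sorted_filter; first by move=> a b c; apply: ltn_trans.
by have := iota_ltn_sorted 0 n; rewrite -val_enum_ord sorted_map.
Qed.

Lemma mem_insert i s : insert i s =i i :: s.
Proof.
elim: s => //= j s IH k; case: ifP => // _.
by rewrite inE IH !inE orbCA.
Qed.

Lemma path_insert i j s : (j < i)%N -> i \notin s ->
  path ltn j (map val s) -> path ltn j (map val (insert i s)).
Proof.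
elim: s j => [|k s IH] j ji /=; first by rewrite ji.
rewrite inE negb_or => /andP[nik nis] /andP[jk ks].
case: (ltnP i k) => ik /=; first by rewrite ji ik.
by rewrite jk IH // ltn_neqAle ik andbT; apply: contra nik => /eqP/val_inj->.
Qed.

Lemma sorted_insert i s : i \notin s ->
  sorted ltn (map val s) -> sorted ltn (map val (insert i s)).
Proof.
case: s => //= j s; rewrite inE negb_or => /andP[nij nis] js.
case: (ltnP i j) => ij /=; first by rewrite ij.
by apply: path_insert => //; rewrite ltn_neqAle ij andbT; apply: contra nij => /eqP/val_inj->.
Qed.

Lemma enum_setU1 i S : i \notin S -> enum (i |: S) = insert i (enum S).
Proof.
move=> iS; apply: (inj_map val_inj); apply: (irr_sorted_eq ltn_trans ltnn).
- exact: sorted_enum.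
- by apply: sorted_insert (sorted_enum _); rewrite mem_enum.
move=> k; apply/mapP/mapP => -[j jS ->]; exists j => //; move: jS.
  by rewrite mem_insert inE !mem_enum !inE.
by rewrite mem_insert inE !mem_enum !inE.
Qed.

(** The multiplicative extension of the linear map whose matrix, acting on row vectors, is [P]; a
    monomial goes to the product of the images in increasing order. *)
Definition aext x : E := \sum_S escale (x S) (wprod (enum S)).

Lemma aext_lin : is_linear_map aext.
Proof.
move=> a x y; rewrite /aext escale_sum -big_split; apply: eq_bigr => S _ /=.
by rewrite !ffunE escaleDl escaleA.
Qed.

Lemma aext_mono S : aext (mono F S) = wprod (enum S).
Proof.
rewrite /aext (bigD1 S) //= ffunE eqxx escale1 big1 ?addr0 // => T /negPf nT.
by rewrite ffunE nT escale0.
Qed.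

Lemma aext1 : aext (ext1 F n) = ext1 F n.
Proof. by rewrite ext1E aext_mono enum_set0. Qed.

Lemma aext_mul_gen i x : aext (wedge (gen F i) x) = wedge (p i) (aext x).
Proof.
rewrite [x]ext_sum wedge_sumr !(lin_sum aext_lin) wedge_sumr; apply: eq_bigr => S _.
rewrite wedgeZr !(linZ aext_lin) wedgeZr; congr escale.
rewrite wedge_gen_mono aext_mono; case: ifPn => iS.
  by rewrite (lin0 aext_lin) wprod_mem // mem_enum.
rewrite (linZ aext_lin) aext_mono enum_setU1 //.
case: (@wprod_insert i (enum S)); rewrite ?mem_enum ?sorted_enum // => ->.
congr (escale (_ ^+ _) _); rewrite /nlt cardE -size_filter.
have -> : enum [set j in S | (j < i)%N] = [seq j <- enum 'I_n | (j \in S) && (j < i)%N].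
  by rewrite enumT -[LHS]/(filter _ (Finite.enum _)); apply: eq_filter => j; rewrite !inE.
have -> : enum S = [seq j <- enum 'I_n | j \in S] by rewrite enumT.
by rewrite -[in RHS]filter_predI; congr (size _); apply: eq_filter => j /=; rewrite andbC.
Qed.

Lemma aextM x y : aext (wedge x y) = wedge (aext x) (aext y).
Proof.
elim/ext_ind: x => [a x z Px Pz||i x Px].
- by rewrite wedgeDl wedgeZl !aext_lin Px Pz wedgeDl wedgeZl.
- by rewrite aext1 !wedge1l.
- by rewrite -wedgeA !aext_mul_gen Px wedgeA.
Qed.

Lemma aext_gen i : aext (gen F i) = p i.
Proof. by rewrite -[gen F i]wedge1r aext_mul_gen aext1 wedge1r. Qed.

Lemma aext_lform u : aext (lform u) = lform (u *m P).
Proof.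
rewrite /lform (lin_sum aext_lin) -/(lform _) lform_mul; apply: eq_bigr => i _.
by rewrite (linZ aext_lin) aext_gen.
Qed.

Lemma wprod_homog s : homog (size s) (wprod s).
Proof.
elim: s => [|i s IH] /=; first exact: homog1.
by rewrite -add1n; apply: homogM => //; apply: lform_homog.
Qed.

Lemma aext_homog q x : homog q x -> homog q (aext x).
Proof.
move=> hx; apply: homog_sum => S _.
have [<-|/hx->] := eqVneq #|S| q; last by rewrite escale0; apply: homog0.
by apply: homogZ; rewrite cardE; apply: wprod_homog.
Qed.

End Extension.

Lemma aextK P Q : P *m Q = 1%:M -> cancel (aext P) (aext Q).
Proof.
move=> PQ; elim/ext_ind => [a x y Px Py||i x Px].
- by rewrite !aext_lin Px Py.
- by rewrite !aext1.
rewrite aextM aextM Px aext_gen aext_lform -row_mul PQ row1 lform_delta //.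
Qed.

(** Both composites obey the same twisted Leibniz rule, so agreement on the generators spreads to
    the whole algebra by [ext_ind]. *)
Lemma aext_iso P (d d' : E -> E) : P \in unitmx ->
  is_linear_map d -> is_linear_map d' -> leibniz d -> leibniz d' ->
  (forall i, aext P (d (gen F i)) = d' (aext P (gen F i))) -> dga_iso d d'.
Proof.
move=> uP dl dl' dM dM' dd'; exists (aext P); split.
- split; first exact: aext_lin.
  by exists (aext (invmx P)); apply: aextK; rewrite ?mulmxV ?mulVmx.
- exact: aext1.
- exact: aextM.
- exact: aext_homog.
elim/ext_ind => [a x y Px Py||i x Px].
- by rewrite dl !aext_lin dl' Px Py.
- by rewrite !aext1 !leibniz1 // (lin0 (aext_lin P)).
rewrite leibniz_gen // (linD (aext_lin P)) (linN (aext_lin P)) !aextM dd' Px.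
by rewrite dM' aext_gen (inv_homog (lform_homog _)) wedgeZl escaleN1.
Qed.

(** An isomorphism preserves degree and products, hence is the extension of its matrix on degree 1;
    that matrix is invertible because a kernel vector would give a 1-form mapped to zero. *)
Lemma iso_matrix (d d' : E -> E) : dga_iso d d' ->
  exists2 P, P \in unitmx & forall i, aext P (d (gen F i)) = d' (lform (row i P)).
Proof.
case=> phi [[pl pbij] p1 pM ph pd].
pose P := \matrix_(i, j) phi (gen F i) [set j].
have pgen i : phi (gen F i) = lform (row i P).
  rewrite [LHS]homog1E; last exact/ph/gen_homog.
  by congr lform; apply/rowP=> j; rewrite !mxE.
have pE : phi =1 aext P.
  elim/ext_ind => [a x y Px Py||i x Px].
  - by rewrite pl aext_lin Px Py.
  - by rewrite p1 aext1.
  by rewrite pM aextM Px pgen aext_gen.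
exists P; last by move=> i; rewrite -pE pd pgen.
rewrite -row_free_unit -kermx_eq0; apply/rowV0P => u /sub_kermxP uP.
have : phi (lform u) = phi 0 by rewrite pE aext_lform uP (lin0 pl) /lform big1 // => i _; rewrite mxE escale0.
by move/(bij_inj pbij)/ffunP => u0; apply/rowP=> i; have := u0 [set i]; rewrite lformE !(ffunE, mxE).
Qed.
End Morphism.

(** * Presentations by lists of monomials *)

Section Presentation.
Variable F : fieldType.
Hypothesis two_neq0 : (2%:R : F) != 0.
Local Notation E := (ext F 6).
Local Notation form := (seq (nat * nat * F)).
Local Notation lin := (seq (nat * F)).
Implicit Types (l : form) (u : lin) (s : seq form) (p q r i j k : nat).

(** Generators are indexed by natural numbers so that coefficients of concrete presentations can be
    obtained by plain reduction. *)
Definition e k : E := gen F (inord k : 'I_6).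

Definition fval l : E := \sum_(t <- l) escale t.2 (wedge (e t.1.1) (e t.1.2)).
Definition lval u : E := \sum_(t <- u) escale t.2 (e t.1).

Definition alg s : E -> E := extder (fun i : 'I_6 => fval (nth [::] s i)).

(** The coefficient is antisymmetrized and sums repeated monomials, so lists produced by
    substitution need no normalization. *)
Fixpoint coef l p q : F :=
  if l is (j, k, a) :: l' then
    if eqn j p && eqn k q then a + coef l' p q
    else if eqn j q && eqn k p then coef l' p q - a else coef l' p q
  else 0.

Fixpoint lcoef u j : F :=
  if u is (i, a) :: u' then if eqn i j then a + lcoef u' j else lcoef u' j else 0.

Definition bounded m l := all (fun t => (t.1.1 < m) && (t.1.2 < m))%N l.
Definition lbounded m u := all (fun t : nat * F => t.1 < m)%N u.

Lemma inord_eq i j : (i < 6)%N -> (j < 6)%N -> ((inord i : 'I_6) == inord j) = eqn i j.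
Proof. by move=> hi hj; rewrite -val_eqE /= !inordK. Qed.

Lemma wedge_gen2 (i a b : 'I_6) (y : E) : (a < b)%N ->
  wedge (gen F i) y [set a; b] = (i == a)%:R * y [set b] - (i == b)%:R * y [set a].
Proof.
move=> ab; have nab : a != b by rewrite -val_eqE /= neq_ltn ab.
rewrite wedge_genE !inE; case: (eqVneq i a) => [->|nia] /=.
  rewrite (negPf nab) mul0r subr0 mul1r setU1K ?inE //.
  rewrite /nlt (eq_card0 (A := _)) ?mul1r // => j; rewrite !inE.
  by case: eqP => [->|_]; [rewrite ltnn | case: eqP => [->|]; rewrite // ltnNge (ltnW ab)].
case: (eqVneq i b) => [->|nib] /=; last by rewrite !mul0r subrr.
rewrite mul0r sub0r mul1r setUC setU1K ?inE 1?eq_sym //.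
rewrite /nlt (eq_card (B := [set a])) ?cards1 ?mulN1r // => j; rewrite !inE.
have [->|nja] := eqVneq j a; first by rewrite orbT ab.
by have [->|//] := eqVneq j b; rewrite ltnn andbF.
Qed.

Lemma wedge_gen3 (i a b c : 'I_6) (y : E) : (a < b)%N -> (b < c)%N ->
  wedge (gen F i) y [set a; b; c] =
  (i == a)%:R * y [set b; c] - (i == b)%:R * y [set a; c] + (i == c)%:R * y [set a; b].
Proof.
move=> ab bc; have ac := ltn_trans ab bc.
have [nab nac nbc] : [/\ a != b, a != c & b != c] by rewrite -!val_eqE /= !neq_ltn ab ac bc.
have lt3 : nlt [set a; b; c] a = 0%N /\ nlt [set a; b; c] b = 1%N /\ nlt [set a; b; c] c = 2%N.
  split; [|split].
  - apply: eq_card0 => j; rewrite !inE; apply/negP => /andP[/orP[/orP[]|] /eqP->]; rewrite ?ltnn //;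
    by rewrite ltnNge ltnW.
  - rewrite -[RHS](cards1 a); apply: eq_card => j; rewrite !inE; apply/andP/eqP => [[]|->]; last by rewrite eqxx.
    by case/orP=> [/orP[]|] /eqP-> //; rewrite ?ltnn // ltnNge ltnW.
  - transitivity #|[set a; b]|; last by rewrite cards2 nab.
    apply: eq_card => j; rewrite !inE; apply/andP/orP => [[]|[]/eqP->]; rewrite ?eqxx ?orbT //.
    by case/orP=> [/orP[]|] /eqP-> //; rewrite ?eqxx ?ltnn; auto.
rewrite wedge_genE !inE; case: (eqVneq i a) => [->|nia] /=.
  rewrite (negPf nab) (negPf nac) lt3.1 !mul0r subr0 addr0 !mul1r; congr (y _).
  by apply/setP=> j; rewrite !inE; case: (eqVneq j a) => // ->; rewrite (negPf nab) (negPf nac).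
case: (eqVneq i b) => [->|nib] /=.
  rewrite (negPf nbc) lt3.2.1 !mul0r addr0 sub0r expr1 mulN1r mul1r; congr (- y _).
  by apply/setP=> j; rewrite !inE; have [->|_] := eqVneq j b; rewrite /= ?orbF // [b == a]eq_sym (negPf nab) (negPf nbc).
case: (eqVneq i c) => [->|nic] /=; last by rewrite !mul0r subrr addr0.
rewrite lt3.2.2 !mul0r subrr add0r sqrrN expr1n !mul1r; congr (y _).
by apply/setP=> j; rewrite !inE; have [->|_] := eqVneq j c; rewrite /= ?orbF // ![c == _]eq_sym (negPf nac) (negPf nbc).
Qed.

Lemma deg2_eq (x y : E) : homog 2 x -> homog 2 y ->
  (forall p q, (p < q)%N -> (q < 6)%N ->
    x [set inord p; inord q] = y [set inord p; inord q]) -> x = y.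
Proof.
move=> hx hy xy; apply/ffunP=> S; case: (boolP (#|S| == 2)%N) => [/cards2P[a [b [nab ->]]]|nS]; last first.
  by rewrite (hx _ nS) (hy _ nS).
wlog ab : a b nab / (a < b)%N.
  move=> IH; case: (ltngtP a b) (nab) => [/IH->//|ba|/val_inj->]; last by rewrite eqxx.
  by rewrite setUC => _; apply: IH; rewrite 1?eq_sym.
by have := xy a b ab (ltn_ord b); rewrite !inord_val.
Qed.

Lemma fval_homog l : homog 2 (fval l).
Proof.
by apply: homog_sum => t _; apply/homogZ/(homogM (p := 1) (q := 1)); apply: gen_homog.
Qed.

Lemma fval_cons t l : fval (t :: l) = escale t.2 (wedge (e t.1.1) (e t.1.2)) + fval l.
Proof. by rewrite /fval big_cons. Qed.

Lemma genE (i a : 'I_6) : gen F i [set a] = (i == a)%:R.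
Proof. by rewrite ffunE (inj_eq set1_inj) eq_sym. Qed.

Lemma ltn_inord p q : (p < q)%N -> (q < 6)%N -> ((inord p : 'I_6) < (inord q : 'I_6))%N.
Proof. by move=> pq q6; rewrite !inordK // (ltn_trans pq). Qed.

Lemma fval_coef l p q : bounded 6 l -> (p < q)%N -> (q < 6)%N ->
  fval l [set inord p; inord q] = coef l p q.
Proof.
move=> bl pq q6; have p6 := ltn_trans pq q6.
elim: l bl => [|[[j k] a] l IH] /=; first by rewrite /fval big_nil ffunE.
move=> /andP[/andP[j6 k6] bl]; rewrite fval_cons addE escaleE IH //.
rewrite wedge_gen2 ?ltn_inord // !genE !inord_eq //.
case: (@eqnP j p) => [->|] /=.
  rewrite (_ : eqn p q = false) /=; last by apply/eqnP=> E; rewrite E ltnn in pq.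
  case: (@eqnP k q) => [->|_] /=; ring.
by move=> _; case: (@eqnP j q) => _ /=; case: (@eqnP k p) => _ /=; ring.
Qed.

Lemma coef_bound m l p q : bounded m l -> (m <= q)%N -> coef l p q = 0.
Proof.
move=> bl mq; elim: l bl => [|[[j k] a] l IH] //= /andP[/andP[jm km] /IH->].
have nq x : (x < m)%N -> eqn x q = false.
  by move=> xm; apply/eqnP=> E; move: xm; rewrite E ltnNge mq.
by rewrite !nq // andbF.
Qed.

Lemma bounded_le m m' l : (m <= m')%N -> bounded m l -> bounded m' l.
Proof.
by move=> mm; apply: sub_all => t /andP[a b]; rewrite (leq_trans a) ?(leq_trans b).
Qed.

Lemma fval_eq l l' : bounded 6 l -> bounded 6 l' ->
  (forall p q, (p < q)%N -> (q < 6)%N -> coef l p q = coef l' p q) -> fval l = fval l'.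
Proof.
move=> bl bl' ll'; apply: deg2_eq; try exact: fval_homog.
by move=> p q pq q6; rewrite !fval_coef // ll'.
Qed.
End Presentation.

(** * Base changes of partially normalized algebras *)

Section BaseChange.
Variable F : fieldType.
Hypothesis two_neq0 : (2%:R : F) != 0.
Local Notation E := (ext F 6).
Local Notation form := (seq (nat * nat * F)).
Local Notation lin := (seq (nat * F)).
Local Notation subst := (seq (nat * lin)).
Implicit Types (l : form) (u : lin) (s : seq form) (p q r i j k : nat) (P Q : subst).

(* A substitution lists the images of the generators it moves. *)
Fixpoint img P i : lin :=
  if P is (j, u) :: P' then if eqn j i then u else img P' i else [:: (i, 1)].

Definition pull P l : form :=
  flatten [seq [seq (x.1, y.1, t.2 * (x.2 * y.2)) | x <- img P t.1.1, y <- img P t.1.2] | t <- l].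
(** The differential of the linear form [u] in the presentation [s]. *)
Definition comb u s : form :=
  flatten [seq [seq (t.1, x.2 * t.2) | t <- nth [::] s x.1] | x <- u].
Definition lcomb u P : lin :=
  flatten [seq [seq (y.1, x.2 * y.2) | y <- img P x.1] | x <- u].

Definition sbounded m P := all (fun r : nat * lin => (r.1 < m)%N && lbounded m r.2) P.

Definition smx P : 'M[F]_6 := \matrix_(i, j) lcoef (img P i) j.

Lemma sbounded_le m m' P : (m <= m')%N -> sbounded m P -> sbounded m' P.
Proof.
move=> mm; apply: sub_all => r /andP[a b]; rewrite (leq_trans a) //=.
by apply: sub_all b => x xm; apply: leq_trans mm.
Qed.

Lemma img_bounded m P i : sbounded m P -> (i < m)%N -> lbounded m (img P i).
Proof.
move=> + im; elim: P => [|[j u] P IH] /=; first by rewrite im.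
by case/andP=> /andP[jm bu] bP; case: ifP => // _; apply: IH.
Qed.

Lemma img_id m P i : sbounded m P -> (m <= i)%N -> img P i = [:: (i, 1)].
Proof.
move=> + im; elim: P => [|[j u] P IH] //= /andP[/andP[jm _] /IH->].
case: (@eqnP j i) => // ji; by move: jm; rewrite ji ltnNge im.
Qed.

Lemma lval_lform u : lbounded 6 u -> lval u = lform (\row_(j < 6) lcoef u j).
Proof.
elim: u => [|[i a] u IH] /=.
  by move=> _; rewrite /lval /lform big_nil big1 // => i _; rewrite mxE escale0.
move=> /andP[i6 bu]; rewrite /lval big_cons -/(lval u) IH // /e -lform_delta -lform_lin; congr lform.
apply/rowP=> j; rewrite !mxE eqxx /=; case: (@eqnP i j) => ij.
  by rewrite -(inj_eq val_inj) /= inordK // ij eqxx mulr1.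
by rewrite -(inj_eq val_inj) /= inordK // eq_sym; case: eqP => // _; rewrite mulr0 add0r.
Qed.

Lemma row_smx P i : (i < 6)%N -> row (inord i) (smx P) = \row_j lcoef (img P i) j.
Proof. by move=> i6; apply/rowP=> j; rewrite !mxE inordK. Qed.

Lemma aext_e P i : sbounded 6 P -> (i < 6)%N -> aext (smx P) (e F i) = lval (img P i).
Proof.
by move=> bP i6; rewrite aext_gen // lval_lform ?img_bounded // row_smx.
Qed.

Lemma fval_cat l l' : fval (l ++ l') = fval l + fval l'.
Proof. by rewrite /fval big_cat. Qed.

Lemma fval_map c (G : nat * nat * F -> nat * nat * F) l :
  (forall t, (G t).1 = t.1 /\ (G t).2 = c * t.2) -> fval (map G l) = escale c (fval l).
Proof.
move=> hG; rewrite /fval big_map escale_sum; apply: eq_bigr => t _.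
by have [-> ->] := hG t; rewrite escaleA.
Qed.

Lemma aext_pull P l : sbounded 6 P -> bounded 6 l -> aext (smx P) (fval l) = fval (pull P l).
Proof.
move=> bP; elim: l => [|[[j k] a] l IH] /=; first by rewrite /fval !big_nil (lin0 (aext_lin _)).
move=> /andP[/andP[j6 k6] bl]; rewrite fval_cons (linD (aext_lin _)) (linZ (aext_lin _)) aextM //.
rewrite !aext_e // IH // /pull /= fval_cat; congr (_ + _).
rewrite /lval /fval big_allpairs_dep /= wedge_suml escale_sum; apply: eq_bigr => x _.
rewrite wedge_sumr escale_sum; apply: eq_bigr => y _.
by rewrite wedgeZl wedgeZr !escaleA mulrA.
Qed.

Lemma pull_bounded m P l : sbounded m P -> bounded m l -> bounded m (pull P l).
Proof.
move=> bP bl; apply/allP => t /flattenP[l' /mapP[t' t'l ->]] /allpairsP[[x y] [xP yP ->]] /=.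
have /andP[j6 k6] := allP bl _ t'l.
by rewrite (allP (img_bounded bP j6) _ xP) (allP (img_bounded bP k6) _ yP).
Qed.

Lemma comb_bounded m u s : all (bounded m) s -> bounded m (comb u s).
Proof.
move=> bs; apply/allP => t /flattenP[l' /mapP[x xu ->]] /mapP[t' t'l ->] /=.
have [xs|xs] := ltnP x.1 (size s); last by rewrite nth_default in t'l.
exact: (allP (allP bs _ (mem_nth _ xs)) _ t'l).
Qed.

Lemma alg_lin s : is_linear_map (alg s).
Proof. exact: extder_lin. Qed.

Lemma alg_leibniz s : leibniz (alg s).
Proof. by apply: extder_leibniz => i; apply: fval_homog. Qed.

Lemma alg_e s i : (i < 6)%N -> alg s (e F i) = fval (nth [::] s i).
Proof. by move=> i6; rewrite /alg extder_gen ?inordK // => j; apply: fval_homog. Qed.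

Lemma alg_lval s u : lbounded 6 u -> alg s (lval u) = fval (comb u s).
Proof.
elim: u => [|[i a] u IH] /=; first by rewrite /fval /lval !big_nil (lin0 (alg_lin _)).
move=> /andP[i6 bu]; rewrite /lval big_cons (alg_lin s) -/(lval u) IH // alg_e //=.
by rewrite /comb /= fval_cat (@fval_map a).
Qed.

Lemma lcoef_cat u u' j : lcoef (u ++ u') j = lcoef u j + lcoef u' j.
Proof. by elim: u => [|[i a] u IH] /=; rewrite ?add0r // IH; case: ifP => _; rewrite ?addrA. Qed.

Lemma lcoef_scale c u j : lcoef [seq (y.1, c * y.2) | y <- u] j = c * lcoef u j.
Proof. by elim: u => [|[i a] u IH] /=; rewrite ?mulr0 // IH; case: ifP => _; rewrite ?mulrDr. Qed.

Lemma lcoef_bound m u j : lbounded m u -> (m <= j)%N -> lcoef u j = 0.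
Proof.
move=> bu mj; elim: u bu => [|[i a] u IH] //= /andP[im /IH->].
by case: (@eqnP i j) => // ij; move: im; rewrite ij ltnNge mj.
Qed.

Lemma lcoef_lcomb P Q i (j : 'I_6) : sbounded 6 P -> (i < 6)%N ->
  lcoef (lcomb (img P i) Q) j = \sum_k smx P (inord i) k * smx Q k j.
Proof.
move=> bP i6; under eq_bigr => k _ do rewrite !mxE inordK //.
have := img_bounded bP i6; elim: (img P i) => [|[k a] u IH] /=.
  by rewrite big1 // => k _; rewrite mul0r.
move=> /andP[k6 bu]; rewrite /lcomb /= lcoef_cat lcoef_scale -/(lcomb u Q) IH //.
rewrite (bigD1 (inord k)) //= [in RHS](bigD1 (inord k)) //= inordK // /= !eqnE eqxx mulrDl addrA.
congr (_ + _ + _); apply: eq_bigr => k' nk; case: eqP => // E.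
by case/eqP: nk; apply: val_inj; rewrite /= E inordK.
Qed.

Lemma dga_iso_trans n (d1 d2 d3 : ext F n -> ext F n) :
  dga_iso d1 d2 -> dga_iso d2 d3 -> dga_iso d1 d3.
Proof.
move=> [f [[fl fb] f1 fM fh fd]] [g [[gl gb] g1 gM gh gd]]; exists (g \o f); split => /=.
- by split; [move=> a x y /=; rewrite fl gl | apply: bij_comp].
- by rewrite f1.
- by move=> x y; rewrite fM gM.
- by move=> p x hx; apply/gh/fh.
- by move=> x; rewrite fd gd.
Qed.

Definition gform k (a : nat -> nat -> F) : form := [seq (j, i, a j i) | i <- iota 0 k, j <- iota 0 i].
Definition tail k (a : nat -> nat -> nat -> F) : seq form := [seq gform i (a i) | i <- iota k (6 - k)].

(* The first k generators are in normal form, the remaining ones only triangular. *)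
Definition approx k s d := exists a, dga_iso d (alg (s ++ tail k a)).

Lemma coef_cat l l' p q : coef (l ++ l') p q = coef l p q + coef l' p q.
Proof.
elim: l => [|[[i j] a] l IH] /=; rewrite ?add0r // IH.
by case: ifP => _; rewrite ?addrA //; case: ifP => _; rewrite // addrAC.
Qed.

Lemma coef_gform k a p q : (p < q)%N -> coef (gform k a) p q = if (q < k)%N then a p q else 0.
Proof.
have one i m : (p < q)%N -> coef [seq (j, i, a j i) | j <- iota 0 m] p q =
    if (i == q) && (p < m)%N then a p q else if (i == p) && (q < m)%N then - a q p else 0.
  move=> pq; elim: m => [|m IH]; first by rewrite /= !andbF.
  rewrite -addn1 iotaD map_cat coef_cat IH /= add0n addn1 !ltnS !eqnE [m == p]eq_sym [m == q]eq_sym.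
  rewrite (leq_eqVlt p m) (leq_eqVlt q m); case: (eqVneq p m) => [pm|_] /=.
    rewrite -pm ltnn andbF (gtn_eqF pq) /= ltnNge (ltnW pq) !andbF /= andbT.
    by case: ifP => [/eqP->|_]; rewrite ?add0r ?addr0.
  case: (eqVneq q m) => [qm|_] /=; last by rewrite addr0.
  rewrite -qm ltnn andbF pq andbT; case: eqP => [->|_] /=; last by case: eqP => [->|]; rewrite ?add0r ?addr0 ?sub0r.
  by rewrite (gtn_eqF pq) addr0.
move=> pq; elim: k => [|k IH]; first by [].
rewrite /gform -addn1 iotaD allpairs_cat coef_cat -/(gform k a) IH /= cats0 add0n addn1 one // ltnS.
case: (eqVneq k q) => [->|nkq] /=; first by rewrite ltnn leqnn pq add0r.
rewrite (leq_eqVlt q k) [q == k]eq_sym (negPf nkq) /=.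
case: (eqVneq k p) => [->|_] /=; last by rewrite addr0.
by rewrite ltnNge (ltnW pq) /= addr0.
Qed.

Lemma gform_bounded k a : bounded k (gform k a).
Proof.
apply/allP => t /allpairsPdep[i [j [ik ji ->]]] /=; move: ik ji; rewrite !mem_iota !add0n /=.
by move=> ik ji; rewrite ik (ltn_trans ji).
Qed.

Definition iso_eqs m s s' P := forall i q p, (i < m)%N -> (q < m)%N -> (p < q)%N ->
  coef (pull P (nth [::] s i)) p q = coef (comb (img P i) s') p q.
Definition inv_eqs m P Q := forall i j, (i < m)%N -> (j < m)%N ->
  lcoef (lcomb (img P i) Q) j = (i == j)%:R.

Lemma comb_cat m u s s' : lbounded m u -> size s = m -> comb u (s ++ s') = comb u s.
Proof.
move=> bu sm; rewrite /comb; congr flatten; apply/eq_in_map => x xu; rewrite nth_cat sm.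
by rewrite (allP bu _ xu).
Qed.

Lemma smx_unit m P Q : (m <= 6)%N -> sbounded m P -> sbounded m Q -> inv_eqs m P Q ->
  smx P \in unitmx.
Proof.
move=> m6 bP bQ PQ; have [] // := @mulmx1_unit _ _ (smx P) (smx Q) _.
apply/matrixP=> i j; rewrite mxE -[i]inord_val -lcoef_lcomb ?(sbounded_le m6 bP) // mxE.
rewrite inord_val -val_eqE; have [im|mi] := ltnP i m.
  have [jm|mj] := ltnP j m; first by rewrite PQ.
  rewrite (lcoef_bound (m := m)) //; first by rewrite (ltn_eqF (leq_trans im mj)).
  apply/allP=> t /flattenP[u /mapP[x xi ->]] /mapP[y yi ->] /=.
  have xm := allP (img_bounded bP im) _ xi.
  exact: (allP (img_bounded bQ xm) _ yi).
rewrite (img_id bP mi) /lcomb /= cats0 lcoef_scale mul1r (img_id bQ mi) /=.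
by rewrite eqnE; case: eqP; rewrite ?addr0.
Qed.

(** The substitution fixes the generators from m on. Their differentials are pulled back along [P],
    and since [P] mixes only the first m generators, the result still involves earlier generators
    only. *)
Lemma approx_step m s s' P Q d : (m <= 6)%N -> size s = m -> size s' = m ->
  all (bounded m) s -> all (bounded m) s' -> sbounded m P -> sbounded m Q ->
  inv_eqs m P Q -> iso_eqs m s s' P -> approx m s d -> approx m s' d.
Proof.
move=> m6 sm sm' bs bs' bP bQ PQ ss' [a da].
(* Coefficients of the remaining differentials after the substitution. *)
pose b i p q := coef (pull P (gform i (a i))) p q.
have bt c : all (bounded 6) (tail m c).
  apply/allP => l /mapP[i]; rewrite mem_iota subnKC // => /andP[_ i6] ->.
  by apply: bounded_le (gform_bounded _ _); apply: ltnW.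
have b6 : all (bounded 6) s by apply: sub_all bs => l; apply: bounded_le.
have b6' : all (bounded 6) s' by apply: sub_all bs' => l; apply: bounded_le.
have bP6 := sbounded_le m6 bP.
exists b; apply: dga_iso_trans da _.
apply: (@aext_iso _ _ two_neq0 (smx P)); try exact: alg_lin; try exact: alg_leibniz.
  exact: smx_unit PQ.
move=> i; rewrite -[i]inord_val -/(e F i) alg_e // aext_e // alg_lval ?img_bounded //.
have bi c t : all (bounded 6) t -> all (bounded 6) (t ++ tail m c) by move=> bt'; rewrite all_cat bt' bt.
rewrite aext_pull //; last first.
  have [/(mem_nth [::])/(allP (bi a _ b6))//|le] := ltnP i (size (s ++ tail m a)).
  by rewrite nth_default.
apply: fval_eq.
- apply: pull_bounded => //; have [/(mem_nth [::])/(allP (bi a _ b6))//|le] := ltnP i (size (s ++ tail m a)).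
  by rewrite nth_default.
- by apply: comb_bounded; apply: bi.
move=> p q pq q6; rewrite nth_cat sm; have [im|mi] := ltnP i m.
  rewrite (comb_cat _ (img_bounded bP im)) //; have [qm|mq] := ltnP q m; first exact: ss'.
  have bsi : bounded m (nth [::] s i) by apply: (allP bs); rewrite mem_nth ?sm.
  rewrite !(coef_bound (m := m)) //; first exact: comb_bounded.
  exact: pull_bounded.
have im6 : (i - m < 6 - m)%N by rewrite ltn_sub2r // (leq_ltn_trans mi).
rewrite (nth_map 0%N) ?size_iota // nth_iota // subnKC // (img_id bP mi).
rewrite /comb /= cats0 nth_cat sm' ltnNge mi /= (nth_map 0%N) ?size_iota // nth_iota // subnKC //.
have -> : forall l, coef [seq (t.1, 1 * t.2) | t <- l] p q = coef l p q.
  by move=> l; congr coef; rewrite -[RHS]map_id; apply: eq_map => -[x y]; rewrite mul1r.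
rewrite coef_gform //; case: ltnP => // iq.
by rewrite (coef_bound (m := i)) //; apply: pull_bounded (gform_bounded _ _); apply: sbounded_le bP.
Qed.

Lemma approx_extend m s d : (m < 6)%N -> approx m s d ->
  exists a, approx m.+1 (rcons s (gform m a)) d.
Proof.
move=> m6 [a da]; exists (a m); exists a; move: da.
by rewrite cat_rcons /tail -(subnSK m6).
Qed.

Lemma approx_full s d : approx 6 s d -> dga_iso d (alg s).
Proof. by case=> a; rewrite /tail /= cats0. Qed.

Lemma approx_start d : is_minimal_algebra d -> approx 0 [::] d.
Proof.
case=> cd [x [x1 xfree dx]].
pose X := \matrix_(i, j) x i [set j].
have xE (i : 'I_6) : x i = lform (row i X).
  by rewrite [LHS]homog1E //; congr lform; apply/rowP=> j; rewrite !mxE.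
have uX : X \in unitmx.
  rewrite -row_free_unit -kermx_eq0; apply/rowV0P => u /sub_kermxP uX.
  have u0 : \sum_i escale (u 0 i) (x i) = 0.
    transitivity (lform (u *m X)); last by rewrite uX /lform big1 // => j _; rewrite mxE escale0.
    by rewrite lform_mul; apply: eq_bigr => j _; rewrite xE.
  by apply/rowP=> j; rewrite [RHS]mxE; apply: (xfree (fun j : 'I_6 => u 0 j) u0 j).
have [c dc] := fin_all_exists dx.
have dl : is_linear_map d by case: cd.
(* [gform] lists each pair of indices once, whereas the definition of minimality sums over both
   orders. *)
pose a i p q : F := c (inord i) (inord p) (inord q) - c (inord i) (inord q) (inord p).
exists a; rewrite cat0s.
have xX (i : 'I_6) : aext (invmx X) (x i) = gen F i.
  by rewrite xE aext_lform // -row_mul mulmxV // row1 lform_delta.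
have key (i : 'I_6) : aext (invmx X) (d (x i)) = alg (tail 0 a) (gen F i).
  rewrite -[in RHS](inord_val i) -/(e F i) alg_e // (nth_map 0%N) ?size_iota // nth_iota // add0n.
  rewrite dc (lin_sum (aext_lin _)).
  under eq_bigr do rewrite (lin_sum (aext_lin _)).
  under eq_bigr => j _ do under eq_bigr => k _ do rewrite (linZ (aext_lin _)) aextM // !xX.
  apply: deg2_eq; last first.
  - move=> p q pq q6; rewrite fval_coef ?coef_gform //; last first.
      by apply: bounded_le (gform_bounded _ _); apply: ltnW.
    have p6 := ltn_trans pq q6.
    rewrite sum_ffunE; under eq_bigr do rewrite sum_ffunE.
    under eq_bigr => j _ do under eq_bigr => k _ do rewrite escaleE wedge_gen2 ?ltn_inord // !genE.
    have dsum (A B : 'I_6) : \sum_(j < 6 | (j < i)%N) \sum_(k < 6 | (k < i)%N)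
        c i j k * ((j == A)%:R * (k == B)%:R) = if (A < i)%N && (B < i)%N then c i A B else 0.
      rewrite big_mkcond (bigD1 A) //= [X in _ + X]big1 ?addr0 => [|j /negPf nj]; last first.
        by case: ifP => // _; rewrite big1 // => k _; rewrite nj mul0r mulr0.
      case: ifP => //= _; rewrite big_mkcond (bigD1 B) //= !eqxx !mulr1 big1 ?addr0 // => k /negPf nk.
      by rewrite nk !mulr0; case: ifP.
    under eq_bigr do (under eq_bigr do rewrite mulrBr; rewrite sumrB).
    rewrite sumrB; pose G A B := if (nat_of_ord A < i)%N && (nat_of_ord B < i)%N then c i A B else 0.
    transitivity (G (inord p) (inord q) - G (inord q) (inord p)).
      by congr (_ - _); apply: dsum.
    rewrite /G !inordK // [(q < i)%N && _]andbC.
    case: (ltnP q i) => qi; rewrite ?andbF ?subrr // (ltn_trans pq qi) /= /a inord_val //.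
  - exact: fval_homog.
  - apply: homog_sum => j _; apply: homog_sum => k _; apply: homogZ.
    by apply: (homogM (p := 1) (q := 1)); apply: gen_homog.
apply: (@aext_iso _ _ two_neq0 (invmx X)); rewrite ?unitmx_inv //; try exact: alg_lin; try exact: alg_leibniz.
  exact: cdga_leibniz.
(* [key] gives compatibility on the triangular basis [x]; expanding the standard generators in that
   basis transfers it to them by linearity. *)
have gE (i : 'I_6) : gen F i = \sum_j escale (invmx X i j) (x j).
  rewrite -lform_delta -[delta_mx _ _]mulmx1 -(mulVmx uX) mulmxA -rowE lform_mul.
  by apply: eq_bigr => j _; rewrite xE mxE.
move=> i; rewrite gE !(lin_sum dl, lin_sum (aext_lin _)) (lin_sum (@alg_lin _)); apply: eq_bigr => j _.
by rewrite !(linZ dl, linZ (aext_lin _)) (linZ (@alg_lin _)) key xX.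
Qed.
End BaseChange.

(** * The equation d^2 = 0 in coordinates *)

Section Jacobi.
Variable F : fieldType.
Hypothesis two_neq0 : (2%:R : F) != 0.
Local Notation E := (ext F 6).
Local Notation form := (seq (nat * nat * F)).
Implicit Types (l : form) (s : seq form) (p q r i j k : nat).

(* The coefficient of e_p e_q e_r in e_k d(e_j). *)
Definition jterm s k j p q r : F :=
  let l := nth [::] s j in
  if eqn k p then coef l q r else if eqn k q then - coef l p r
  else if eqn k r then coef l p q else 0.

(** Coefficient of the differential of [l]. It uses d(x_j x_k) = dx_j x_k - x_j dx_k, where the
    2-form dx_j commutes with x_k. *)
Fixpoint jac s l p q r : F :=
  if l is (j, k, a) :: l' then a * (jterm s k j p q r - jterm s j k p q r) + jac s l' p q r
  else 0.

Definition triangular s := forall i, (i < 6)%N -> bounded i (nth [::] s i).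
Definition jacobi s := forall i r q p, (i < 6)%N -> (r < 6)%N -> (q < r)%N -> (p < q)%N ->
  jac s (nth [::] s i) p q r = 0.

Lemma bounded_nth m s i : all (bounded m) s -> bounded m (nth [::] s i).
Proof.
move=> bs; have [/(mem_nth [::])/(allP bs)//|le] := ltnP i (size s).
by rewrite nth_default.
Qed.

Lemma jtermE s k j p q r : all (bounded 6) s -> (j < 6)%N -> (k < 6)%N ->
  (p < q)%N -> (q < r)%N -> (r < 6)%N ->
  wedge (e F k) (alg s (e F j)) [set inord p; inord q; inord r] = jterm s k j p q r.
Proof.
move=> bs j6 k6 pq qr r6; have q6 := ltn_trans qr r6; have p6 := ltn_trans pq q6.
rewrite alg_e // wedge_gen3 ?ltn_inord // !fval_coef ?bounded_nth //; last exact: ltn_trans qr.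
rewrite !inord_eq // /jterm; case: (@eqnP k p) => [->|_] /=.
  have -> : eqn p q = false by apply/eqnP=> E; rewrite E ltnn in pq.
  have -> : eqn p r = false by apply/eqnP=> E; move: (ltn_trans pq qr); rewrite E ltnn.
  by rewrite /=; ring.
case: (@eqnP k q) => [->|_] /=; last by case: eqn => /=; ring.
by have -> : eqn q r = false by [apply/eqnP=> E; rewrite E ltnn in qr]; rewrite /=; ring.
Qed.

Lemma alg_fval s l p q r : all (bounded 6) s -> bounded 6 l ->
  (p < q)%N -> (q < r)%N -> (r < 6)%N ->
  alg s (fval l) [set inord p; inord q; inord r] = jac s l p q r.
Proof.
move=> bs bl pq qr r6; elim: l bl => [|[[j k] a] l IH] /=.
  by rewrite /fval big_nil (lin0 (alg_lin s)) ffunE.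
move=> /andP[/andP[j6 k6] bl]; rewrite fval_cons (alg_lin s) addE escaleE IH //; congr (_ * _ + _).
rewrite leibniz_gen; last exact: alg_leibniz.
rewrite addE oppE jtermE //; congr (_ - _).
by rewrite wedge_gen_r alg_e // (inv_homog (fval_homog _)) sqrrN expr1n escale1 -alg_e // jtermE.
Qed.

Lemma iso_d2 n (d d' : ext F n -> ext F n) : dga_iso d d' ->
  is_cdga_differential d -> forall x, d' (d' x) = 0.
Proof.
case=> phi [[pl [psi K1 K2]] _ _ _ pd] [_ _ _ dd] x.
by rewrite -(K2 x) -!pd dd (lin0 pl).
Qed.

(** The relation d^2 = 0 passes through the isomorphism, and on one of the first m generators it
    involves only the first m differentials, so the unknown tail drops out. *)
Lemma approx_jacobi m s d : (m <= 6)%N -> size s = m -> all (bounded m) s ->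
  is_cdga_differential d -> approx m s d -> forall i r q p, (i < m)%N -> (r < 6)%N -> (q < r)%N ->
  (p < q)%N -> jac s (nth [::] s i) p q r = 0.
Proof.
move=> m6 sm bs cd [a da] i r q p im r6 qr pq.
have := iso_d2 da cd (e F i); have i6 := leq_trans im m6.
have bt : all (bounded 6) (s ++ tail m a).
  rewrite all_cat; apply/andP; split; first by apply: sub_all bs => l; apply: bounded_le.
  apply/allP => l /mapP[j]; rewrite mem_iota subnKC // => /andP[_ j6] ->.
  by apply: bounded_le (gform_bounded _ _); apply: ltnW.
rewrite alg_e // nth_cat sm im => /ffunP/(_ [set inord p; inord q; inord r]).
rewrite alg_fval ?(bounded_le m6) ?bounded_nth // ffunE => <-.
have := bounded_nth i bs; elim: (nth [::] s i) => [|[[j k] b] l IH] //= /andP[/andP[jm km] /IH->].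
by rewrite /jterm !nth_cat sm jm km.
Qed.

Lemma deg3_eq0 (x : E) : homog 3 x ->
  (forall p q r, (p < q)%N -> (q < r)%N -> (r < 6)%N ->
    x [set inord p; inord q; inord r] = 0) -> x = 0.
Proof.
move=> hx x0; apply/ffunP=> S; rewrite [RHS]ffunE.
case: (boolP (#|S| == 3)%N) => [|nS]; last exact: hx nS.
rewrite cardE => /eqP; have := sorted_enum S; have := @mem_enum _ S.
case: (enum S) => [|a [|b [|c [|]]]] //= mS /and3P[ab bc _] _.
have -> : S = [set a; b; c] by apply/setP=> j; rewrite -mS !inE orbA.
by have := x0 a b c ab bc (ltn_ord c); rewrite !inord_val.
Qed.

Lemma minimal_alg s : triangular s -> jacobi s -> is_minimal_algebra (alg s).
Proof.
move=> ts js.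
(* Triangularity controls only the first six entries; trimming or padding to six makes the whole
   list bounded without changing the differential. *)
pose s6 := [seq nth [::] s i | i <- iota 0 6].
have s6E i : (i < 6)%N -> nth [::] s6 i = nth [::] s i.
  by move=> i6; rewrite (nth_map 0%N) ?size_iota // nth_iota.
have bs : all (bounded 6) s6.
  apply/allP=> l /mapP[i]; rewrite mem_iota => /andP[_ i6] ->.
  exact: bounded_le (ltnW i6) (ts _ i6).
have sE : alg s =1 alg s6.
  by move=> x; apply: eq_bigr => i _; rewrite s6E.
split.
  apply: extder_cdga => [i|i]; first exact: fval_homog.
  rewrite -/(alg s _) sE; apply: deg3_eq0.
    by apply: extder_homog => [j|]; apply: fval_homog.
  move=> p q r pq qr r6; rewrite alg_fval //; last exact: bounded_le (ltnW (ltn_ord i)) (ts _ (ltn_ord i)).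
  rewrite -[RHS](js i r q p) //; have := bounded_le (ltnW (ltn_ord i)) (ts _ (ltn_ord i)).
  elim: (nth [::] s i) => [|[[j k] b] l IH] //= /andP[/andP[jm km] /IH->].
  by rewrite /jterm !s6E.
exists (fun i : 'I_6 => gen F i); split; first by move=> i; apply: gen_homog.
  move=> c /ffunP c0 i; have := c0 [set i].
  have -> : \sum_j escale (c j) (gen F j) = lform (\row_j c j).
    by apply: eq_bigr => j _; rewrite mxE.
  by rewrite lformE mxE ffunE.
move=> i; rewrite -[i in alg _ (gen F i)]inord_val -/(e F i) alg_e //.
have := ts i (ltn_ord i); elim: (nth [::] s i) => [|[[j k] a] l IH] /=.
  exists (fun _ _ : 'I_6 => 0); rewrite /fval big_nil big1 // => j _; rewrite big1 // => k _.
  exact: escale0.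
move=> /andP[/andP[ji ki] /IH[c lE]].
have j6 := ltn_trans ji (ltn_ord i); have k6 := ltn_trans ki (ltn_ord i).
exists (fun j' k' : 'I_6 => (if (j' == inord j) && (k' == inord k) then a else 0) + c j' k').
rewrite fval_cons lE; under [RHS]eq_bigr do under eq_bigr do rewrite escaleDl.
under [RHS]eq_bigr do rewrite big_split.
rewrite big_split /=; congr (_ + _).
rewrite (bigD1 (inord j)) /= ?inordK // [X in _ + X]big1 ?addr0 => [|j' /andP[_ /negPf nj]]; last first.
  by rewrite big1 // => k' _; rewrite nj escale0.
rewrite (bigD1 (inord k)) /= ?inordK // [X in _ + X]big1 ?addr0 => [|k' /andP[_ /negPf nk]]; last first.
  by rewrite nk andbF escale0.
by rewrite !eqxx.
Qed.
End Jacobi.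

Definition conj_all := foldr and True.

Section Check.
Variable F : fieldType.
Hypothesis two_neq0 : (2%:R : F) != 0.
Local Notation form := (seq (nat * nat * F)).
Local Notation lin := (seq (nat * F)).
Local Notation subst := (seq (nat * lin)).
Implicit Types (s : seq form) (P Q : subst).

(** A bounded quantification written as a conjunction over a concrete list: it unfolds to scalar
    equations that [ring] and [field] can decide one by one. *)
Definition iso_goals m s s' P := conj_all [seq coef (pull P (nth [::] s x.1)) x.2.2 x.2.1 =
    coef (comb (img P x.1) s') x.2.2 x.2.1 |
  x <- [seq (i, y) | i <- iota 0 m, y <- [seq (q, p) | q <- iota 0 m, p <- iota 0 q]]].
Definition inv_goals m P Q := conj_all [seq lcoef (lcomb (img P x.1) Q) x.2 =
    (if eqn x.1 x.2 then 1 else 0) | x <- [seq (i, j) | i <- iota 0 m, j <- iota 0 m]].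

Lemma conj_allP (T : eqType) (G : T -> Prop) (l : seq T) : conj_all (map G l) ->
  forall x, x \in l -> G x.
Proof.
elim: l => //= y l IH [Gy Gl] x; rewrite inE => /orP[/eqP->|] //; exact: IH.
Qed.

Lemma iso_goalsP m s s' P : iso_goals m s s' P -> iso_eqs m s s' P.
Proof.
move=> /conj_allP H i q p im qm pq; apply: (H (i, (q, p))).
apply/allpairsPdep; exists i, (q, p); split => //; first by rewrite mem_iota.
by apply/allpairsPdep; exists q, p; split; rewrite ?mem_iota.
Qed.

Lemma inv_goalsP m P Q : inv_goals m P Q -> inv_eqs m P Q.
Proof.
move=> /conj_allP H i j im jm; rewrite (H (i, j)) /= ?eqnE; first by case: eqP.
by apply/allpairsPdep; exists i, j; split; rewrite ?mem_iota.
Qed.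

Lemma base_change m s' P Q s d : iso_goals m s s' P -> inv_goals m P Q ->
  [&& (m <= 6)%N, size s == m, size s' == m, all (bounded m) s, all (bounded m) s',
    sbounded m P & sbounded m Q] -> approx m s d -> approx m s' d.
Proof.
move=> ss' PQ /and5P[m6 /eqP sm /eqP sm' bs /and3P[bs' bP bQ]].
by apply: (approx_step two_neq0 (P := P) (Q := Q)) => //; [exact: inv_goalsP | exact: iso_goalsP].
Qed.
End Check.

Notation "a *e[ i , j ]" := (i%N, j%N, a%R) (at level 40).
Notation "a *e[ i ]" := (i%N, a%R) (at level 40).
Notation "i :-> u" := (i%N, u) (at level 60).

(** * Normal forms *)

Section NormalForms.
Variable F : fieldType.
Hypothesis two_neq0 : (2%:R : F) != 0.
Local Notation form := (seq (nat * nat * F)).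
Local Notation "0'" := ([::] : form).
Local Notation x01 := ([:: 1 *e[0, 1]] : form).
Local Notation x02 := ([:: 1 *e[0, 2]] : form).
Local Notation x03 := ([:: 1 *e[0, 3]] : form).
Local Notation x12 := ([:: 1 *e[1, 2]] : form).

(* In de Graaf's notation these are L_{6,k} for k = 1, ..., 18, 20, 23, 25, 26, then L_{6,19}(0),
   L_{6,21}(0), L_{6,22}(0), L_{6,24}(0). *)
Definition forms : seq (seq form) := [::
  [:: 0'; 0'; 0'; 0'; 0'; 0'];
  [:: 0'; 0'; x01; 0'; 0'; 0'];
  [:: 0'; 0'; x01; x02; 0'; 0'];
  [:: 0'; 0'; 0'; 0'; [:: 1 *e[0, 1]; 1 *e[2, 3]]; 0'];
  [:: 0'; 0'; x01; 0'; [:: 1 *e[0, 2]; 1 *e[1, 3]]; 0'];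
  [:: 0'; 0'; x01; x02; [:: 1 *e[0, 3]; 1 *e[1, 2]]; 0'];
  [:: 0'; 0'; x01; x02; x03; 0'];
  [:: 0'; 0'; 0'; x01; x02; 0'];
  [:: 0'; 0'; x01; x02; x12; 0'];
  [:: 0'; 0'; x01; 0'; 0'; [:: 1 *e[0, 2]; 1 *e[3, 4]]];
  [:: 0'; 0'; x01; x02; 0'; [:: 1 *e[0, 3]; 1 *e[1, 2]; 1 *e[1, 4]]];
  [:: 0'; 0'; x01; x02; 0'; [:: 1 *e[0, 3]; 1 *e[1, 4]]];
  [:: 0'; 0'; x01; 0'; [:: 1 *e[0, 2]; 1 *e[1, 3]]; [:: 1 *e[0, 4]; 1 *e[2, 3]]];
  [:: 0'; 0'; x01; x02; [:: 1 *e[0, 3]; 1 *e[1, 2]]; [:: 1 *e[1, 4]; (-1) *e[2, 3]]];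
  [:: 0'; 0'; x01; x02; [:: 1 *e[0, 3]; 1 *e[1, 2]]; [:: 1 *e[0, 4]; 1 *e[1, 3]]];
  [:: 0'; 0'; x01; x02; x03; [:: 1 *e[1, 4]; (-1) *e[2, 3]]];
  [:: 0'; 0'; x01; x02; x03; [:: 1 *e[0, 4]; 1 *e[1, 2]]];
  [:: 0'; 0'; x01; x02; x03; [:: 1 *e[0, 4]]];
  [:: 0'; 0'; 0'; x01; x02; [:: 1 *e[0, 4]; 1 *e[1, 3]]];
  [:: 0'; 0'; x01; 0'; [:: 1 *e[0, 2]; 1 *e[1, 3]]; x03];
  [:: 0'; 0'; x01; 0'; x02; x03];
  [:: 0'; 0'; 0'; x01; x02; x12];
  [:: 0'; 0'; 0'; x01; x02; [:: 1 *e[1, 3]]];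
  [:: 0'; 0'; x01; x02; x12; x03];
  [:: 0'; 0'; 0'; 0'; [:: 1 *e[0, 1]; 1 *e[2, 3]]; x02];
  [:: 0'; 0'; x01; 0'; [:: 1 *e[0, 2]; 1 *e[1, 3]]; x12]].

(* At u = 0 these give the entries 22, ..., 25 of [forms]. *)
Definition fam (u : F) : seq (seq form) := [::
  [:: 0'; 0'; 0'; x01; x02; [:: 1 *e[1, 3]; u *e[2, 4]]];
  [:: 0'; 0'; x01; x02; x12; [:: 1 *e[0, 3]; u *e[1, 4]]];
  [:: 0'; 0'; 0'; 0'; [:: 1 *e[0, 1]; 1 *e[2, 3]]; [:: 1 *e[0, 2]; u *e[1, 3]]];
  [:: 0'; 0'; x01; 0'; [:: 1 *e[0, 2]; 1 *e[1, 3]]; [:: 1 *e[1, 2]; u *e[0, 3]]]].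

Definition model (t : ('I_26 + 'I_4 * F)%type) : ext F 6 -> ext F 6 :=
  match t with
  | inl i => alg (nth [::] forms i)
  | inr (i, u) => alg (nth [::] (fam u) i)
  end.

Definition classified (d : ext F 6 -> ext F 6) := exists t, valid_index t /\ dga_iso d (model t).

Definition wf_change m (s s' : seq form) (P Q : seq (nat * seq (nat * F))) := [&& (m <= 6)%N, size s == m, size s' == m, all (@bounded F m) s,
  all (bounded m) s', sbounded m P & sbounded m Q].

Lemma form_leaf k P Q s d : iso_goals 6 s (nth [::] forms k) P -> inv_goals 6 P Q ->
  (k < 26)%N && wf_change 6 s (nth [::] forms k) P Q -> approx 6 s d -> classified d.
Proof.
move=> sP PQ /andP[k26 wf] /(base_change two_neq0 sP PQ wf)/approx_full da.
by exists (inl (Ordinal k26)).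
Qed.
End NormalForms.

Ltac expand_goals := cbv beta iota zeta delta [iso_goals inv_goals conj_all foldr coef lcoef pull
  comb lcomb img flatten cat map nth iota fst snd eqn andb forms fam jac jterm].
Ltac nonzero := repeat match goal with
  | |- is_true (_ && _) => apply/andP; split
  | |- is_true (_ * _ != 0) => apply: mulf_neq0
  end; first [done | by rewrite oppr_eq0 | by rewrite (natrM _ 2 2) mulf_neq0].
Ltac solve_eq := first [reflexivity | ring | by field; nonzero].
Ltac solve_all := expand_goals; repeat split; solve_eq.
(* [P] expresses the old generators in terms of the new ones and [Q] is its inverse. *)
Tactic Notation "rebase" uconstr(s) uconstr(P) uconstr(Q) :=
  lazymatch goal with two : is_true (2%:R != 0), H : approx _ _ _ |- _ =>
    let T := fresh in
    pose proof (fun h1 h2 h3 => base_change two (s' := s) (P := P) (Q := Q) h1 h2 h3 H) as T;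
    clear H; assert (H := T ltac:(solve_all) ltac:(solve_all) isT); clear T
  end.
Tactic Notation "leaf" constr(k) uconstr(P) uconstr(Q) :=
  lazymatch goal with two : is_true (2%:R != 0), H : approx _ _ _ |- _ =>
    let T := fresh in
    pose proof (fun h1 h2 h3 => form_leaf two (k := k%N) (P := P) (Q := Q) h1 h2 h3 H) as T;
    exact (T ltac:(solve_all) ltac:(solve_all) isT)
  end.

Section Families.
Variable F : fieldType.
Hypothesis two_neq0 : (2%:R : F) != 0.

(** Lets a reduction end in a family without deciding whether the parameter vanishes: at zero it
    lands on entry 22 + k of [forms]. *)
Lemma fam_leaf k (u : F) d : (k < 4)%N -> approx 6 (nth [::] (fam u) k) d -> classified d.
Proof.
have [->|u0] := eqVneq u 0; last first.
  by move=> k4 /approx_full da; exists (inr (Ordinal k4, u)).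
case: k => [|[|[|[|]]]] // _ H.
- leaf 22%N [::] [::].
- leaf 23%N [::] [::].
- leaf 24%N [::] [::].
- leaf 25%N [::] [::].
Qed.
End Families.

(** The goal says that some combination of coefficients vanishes; up to sign it is the coefficient
    at (p, q, r) of d^2 of the last normalized generator. *)
Ltac from_jacobi p q r :=
  lazymatch goal with H : approx _ _ ?d, cd : is_cdga_differential ?d |- _ =>
    lazymatch type of H with approx ?m ?s _ =>
    let E := fresh in let i := eval compute in (m.-1) in
    have E := approx_jacobi (m := m) (s := s) isT (erefl _) isT cd H (i := i) (p := p) (q := q) (r := r) isT isT isT isT;
    revert E; expand_goals; move=> E;
    first [by rewrite -[RHS]E; ring
          | by apply: oppr_inj; rewrite oppr0 -[RHS]E; ring]
    end
  end.

(** * Reduction to normal form *)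

Section LowDimension.
Variable F : fieldType.
Hypothesis two_neq0 : (2%:R : F) != 0.
Variable d : ext F 6 -> ext F 6.
Hypothesis cd : is_cdga_differential d.
Local Notation form := (seq (nat * nat * F)).
Local Notation "0'" := ([::] : form).
Local Notation x01 := ([:: 1 *e[0, 1]] : form).
Local Notation x02 := ([:: 1 *e[0, 2]] : form).
Local Notation x03 := ([:: 1 *e[0, 3]] : form).
Local Notation x12 := ([:: 1 *e[1, 2]] : form).

(** The nine five-dimensional algebras, ordered so that entry k followed by a closed generator is
    entry k of [forms]. *)
Definition five : seq (seq form) := [::
  [:: 0'; 0'; 0'; 0'; 0'];
  [:: 0'; 0'; x01; 0'; 0'];
  [:: 0'; 0'; x01; x02; 0'];
  [:: 0'; 0'; 0'; 0'; [:: 1 *e[0, 1]; 1 *e[2, 3]]];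
  [:: 0'; 0'; x01; 0'; [:: 1 *e[0, 2]; 1 *e[1, 3]]];
  [:: 0'; 0'; x01; x02; [:: 1 *e[0, 3]; 1 *e[1, 2]]];
  [:: 0'; 0'; x01; x02; x03];
  [:: 0'; 0'; 0'; x01; x02];
  [:: 0'; 0'; x01; x02; x12]].

Lemma red3 : approx 0 [::] d ->
  approx 3 [:: 0'; 0'; 0'] d \/ approx 3 [:: 0'; 0'; x01] d.
Proof.
move=> /(approx_extend (m := 0) isT)[? /(approx_extend (m := 1) isT)[? /(approx_extend (m := 2) isT)[f]]].
rewrite /gform /=; move: (f 0%N 1%N) => a H.
have [a0|a0] := eqVneq a 0; [left|right].
  by subst a; rebase [:: 0'; 0'; 0'] [::] [::].
by rebase [:: 0'; 0'; x01] [:: 2 :-> [:: a *e[2]]] [:: 2 :-> [:: a^-1 *e[2]]].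
Qed.

Lemma red4 : approx 0 [::] d ->
  [\/ approx 4 [:: 0'; 0'; 0'; 0'] d, approx 4 [:: 0'; 0'; x01; 0'] d |
     approx 4 [:: 0'; 0'; x01; x02] d].
Proof.
move=> /red3[] /(approx_extend (m := 3) isT)[f]; rewrite /gform /=;
  move: (f 0%N 1%N) (f 0%N 2%N) (f 1%N 2%N) => a b c H.
  (* A 2-form in three variables is decomposable; whichever coefficient is nonzero exhibits two
     factors, which become the new x0 and x1. *)
  have [c0|c0] := eqVneq c 0; last first.
    constructor 2; rebase [:: 0'; 0'; x01; 0']
      [:: 0 :-> [:: 1 *e[3]]; 1 :-> [:: 1 *e[0]; (- (b / c)) *e[3]];
         2 :-> [:: c^-1 *e[1]; (a / c) *e[3]]; 3 :-> [:: 1 *e[2]]]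
      [:: 3 :-> [:: 1 *e[0]]; 0 :-> [:: 1 *e[1]; (b / c) *e[0]];
         1 :-> [:: c *e[2]; (- a) *e[0]]; 2 :-> [:: 1 *e[3]]].
    exact: H.
  have [b0|b0] := eqVneq b 0; last first.
    constructor 2; subst c; rebase [:: 0'; 0'; x01; 0']
      [:: 1 :-> [:: 1 *e[3]]; 2 :-> [:: b^-1 *e[1]; (- (a / b)) *e[3]]; 3 :-> [:: 1 *e[2]]]
      [:: 1 :-> [:: a *e[1]; b *e[2]]; 2 :-> [:: 1 *e[3]]; 3 :-> [:: 1 *e[1]]].
    exact: H.
  have [a0|a0] := eqVneq a 0; last first.
    constructor 2; subst b c; rebase [:: 0'; 0'; x01; 0']
      [:: 1 :-> [:: a^-1 *e[1]]; 2 :-> [:: 1 *e[3]]; 3 :-> [:: 1 *e[2]]]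
      [:: 1 :-> [:: a *e[1]]; 2 :-> [:: 1 *e[3]]; 3 :-> [:: 1 *e[2]]].
    exact: H.
  by constructor 1; subst a b c; rebase [:: 0'; 0'; 0'; 0'] [::] [::].
(* The term in [a] is exact and is absorbed into x3. What remains is (b x0 + c x1) x2, and the first
   factor is made the new x0 by a change of determinant 1 on x0, x1, which keeps dx2 = x0 x1. *)
have [b0|b0] := eqVneq b 0; last first.
  constructor 3; rebase [:: 0'; 0'; x01; x02]
    [:: 0 :-> [:: b^-1 *e[0]; (- c) *e[1]]; 1 :-> [:: b *e[1]]; 3 :-> [:: 1 *e[3]; a *e[2]]]
    [:: 0 :-> [:: b *e[0]; c *e[1]]; 1 :-> [:: b^-1 *e[1]]; 3 :-> [:: 1 *e[3]; (- a) *e[2]]].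
  exact: H.
have [c0|c0] := eqVneq c 0; last first.
  constructor 3; subst b; rebase [:: 0'; 0'; x01; x02]
    [:: 0 :-> [:: (- c) *e[1]]; 1 :-> [:: c^-1 *e[0]]; 3 :-> [:: 1 *e[3]; a *e[2]]]
    [:: 0 :-> [:: c *e[1]]; 1 :-> [:: (- c^-1) *e[0]]; 3 :-> [:: 1 *e[3]; (- a) *e[2]]].
  exact: H.
constructor 2; subst b c; rebase [:: 0'; 0'; x01; 0']
   [:: 3 :-> [:: 1 *e[3]; a *e[2]]] [:: 3 :-> [:: 1 *e[3]; (- a) *e[2]]].
exact: H.
Qed.


(** Symplectic reduction: x2 x3 is split off, and the coefficient left on x0 x1 is the Pfaffian
    divided by [r]. It decides between rank 4 and rank 2. *)
Lemma red5_rank4 a b c p q r : r != 0 ->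
  approx 5 [:: 0'; 0'; 0'; 0'; [:: a *e[0, 1]; b *e[0, 2]; c *e[1, 2]; p *e[0, 3]; q *e[1, 3]; r *e[2, 3]]] d ->
  exists k, (k < 9)%N /\ approx 5 (nth [::] five k) d.
Proof.
move=> r0 H.
rebase [:: 0'; 0'; 0'; 0'; [:: (a + (p * c - q * b) / r) *e[0, 1]; 1 *e[2, 3]]]
  [:: 2 :-> [:: 1 *e[2]; (- (p / r)) *e[0]; (- (q / r)) *e[1]];
     3 :-> [:: r^-1 *e[3]; (b / r) *e[0]; (c / r) *e[1]]]
  [:: 2 :-> [:: 1 *e[2]; (p / r) *e[0]; (q / r) *e[1]];
     3 :-> [:: r *e[3]; (- b) *e[0]; (- c) *e[1]]].
move: (a + _) H => t H; have [t0|t0] := eqVneq t 0.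
  subst t; rebase [:: 0'; 0'; x01; 0'; 0']
    [:: 0 :-> [:: 1 *e[3]]; 1 :-> [:: 1 *e[4]]; 2 :-> [:: 1 *e[0]]; 3 :-> [:: 1 *e[1]]; 4 :-> [:: 1 *e[2]]]
    [:: 3 :-> [:: 1 *e[0]]; 4 :-> [:: 1 *e[1]]; 0 :-> [:: 1 *e[2]]; 1 :-> [:: 1 *e[3]]; 2 :-> [:: 1 *e[4]]].
  by exists 1%N.
rebase [:: 0'; 0'; 0'; 0'; [:: 1 *e[0, 1]; 1 *e[2, 3]]]
  [:: 0 :-> [:: t^-1 *e[0]]] [:: 0 :-> [:: t *e[0]]].
by exists 3%N.
Qed.

Lemma red5_abelian : approx 4 [:: 0'; 0'; 0'; 0'] d ->
  exists k, (k < 9)%N /\ approx 5 (nth [::] five k) d.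
Proof.
move=> /(approx_extend (m := 4) isT)[f]; rewrite /gform /=.
move: (f 0%N 1%N) (f 0%N 2%N) (f 1%N 2%N) (f 0%N 3%N) (f 1%N 3%N) (f 2%N 3%N) => a b c p q r H.
(* Any nonzero coefficient is moved to the position x2 x3 by a permutation of the generators. *)
have [r0|r0] := eqVneq r 0; last exact: (red5_rank4 r0 H).
have [q0|q0] := eqVneq q 0; last first.
  rebase [:: 0'; 0'; 0'; 0'; [:: b *e[0, 1]; a *e[0, 2]; (- c) *e[1, 2]; p *e[0, 3]; r *e[1, 3]; q *e[2, 3]]]
    [:: 1 :-> [:: 1 *e[2]]; 2 :-> [:: 1 *e[1]]] [:: 1 :-> [:: 1 *e[2]]; 2 :-> [:: 1 *e[1]]].
  exact: (red5_rank4 q0 H).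
have [p0|p0] := eqVneq p 0; last first.
  rebase [:: 0'; 0'; 0'; 0'; [:: (- c) *e[0, 1]; (- b) *e[0, 2]; (- a) *e[1, 2]; r *e[0, 3]; q *e[1, 3]; p *e[2, 3]]]
    [:: 0 :-> [:: 1 *e[2]]; 2 :-> [:: 1 *e[0]]] [:: 0 :-> [:: 1 *e[2]]; 2 :-> [:: 1 *e[0]]].
  exact: (red5_rank4 p0 H).
have [c0|c0] := eqVneq c 0; last first.
  rebase [:: 0'; 0'; 0'; 0'; [:: p *e[0, 1]; b *e[0, 2]; (- r) *e[1, 2]; a *e[0, 3]; (- q) *e[1, 3]; (- c) *e[2, 3]]]
    [:: 1 :-> [:: 1 *e[3]]; 3 :-> [:: 1 *e[1]]] [:: 1 :-> [:: 1 *e[3]]; 3 :-> [:: 1 *e[1]]].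
  by apply: (red5_rank4 _ H); rewrite oppr_eq0.
have [b0|b0] := eqVneq b 0; last first.
  rebase [:: 0'; 0'; 0'; 0'; [:: (- q) *e[0, 1]; (- r) *e[0, 2]; c *e[1, 2]; (- p) *e[0, 3]; (- a) *e[1, 3]; (- b) *e[2, 3]]]
    [:: 0 :-> [:: 1 *e[3]]; 3 :-> [:: 1 *e[0]]] [:: 0 :-> [:: 1 *e[3]]; 3 :-> [:: 1 *e[0]]].
  by apply: (red5_rank4 _ H); rewrite oppr_eq0.
have [a0|a0] := eqVneq a 0; last first.
  rebase [:: 0'; 0'; 0'; 0'; [:: r *e[0, 1]; (- b) *e[0, 2]; (- p) *e[1, 2]; (- c) *e[0, 3]; (- q) *e[1, 3]; a *e[2, 3]]]
    [:: 0 :-> [:: 1 *e[2]]; 1 :-> [:: 1 *e[3]]; 2 :-> [:: 1 *e[0]]; 3 :-> [:: 1 *e[1]]]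
    [:: 0 :-> [:: 1 *e[2]]; 1 :-> [:: 1 *e[3]]; 2 :-> [:: 1 *e[0]]; 3 :-> [:: 1 *e[1]]].
  exact: (red5_rank4 a0 H).
subst a b c p q r; rebase [:: 0'; 0'; 0'; 0'; 0'] [::] [::].
by exists 0%N.
Qed.

Lemma red5_heisenberg : approx 4 [:: 0'; 0'; x01; 0'] d ->
  exists k, (k < 9)%N /\ approx 5 (nth [::] five k) d.
Proof.
(* Common end of the cases in which x2 occurs in dx4: its cofactor in x0, x1 is made x0 by a change
   of determinant 1, and x0 x3 is absorbed by adding a multiple of the closed x3 to x2. *)
have top t : approx 5 [:: 0'; 0'; x01; 0'; [:: 1 *e[0, 2]; t *e[1, 3]]] d ->
    exists k, (k < 9)%N /\ approx 5 (nth [::] five k) d.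
  move=> H; have [t0|t0] := eqVneq t 0.
    subst t; rebase [:: 0'; 0'; x01; x02; 0']
      [:: 3 :-> [:: 1 *e[4]]; 4 :-> [:: 1 *e[3]]] [:: 3 :-> [:: 1 *e[4]]; 4 :-> [:: 1 *e[3]]].
    by exists 2%N.
  rebase [:: 0'; 0'; x01; 0'; [:: 1 *e[0, 2]; 1 *e[1, 3]]]
    [:: 3 :-> [:: t^-1 *e[3]]] [:: 3 :-> [:: t *e[3]]].
  by exists 4%N.
move=> /(approx_extend (m := 4) isT)[f]; rewrite /gform /=.
move: (f 0%N 1%N) (f 0%N 2%N) (f 1%N 2%N) (f 0%N 3%N) (f 1%N 3%N) (f 2%N 3%N) => a b c p q r H.
have r0 : r = 0 by from_jacobi 0%N 1%N 3%N.
subst r; have [b0|b0] := eqVneq b 0; last first.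
  rebase [:: 0'; 0'; x01; 0'; [:: 1 *e[0, 2]; (q * b - p * c) *e[1, 3]]]
    [:: 0 :-> [:: b^-1 *e[0]; (- c) *e[1]]; 1 :-> [:: b *e[1]]; 2 :-> [:: 1 *e[2]; (- (p / b)) *e[3]];
       4 :-> [:: 1 *e[4]; a *e[2]; (- (a * (p / b))) *e[3]]]
    [:: 0 :-> [:: b *e[0]; c *e[1]]; 1 :-> [:: b^-1 *e[1]]; 2 :-> [:: 1 *e[2]; (p / b) *e[3]];
       4 :-> [:: 1 *e[4]; (- a) *e[2]]].
  exact: top H.
have [c0|c0] := eqVneq c 0; last first.
  subst b; rebase [:: 0'; 0'; x01; 0'; [:: 1 *e[0, 2]; (- c * p) *e[1, 3]]]
    [:: 0 :-> [:: (- c) *e[1]]; 1 :-> [:: c^-1 *e[0]]; 2 :-> [:: 1 *e[2]; (- (q / c)) *e[3]];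
       4 :-> [:: 1 *e[4]; a *e[2]; (- (a * (q / c))) *e[3]]]
    [:: 0 :-> [:: c *e[1]]; 1 :-> [:: (- c^-1) *e[0]]; 2 :-> [:: 1 *e[2]; (q / c) *e[3]];
       4 :-> [:: 1 *e[4]; (- a) *e[2]]].
  exact: top H.
subst b c; have [p0|p0] := eqVneq p 0; last first.
  rebase [:: 0'; 0'; 0'; x01; x02]
    [:: 0 :-> [:: p^-1 *e[0]; (- q) *e[1]]; 1 :-> [:: p *e[1]]; 2 :-> [:: 1 *e[3]]; 3 :-> [:: 1 *e[2]];
       4 :-> [:: 1 *e[4]; a *e[3]]]
    [:: 0 :-> [:: p *e[0]; q *e[1]]; 1 :-> [:: p^-1 *e[1]]; 2 :-> [:: 1 *e[3]]; 3 :-> [:: 1 *e[2]];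
       4 :-> [:: 1 *e[4]; (- a) *e[2]]].
  by exists 7%N.
subst p; have [q0|q0] := eqVneq q 0; last first.
  rebase [:: 0'; 0'; 0'; x01; x02]
    [:: 0 :-> [:: (- q) *e[1]]; 1 :-> [:: q^-1 *e[0]]; 2 :-> [:: 1 *e[3]]; 3 :-> [:: 1 *e[2]];
       4 :-> [:: 1 *e[4]; a *e[3]]]
    [:: 0 :-> [:: q *e[1]]; 1 :-> [:: (- q^-1) *e[0]]; 2 :-> [:: 1 *e[3]]; 3 :-> [:: 1 *e[2]];
       4 :-> [:: 1 *e[4]; (- a) *e[2]]].
  by exists 7%N.
subst q; rebase [:: 0'; 0'; x01; 0'; 0']
  [:: 4 :-> [:: 1 *e[4]; a *e[2]]] [:: 4 :-> [:: 1 *e[4]; (- a) *e[2]]].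
by exists 1%N.
Qed.

Lemma red5_filiform : approx 4 [:: 0'; 0'; x01; x02] d ->
  exists k, (k < 9)%N /\ approx 5 (nth [::] five k) d.
Proof.
move=> /(approx_extend (m := 4) isT)[f]; rewrite /gform /=.
move: (f 0%N 1%N) (f 0%N 2%N) (f 1%N 2%N) (f 0%N 3%N) (f 1%N 3%N) (f 2%N 3%N) => a b c p q r H.
have q0 : q = 0 by from_jacobi 0%N 1%N 2%N.
have r0 : r = 0 by from_jacobi 0%N 1%N 3%N.
subst q r; have [p0|p0] := eqVneq p 0.
  subst p; have [c0|c0] := eqVneq c 0.
    subst c; rebase [:: 0'; 0'; x01; x02; 0']
      [:: 4 :-> [:: 1 *e[4]; a *e[2]; b *e[3]]] [:: 4 :-> [:: 1 *e[4]; (- a) *e[2]; (- b) *e[3]]].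
    by exists 2%N.
  rebase [:: 0'; 0'; x01; x02; x12]
    [:: 4 :-> [:: c *e[4]; a *e[2]; b *e[3]]]
    [:: 4 :-> [:: c^-1 *e[4]; (- (a / c)) *e[2]; (- (b / c)) *e[3]]].
  by exists 8%N.
have [c0|c0] := eqVneq c 0.
  subst c; rebase [:: 0'; 0'; x01; x02; x03]
    [:: 4 :-> [:: p *e[4]; a *e[2]; b *e[3]]]
    [:: 4 :-> [:: p^-1 *e[4]; (- (a / p)) *e[2]; (- (b / p)) *e[3]]].
  by exists 6%N.
(* Scaling x1, x2, x3 by t turns the coefficients p, c into p t, c t^2; they coincide for t = p / c,
   with common value p^2 / c to be absorbed into x4. *)
rebase [:: 0'; 0'; x01; x02; [:: 1 *e[0, 3]; 1 *e[1, 2]]]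
  [:: 1 :-> [:: (p / c) *e[1]]; 2 :-> [:: (p / c) *e[2]]; 3 :-> [:: (p / c) *e[3]];
     4 :-> [:: (p ^+ 2 / c) *e[4]; (a * (p / c)) *e[2]; (b * (p / c)) *e[3]]]
  [:: 1 :-> [:: (c / p) *e[1]]; 2 :-> [:: (c / p) *e[2]]; 3 :-> [:: (c / p) *e[3]];
     4 :-> [:: (c / p ^+ 2) *e[4]; (- (a * c / p ^+ 2)) *e[2]; (- (b * c / p ^+ 2)) *e[3]]].
by exists 5%N.
Qed.

Lemma red5 : approx 0 [::] d -> exists k, (k < 9)%N /\ approx 5 (nth [::] five k) d.
Proof. by case/red4; [exact: red5_abelian | exact: red5_heisenberg | exact: red5_filiform]. Qed.

End LowDimension.

(** * One-generator extensions of the nine five-dimensional algebras *)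

Section Dimension6.
Variable F : fieldType.
Hypothesis two_neq0 : (2%:R : F) != 0.
Variable d : ext F 6 -> ext F 6.
Hypothesis cd : is_cdga_differential d.
Local Notation form := (seq (nat * nat * F)).
Local Notation "0'" := ([::] : form).
Local Notation x01 := ([:: 1 *e[0, 1]] : form).
Local Notation x02 := ([:: 1 *e[0, 2]] : form).
Local Notation x03 := ([:: 1 *e[0, 3]] : form).
Local Notation x12 := ([:: 1 *e[1, 2]] : form).

Lemma approx6 s : approx 5 s d -> exists a01 a02 a12 a03 a13 a23 a04 a14 a24 a34 : F,
  approx 6 (rcons s [:: a01 *e[0, 1]; a02 *e[0, 2]; a12 *e[1, 2]; a03 *e[0, 3]; a13 *e[1, 3];
    a23 *e[2, 3]; a04 *e[0, 4]; a14 *e[1, 4]; a24 *e[2, 4]; a34 *e[3, 4]]) d.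
Proof. by case/(approx_extend (m := 5) isT) => f H; do 10 eexists; exact: H. Qed.

(** After x3 x4 is split off, a 2-form in the three variables x0, x1, x2 remains; it is
    decomposable, so only its vanishing matters. *)
Lemma case1_rank4 (a01 a02 a12 a03 a13 a23 a04 a14 a24 a34 : F) : a34 != 0 ->
  approx 6 [:: 0'; 0'; 0'; 0'; 0'; [:: a01 *e[0, 1]; a02 *e[0, 2]; a12 *e[1, 2]; a03 *e[0, 3];
    a13 *e[1, 3]; a23 *e[2, 3]; a04 *e[0, 4]; a14 *e[1, 4]; a24 *e[2, 4]; a34 *e[3, 4]]] d ->
  classified d.
Proof.
move=> r0 H.
rebase [:: 0'; 0'; 0'; 0'; 0'; [:: (a01 + (a04 * a13 - a14 * a03) / a34) *e[0, 1];
    (a02 + (a04 * a23 - a24 * a03) / a34) *e[0, 2]; (a12 + (a14 * a23 - a24 * a13) / a34) *e[1, 2];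
    1 *e[3, 4]]]
  [:: 3 :-> [:: 1 *e[3]; (- (a04 / a34)) *e[0]; (- (a14 / a34)) *e[1]; (- (a24 / a34)) *e[2]];
     4 :-> [:: a34^-1 *e[4]; (a03 / a34) *e[0]; (a13 / a34) *e[1]; (a23 / a34) *e[2]]]
  [:: 3 :-> [:: 1 *e[3]; (a04 / a34) *e[0]; (a14 / a34) *e[1]; (a24 / a34) *e[2]];
     4 :-> [:: a34 *e[4]; (- a03) *e[0]; (- a13) *e[1]; (- a23) *e[2]]].
move: (a01 + _) (a02 + _) (a12 + _) H => a b c H.
have [c0|c0] := eqVneq c 0; last first.
  leaf 3%N [:: 0 :-> [:: 1 *e[5]]; 1 :-> [:: 1 *e[0]; (- (b / c)) *e[5]];
      2 :-> [:: c^-1 *e[1]; (a / c) *e[5]]; 3 :-> [:: 1 *e[2]]; 4 :-> [:: 1 *e[3]]; 5 :-> [:: 1 *e[4]]]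
    [:: 5 :-> [:: 1 *e[0]]; 0 :-> [:: 1 *e[1]; (b / c) *e[0]]; 1 :-> [:: c *e[2]; (- a) *e[0]];
      2 :-> [:: 1 *e[3]]; 3 :-> [:: 1 *e[4]]; 4 :-> [:: 1 *e[5]]].
subst c; have [b0|b0] := eqVneq b 0; last first.
  leaf 3%N [:: 1 :-> [:: 1 *e[5]]; 2 :-> [:: b^-1 *e[1]; (- (a / b)) *e[5]]; 3 :-> [:: 1 *e[2]];
      4 :-> [:: 1 *e[3]]; 5 :-> [:: 1 *e[4]]]
    [:: 5 :-> [:: 1 *e[1]]; 1 :-> [:: b *e[2]; a *e[1]]; 2 :-> [:: 1 *e[3]]; 3 :-> [:: 1 *e[4]];
      4 :-> [:: 1 *e[5]]].
subst b; have [a0|a0] := eqVneq a 0; last first.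
  leaf 3%N [:: 1 :-> [:: a^-1 *e[1]]; 2 :-> [:: 1 *e[5]]; 3 :-> [:: 1 *e[2]]; 4 :-> [:: 1 *e[3]];
      5 :-> [:: 1 *e[4]]]
    [:: 1 :-> [:: a *e[1]]; 5 :-> [:: 1 *e[2]]; 2 :-> [:: 1 *e[3]]; 3 :-> [:: 1 *e[4]];
      4 :-> [:: 1 *e[5]]].
subst a; leaf 1%N [:: 0 :-> [:: 1 *e[3]]; 1 :-> [:: 1 *e[4]]; 2 :-> [:: 1 *e[5]]; 3 :-> [:: 1 *e[0]];
      4 :-> [:: 1 *e[1]]; 5 :-> [:: 1 *e[2]]]
    [:: 3 :-> [:: 1 *e[0]]; 4 :-> [:: 1 *e[1]]; 5 :-> [:: 1 *e[2]]; 0 :-> [:: 1 *e[3]];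
      1 :-> [:: 1 *e[4]]; 2 :-> [:: 1 *e[5]]].
Qed.

Lemma case1 : approx 5 [:: 0'; 0'; 0'; 0'; 0'] d -> classified d.
Proof.
case/approx6 => a01 [a02 [a12 [a03 [a13 [a23 [a04 [a14 [a24 [a34 /= H]]]]]]]]].
(* As in dimension 5, a permutation of the generators brings any nonzero coefficient to the position
   x3 x4. *)
have [a340|a340] := eqVneq a34 0; last exact: (case1_rank4 a340 H).
have [a240|a240] := eqVneq a24 0; last first.
  rebase [:: 0'; 0'; 0'; 0'; 0'; [:: a01 *e[0, 1]; a03 *e[0, 2]; a13 *e[1, 2]; a02 *e[0, 3]; a12 *e[1, 3]; (- a23) *e[2, 3]; a04 *e[0, 4]; a14 *e[1, 4]; a34 *e[2, 4]; a24 *e[3, 4]]]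
    [:: 2 :-> [:: 1 *e[3]]; 3 :-> [:: 1 *e[2]]] [:: 2 :-> [:: 1 *e[3]]; 3 :-> [:: 1 *e[2]]].
  exact: (case1_rank4 a240 H).
have [a140|a140] := eqVneq a14 0; last first.
  rebase [:: 0'; 0'; 0'; 0'; 0'; [:: a03 *e[0, 1]; a02 *e[0, 2]; (- a23) *e[1, 2]; a01 *e[0, 3]; (- a13) *e[1, 3]; (- a12) *e[2, 3]; a04 *e[0, 4]; a34 *e[1, 4]; a24 *e[2, 4]; a14 *e[3, 4]]]
    [:: 1 :-> [:: 1 *e[3]]; 3 :-> [:: 1 *e[1]]] [:: 1 :-> [:: 1 *e[3]]; 3 :-> [:: 1 *e[1]]].
  exact: (case1_rank4 a140 H).
have [a040|a040] := eqVneq a04 0; last first.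
  rebase [:: 0'; 0'; 0'; 0'; 0'; [:: (- a13) *e[0, 1]; (- a23) *e[0, 2]; a12 *e[1, 2]; (- a03) *e[0, 3]; (- a01) *e[1, 3]; (- a02) *e[2, 3]; a34 *e[0, 4]; a14 *e[1, 4]; a24 *e[2, 4]; a04 *e[3, 4]]]
    [:: 0 :-> [:: 1 *e[3]]; 3 :-> [:: 1 *e[0]]] [:: 0 :-> [:: 1 *e[3]]; 3 :-> [:: 1 *e[0]]].
  exact: (case1_rank4 a040 H).
have [a230|a230] := eqVneq a23 0; last first.
  rebase [:: 0'; 0'; 0'; 0'; 0'; [:: a01 *e[0, 1]; a04 *e[0, 2]; a14 *e[1, 2]; a03 *e[0, 3]; a13 *e[1, 3]; (- a34) *e[2, 3]; a02 *e[0, 4]; a12 *e[1, 4]; (- a24) *e[2, 4]; (- a23) *e[3, 4]]]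
    [:: 2 :-> [:: 1 *e[4]]; 4 :-> [:: 1 *e[2]]] [:: 2 :-> [:: 1 *e[4]]; 4 :-> [:: 1 *e[2]]].
  by apply: (case1_rank4 _ H); rewrite oppr_eq0.
have [a130|a130] := eqVneq a13 0; last first.
  rebase [:: 0'; 0'; 0'; 0'; 0'; [:: a04 *e[0, 1]; a02 *e[0, 2]; (- a24) *e[1, 2]; a03 *e[0, 3]; (- a34) *e[1, 3]; a23 *e[2, 3]; a01 *e[0, 4]; (- a14) *e[1, 4]; (- a12) *e[2, 4]; (- a13) *e[3, 4]]]
    [:: 1 :-> [:: 1 *e[4]]; 4 :-> [:: 1 *e[1]]] [:: 1 :-> [:: 1 *e[4]]; 4 :-> [:: 1 *e[1]]].
  by apply: (case1_rank4 _ H); rewrite oppr_eq0.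
have [a030|a030] := eqVneq a03 0; last first.
  rebase [:: 0'; 0'; 0'; 0'; 0'; [:: (- a14) *e[0, 1]; (- a24) *e[0, 2]; a12 *e[1, 2]; (- a34) *e[0, 3]; a13 *e[1, 3]; a23 *e[2, 3]; (- a04) *e[0, 4]; (- a01) *e[1, 4]; (- a02) *e[2, 4]; (- a03) *e[3, 4]]]
    [:: 0 :-> [:: 1 *e[4]]; 4 :-> [:: 1 *e[0]]] [:: 0 :-> [:: 1 *e[4]]; 4 :-> [:: 1 *e[0]]].
  by apply: (case1_rank4 _ H); rewrite oppr_eq0.
have [a120|a120] := eqVneq a12 0; last first.
  rebase [:: 0'; 0'; 0'; 0'; 0'; [:: a03 *e[0, 1]; a04 *e[0, 2]; a34 *e[1, 2]; a01 *e[0, 3]; (- a13) *e[1, 3]; (- a14) *e[2, 3]; a02 *e[0, 4]; (- a23) *e[1, 4]; (- a24) *e[2, 4]; a12 *e[3, 4]]]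
    [:: 1 :-> [:: 1 *e[3]]; 2 :-> [:: 1 *e[4]]; 3 :-> [:: 1 *e[1]]; 4 :-> [:: 1 *e[2]]] [:: 1 :-> [:: 1 *e[3]]; 2 :-> [:: 1 *e[4]]; 3 :-> [:: 1 *e[1]]; 4 :-> [:: 1 *e[2]]].
  exact: (case1_rank4 a120 H).
have [a020|a020] := eqVneq a02 0; last first.
  rebase [:: 0'; 0'; 0'; 0'; 0'; [:: (- a13) *e[0, 1]; a34 *e[0, 2]; a14 *e[1, 2]; (- a03) *e[0, 3]; (- a01) *e[1, 3]; (- a04) *e[2, 3]; (- a23) *e[0, 4]; a12 *e[1, 4]; (- a24) *e[2, 4]; a02 *e[3, 4]]]
    [:: 0 :-> [:: 1 *e[3]]; 2 :-> [:: 1 *e[4]]; 3 :-> [:: 1 *e[0]]; 4 :-> [:: 1 *e[2]]] [:: 0 :-> [:: 1 *e[3]]; 2 :-> [:: 1 *e[4]]; 3 :-> [:: 1 *e[0]]; 4 :-> [:: 1 *e[2]]].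
  exact: (case1_rank4 a020 H).
have [a010|a010] := eqVneq a01 0; last first.
  rebase [:: 0'; 0'; 0'; 0'; 0'; [:: a34 *e[0, 1]; (- a23) *e[0, 2]; (- a24) *e[1, 2]; (- a03) *e[0, 3]; (- a04) *e[1, 3]; (- a02) *e[2, 3]; (- a13) *e[0, 4]; (- a14) *e[1, 4]; (- a12) *e[2, 4]; a01 *e[3, 4]]]
    [:: 0 :-> [:: 1 *e[3]]; 1 :-> [:: 1 *e[4]]; 3 :-> [:: 1 *e[0]]; 4 :-> [:: 1 *e[1]]] [:: 0 :-> [:: 1 *e[3]]; 1 :-> [:: 1 *e[4]]; 3 :-> [:: 1 *e[0]]; 4 :-> [:: 1 *e[1]]].
  exact: (case1_rank4 a010 H).
subst a01 a02 a12 a03 a13 a23 a04 a14 a24 a34.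
leaf 0%N [::] [::].
Qed.

Lemma case2_02 (p q r : F) :
  approx 6 [:: 0'; 0'; x01; 0'; 0'; [:: 1 *e[0, 2]; p *e[1, 3]; q *e[1, 4]; r *e[3, 4]]] d ->
  classified d.
Proof.
move=> H; have [r0|r0] := eqVneq r 0; last first.
  leaf 9%N
    [:: 3 :-> [:: r^-1 *e[3]; (- (q / r)) *e[1]]; 4 :-> [:: 1 *e[4]; (p / r) *e[1]]]
    [:: 3 :-> [:: r *e[3]; q *e[1]]; 4 :-> [:: 1 *e[4]; (- (p / r)) *e[1]]].
subst r; have [p0|p0] := eqVneq p 0; last first.
  leaf 4%N
    [:: 3 :-> [:: p^-1 *e[3]; (- (q / p)) *e[5]]; 4 :-> [:: 1 *e[5]]; 5 :-> [:: 1 *e[4]]]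
    [:: 3 :-> [:: p *e[3]; q *e[4]]; 5 :-> [:: 1 *e[4]]; 4 :-> [:: 1 *e[5]]].
subst p; have [q0|q0] := eqVneq q 0; last first.
  leaf 4%N
    [:: 4 :-> [:: q^-1 *e[3]]; 3 :-> [:: 1 *e[5]]; 5 :-> [:: 1 *e[4]]]
    [:: 3 :-> [:: q *e[4]]; 5 :-> [:: 1 *e[3]]; 4 :-> [:: 1 *e[5]]].
subst q; leaf 2%N
  [:: 3 :-> [:: 1 *e[4]]; 4 :-> [:: 1 *e[5]]; 5 :-> [:: 1 *e[3]]]
  [:: 4 :-> [:: 1 *e[3]]; 5 :-> [:: 1 *e[4]]; 3 :-> [:: 1 *e[5]]].
Qed.

(** The form is a 2 by 2 matrix pairing x0, x1 with x3, x4. Clearing its first row and column leaves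
    the determinant divided by [a], so the rank decides. *)
Lemma case2_03 (a b c t : F) : a != 0 ->
  approx 6 [:: 0'; 0'; x01; 0'; 0'; [:: a *e[0, 3]; b *e[1, 3]; c *e[0, 4]; t *e[1, 4]]] d ->
  classified d.
Proof.
move=> a0 H.
rebase [:: 0'; 0'; x01; 0'; 0'; [:: 1 *e[0, 3]; (t - b * c / a) *e[1, 4]]]
  [:: 0 :-> [:: 1 *e[0]; (- (b / a)) *e[1]]; 3 :-> [:: a^-1 *e[3]; (- (c / a)) *e[4]]]
  [:: 0 :-> [:: 1 *e[0]; (b / a) *e[1]]; 3 :-> [:: a *e[3]; c *e[4]]].
move: (t - _) H => u H; have [u0|u0] := eqVneq u 0; last first.
  leaf 24%N
    [:: 1 :-> [:: 1 *e[2]]; 2 :-> [:: 1 *e[5]]; 3 :-> [:: 1 *e[1]]; 4 :-> [:: u^-1 *e[3]]; 5 :-> [:: 1 *e[4]]]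
    [:: 2 :-> [:: 1 *e[1]]; 5 :-> [:: 1 *e[2]]; 1 :-> [:: 1 *e[3]]; 3 :-> [:: u *e[4]]; 4 :-> [:: 1 *e[5]]].
subst u; leaf 7%N
  [:: 2 :-> [:: 1 *e[3]]; 3 :-> [:: 1 *e[2]]; 4 :-> [:: 1 *e[5]]; 5 :-> [:: 1 *e[4]]]
  [:: 3 :-> [:: 1 *e[2]]; 2 :-> [:: 1 *e[3]]; 5 :-> [:: 1 *e[4]]; 4 :-> [:: 1 *e[5]]].
Qed.

Lemma case2 : approx 5 [:: 0'; 0'; x01; 0'; 0'] d -> classified d.
Proof.
case/approx6 => a01 [a02 [a12 [a03 [a13 [a23 [a04 [a14 [a24 [a34 /= H]]]]]]]]].
have a230 : a23 = 0 by from_jacobi 0%N 1%N 3%N.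
have a240 : a24 = 0 by from_jacobi 0%N 1%N 4%N.
(* If x2 occurs in dx5, its cofactor becomes x0 by a change of determinant 1, and x0 x3, x0 x4 are
   absorbed into x2. *)
subst a23 a24; have [b0|b0] := eqVneq a02 0; last first.
  rebase [:: 0'; 0'; x01; 0'; 0'; [:: 1 *e[0, 2]; (a13 * a02 - a03 * a12) *e[1, 3];
      (a14 * a02 - a04 * a12) *e[1, 4]; a34 *e[3, 4]]]
    [:: 0 :-> [:: a02^-1 *e[0]; (- a12) *e[1]]; 1 :-> [:: a02 *e[1]];
       2 :-> [:: 1 *e[2]; (- (a03 / a02)) *e[3]; (- (a04 / a02)) *e[4]];
       5 :-> [:: 1 *e[5]; a01 *e[2]; (- (a01 * a03 / a02)) *e[3]; (- (a01 * a04 / a02)) *e[4]]]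
    [:: 0 :-> [:: a02 *e[0]; a12 *e[1]]; 1 :-> [:: a02^-1 *e[1]];
       2 :-> [:: 1 *e[2]; (a03 / a02) *e[3]; (a04 / a02) *e[4]]; 5 :-> [:: 1 *e[5]; (- a01) *e[2]]].
  exact: case2_02 H.
subst a02; have [c0|c0] := eqVneq a12 0; last first.
  rebase [:: 0'; 0'; x01; 0'; 0'; [:: 1 *e[0, 2]; (- (a12 * a03)) *e[1, 3]; (- (a12 * a04)) *e[1, 4]; a34 *e[3, 4]]]
    [:: 0 :-> [:: (- a12) *e[1]]; 1 :-> [:: a12^-1 *e[0]];
       2 :-> [:: 1 *e[2]; (- (a13 / a12)) *e[3]; (- (a14 / a12)) *e[4]];
       5 :-> [:: 1 *e[5]; a01 *e[2]; (- (a01 * a13 / a12)) *e[3]; (- (a01 * a14 / a12)) *e[4]]]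
    [:: 0 :-> [:: a12 *e[1]]; 1 :-> [:: (- a12^-1) *e[0]];
       2 :-> [:: 1 *e[2]; (a13 / a12) *e[3]; (a14 / a12) *e[4]]; 5 :-> [:: 1 *e[5]; (- a01) *e[2]]].
  exact: case2_02 H.
subst a12; have [r0|r0] := eqVneq a34 0; last first.
  rebase [:: 0'; 0'; x01; 0'; 0'; [:: 1 *e[3, 4]]]
    [:: 3 :-> [:: a34^-1 *e[3]; (- (a04 / a34)) *e[0]; (- (a14 / a34)) *e[1]];
       4 :-> [:: 1 *e[4]; (a03 / a34) *e[0]; (a13 / a34) *e[1]];
       5 :-> [:: 1 *e[5]; (a01 + (a04 * a13 - a03 * a14) / a34) *e[2]]]
    [:: 3 :-> [:: a34 *e[3]; a04 *e[0]; a14 *e[1]];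
       4 :-> [:: 1 *e[4]; (- (a03 / a34)) *e[0]; (- (a13 / a34)) *e[1]];
       5 :-> [:: 1 *e[5]; (- (a01 + (a04 * a13 - a03 * a14) / a34)) *e[2]]].
  (* Two independent decomposable forms, x0 x1 and x3 x4, are the isotropic lines of a split pencil:
     in the new basis they are the sum and the difference of x0 x1 + x2 x3 and x0 x2 + x1 x3. *)
  rebase (nth [::] (fam 1) 2)
    [:: 0 :-> [:: 1 *e[0]; (-1) *e[3]]; 1 :-> [:: 1 *e[1]; 1 *e[2]]; 2 :-> [:: 1 *e[4]; 1 *e[5]];
       3 :-> [:: 1 *e[0]; 1 *e[3]]; 4 :-> [:: 1 *e[1]; (-1) *e[2]]; 5 :-> [:: 1 *e[4]; (-1) *e[5]]]
    [:: 0 :-> [:: 2^-1 *e[0]; 2^-1 *e[3]]; 1 :-> [:: 2^-1 *e[1]; 2^-1 *e[4]];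
       2 :-> [:: 2^-1 *e[1]; (- 2^-1) *e[4]]; 3 :-> [:: 2^-1 *e[3]; (- 2^-1) *e[0]];
       4 :-> [:: 2^-1 *e[2]; 2^-1 *e[5]]; 5 :-> [:: 2^-1 *e[2]; (- 2^-1) *e[5]]].
  exact: fam_leaf H.
subst a34; rebase [:: 0'; 0'; x01; 0'; 0'; [:: a03 *e[0, 3]; a13 *e[1, 3]; a04 *e[0, 4]; a14 *e[1, 4]]]
  [:: 5 :-> [:: 1 *e[5]; a01 *e[2]]] [:: 5 :-> [:: 1 *e[5]; (- a01) *e[2]]].
have [a0|a0] := eqVneq a03 0; last exact: case2_03 H.
have [b0|b0] := eqVneq a13 0; last first.
  rebase [:: 0'; 0'; x01; 0'; 0'; [:: a13 *e[0, 3]; (- a03) *e[1, 3]; a14 *e[0, 4]; (- a04) *e[1, 4]]]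
    [:: 0 :-> [:: (-1) *e[1]]; 1 :-> [:: 1 *e[0]]] [:: 0 :-> [:: 1 *e[1]]; 1 :-> [:: (-1) *e[0]]].
  exact: case2_03 H.
have [c0|c0] := eqVneq a04 0; last first.
  rebase [:: 0'; 0'; x01; 0'; 0'; [:: a04 *e[0, 3]; a14 *e[1, 3]; a03 *e[0, 4]; a13 *e[1, 4]]]
    [:: 3 :-> [:: 1 *e[4]]; 4 :-> [:: 1 *e[3]]] [:: 3 :-> [:: 1 *e[4]]; 4 :-> [:: 1 *e[3]]].
  exact: case2_03 H.
have [t0|t0] := eqVneq a14 0; last first.
  rebase [:: 0'; 0'; x01; 0'; 0'; [:: a14 *e[0, 3]; (- a04) *e[1, 3]; a13 *e[0, 4]; (- a03) *e[1, 4]]]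
    [:: 0 :-> [:: (-1) *e[1]]; 1 :-> [:: 1 *e[0]]; 3 :-> [:: 1 *e[4]]; 4 :-> [:: 1 *e[3]]]
    [:: 0 :-> [:: 1 *e[1]]; 1 :-> [:: (-1) *e[0]]; 3 :-> [:: 1 *e[4]]; 4 :-> [:: 1 *e[3]]].
  exact: case2_03 H.
subst a03 a13 a04 a14; leaf 1%N [::] [::].
Qed.

Lemma case3_03 (b q : F) :
  approx 6 [:: 0'; 0'; x01; x02; 0'; [:: 1 *e[0, 3]; b *e[1, 2]; q *e[1, 4]]] d -> classified d.
Proof.
move=> H; have [q0|q0] := eqVneq q 0; have [b0|b0] := eqVneq b 0.
- subst q b; leaf 6%N [:: 4 :-> [:: 1 *e[5]]; 5 :-> [:: 1 *e[4]]] [:: 4 :-> [:: 1 *e[5]]; 5 :-> [:: 1 *e[4]]].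
- subst q; leaf 5%N
    [:: 1 :-> [:: b^-1 *e[1]]; 2 :-> [:: b^-1 *e[2]]; 3 :-> [:: b^-1 *e[3]]; 5 :-> [:: b^-1 *e[4]]; 4 :-> [:: 1 *e[5]]]
    [:: 1 :-> [:: b *e[1]]; 2 :-> [:: b *e[2]]; 3 :-> [:: b *e[3]]; 4 :-> [:: b *e[5]]; 5 :-> [:: 1 *e[4]]].
- subst b; leaf 11%N [:: 4 :-> [:: q^-1 *e[4]]] [:: 4 :-> [:: q *e[4]]].
leaf 10%N
  [:: 1 :-> [:: b^-1 *e[1]]; 2 :-> [:: b^-1 *e[2]]; 3 :-> [:: b^-1 *e[3]]; 4 :-> [:: q^-1 *e[4]]; 5 :-> [:: b^-1 *e[5]]]
  [:: 1 :-> [:: b *e[1]]; 2 :-> [:: b *e[2]]; 3 :-> [:: b *e[3]]; 4 :-> [:: q *e[4]]; 5 :-> [:: b *e[5]]].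
Qed.

(* The pair (dx3, dx5) is y /\ x2 + N(y) /\ x4 for an endomorphism N of <x0, x1>; the case q != 0
   diagonalizes the traceless part of N. *)
Lemma case3_12 (p q : F) :
  approx 6 [:: 0'; 0'; x01; x02; 0'; [:: 1 *e[1, 2]; p *e[0, 4]; q *e[1, 4]]] d -> classified d.
Proof.
move=> H; have [q0|q0] := eqVneq q 0; last first.
  rebase (nth [::] (fam 1) 3)
    [:: 0 :-> [:: 1 *e[0]; (-1) *e[1]]; 1 :-> [:: (1 - p / q) *e[0]; (1 + p / q) *e[1]];
       2 :-> [:: 2 *e[2]; (-2) *e[3]]; 3 :-> [:: 2 *e[4]; (-2) *e[5]]; 4 :-> [:: (2 * 2 / q) *e[3]];
       5 :-> [:: (2 - 2 * p / q) *e[4]; (2 + 2 * p / q) *e[5]]]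
    [:: 0 :-> [:: ((1 + p / q) / 2) *e[0]; 2^-1 *e[1]]; 1 :-> [:: ((p / q - 1) / 2) *e[0]; 2^-1 *e[1]];
       2 :-> [:: 2^-1 *e[2]; (q / (2 * 2)) *e[4]]; 3 :-> [:: (q / (2 * 2)) *e[4]];
       4 :-> [:: ((1 + p / q) / (2 * 2)) *e[3]; (2 * 2)^-1 *e[5]];
       5 :-> [:: ((p / q - 1) / (2 * 2)) *e[3]; (2 * 2)^-1 *e[5]]].
  exact: fam_leaf H.
subst q; have [p0|p0] := eqVneq p 0.
  subst p; leaf 8%N [:: 4 :-> [:: 1 *e[5]]; 5 :-> [:: 1 *e[4]]] [:: 4 :-> [:: 1 *e[5]]; 5 :-> [:: 1 *e[4]]].
leaf 25%N
  [:: 0 :-> [:: (-1) *e[1]]; 1 :-> [:: 1 *e[0]]; 3 :-> [:: (-1) *e[5]]; 4 :-> [:: (- p^-1) *e[3]]; 5 :-> [:: 1 *e[4]]]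
  [:: 0 :-> [:: 1 *e[1]]; 1 :-> [:: (-1) *e[0]]; 3 :-> [:: (- p) *e[4]]; 4 :-> [:: 1 *e[5]]; 5 :-> [:: (-1) *e[3]]].
Qed.

Lemma case3 : approx 5 [:: 0'; 0'; x01; x02; 0'] d -> classified d.
Proof.
case/approx6 => a01 [a02 [a12 [a03 [a13 [a23 [a04 [a14 [a24 [a34 /= H]]]]]]]]].
have a130 : a13 = 0 by from_jacobi 0%N 1%N 2%N.
have a230 : a23 = 0 by from_jacobi 0%N 1%N 3%N.
have a240 : a24 = 0 by from_jacobi 0%N 1%N 4%N.
have a340 : a34 = 0 by from_jacobi 0%N 2%N 4%N.
subst a13 a23 a24 a34; have [a0|a0] := eqVneq a03 0; last first.
  rebase [:: 0'; 0'; x01; x02; 0'; [:: 1 *e[0, 3]; (a12 / a03) *e[1, 2]; (a14 / a03) *e[1, 4]]]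
    [:: 3 :-> [:: 1 *e[3]; (- (a04 / a03)) *e[4]]; 5 :-> [:: a03 *e[5]; a01 *e[2]; a02 *e[3]]]
    [:: 3 :-> [:: 1 *e[3]; (a04 / a03) *e[4]];
       5 :-> [:: a03^-1 *e[5]; (- (a01 / a03)) *e[2]; (- (a02 / a03)) *e[3]; (- (a02 * a04 / a03 ^+ 2)) *e[4]]].
  exact: case3_03 H.
subst a03; have [c0|c0] := eqVneq a12 0; last first.
  rebase [:: 0'; 0'; x01; x02; 0'; [:: 1 *e[1, 2]; (a04 / a12) *e[0, 4]; (a14 / a12) *e[1, 4]]]
    [:: 5 :-> [:: a12 *e[5]; a01 *e[2]; a02 *e[3]]]
    [:: 5 :-> [:: a12^-1 *e[5]; (- (a01 / a12)) *e[2]; (- (a02 / a12)) *e[3]]].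
  exact: case3_12 H.
(* Modulo exact forms, dx5 is now y x4 with y in the span of x0, x1. The cases are: y independent of
   x0 (the factor of dx3), y a nonzero multiple of x0, and y = 0. *)
subst a12; have [q0|q0] := eqVneq a14 0; last first.
  leaf 22%N
    [:: 0 :-> [:: 1 *e[1]]; 1 :-> [:: 1 *e[0]; (- (a04 / a14)) *e[1]]; 2 :-> [:: (-1) *e[3]]; 3 :-> [:: (-1) *e[5]];
       4 :-> [:: a14^-1 *e[2]]; 5 :-> [:: 1 *e[4]; (- a01) *e[3]; (- a02) *e[5]]]
    [:: 0 :-> [:: 1 *e[1]; (a04 / a14) *e[0]]; 1 :-> [:: 1 *e[0]]; 2 :-> [:: a14 *e[4]]; 3 :-> [:: (-1) *e[2]];
       4 :-> [:: 1 *e[5]; (- a01) *e[2]; (- a02) *e[3]]; 5 :-> [:: (-1) *e[3]]].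
subst a14; have [p0|p0] := eqVneq a04 0; last first.
  leaf 20%N
    [:: 3 :-> [:: 1 *e[4]]; 4 :-> [:: a04^-1 *e[3]]; 5 :-> [:: 1 *e[5]; a01 *e[2]; a02 *e[4]]]
    [:: 3 :-> [:: a04 *e[4]]; 4 :-> [:: 1 *e[3]]; 5 :-> [:: 1 *e[5]; (- a01) *e[2]; (- a02) *e[3]]].
subst a04; leaf 2%N
  [:: 5 :-> [:: 1 *e[5]; a01 *e[2]; a02 *e[3]]] [:: 5 :-> [:: 1 *e[5]; (- a01) *e[2]; (- a02) *e[3]]].
Qed.

(** The coefficients of x0 x1 and x2 x3 are opposite, that is, dx4 dx5 = 0. The parameter obtained
    is minus the Pfaffian of dx5 divided by b^2. *)
Lemma case4_02 (a b c e f : F) : b != 0 ->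
  approx 6 [:: 0'; 0'; 0'; 0'; [:: 1 *e[0, 1]; 1 *e[2, 3]];
    [:: a *e[0, 1]; b *e[0, 2]; f *e[1, 2]; e *e[0, 3]; c *e[1, 3]; (- a) *e[2, 3]]] d -> classified d.
Proof.
move=> b0 H.
rebase (nth [::] (fam (c / b - e * f / b ^+ 2 + a ^+ 2 / b ^+ 2)) 2)
  [:: 0 :-> [:: 1 *e[0]; (- (f / b)) *e[1]; (- (a / b)) *e[3]];
     2 :-> [:: 1 *e[2]; (- (e / b)) *e[3]; (- (a / b)) *e[1]]; 5 :-> [:: b *e[5]]]
  [:: 0 :-> [:: 1 *e[0]; (f / b) *e[1]; (a / b) *e[3]];
     2 :-> [:: 1 *e[2]; (e / b) *e[3]; (a / b) *e[1]]; 5 :-> [:: b^-1 *e[5]]].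
exact: fam_leaf H.
Qed.

Lemma case4 : approx 5 [:: 0'; 0'; 0'; 0'; [:: 1 *e[0, 1]; 1 *e[2, 3]]] d -> classified d.
Proof.
case/approx6 => a01 [b [f [e [c [a23 [a04 [a14 [a24 [a34 /= H]]]]]]]]].
have a040 : a04 = 0 by from_jacobi 0%N 2%N 3%N.
have a140 : a14 = 0 by from_jacobi 1%N 2%N 3%N.
have a240 : a24 = 0 by from_jacobi 0%N 1%N 2%N.
have a340 : a34 = 0 by from_jacobi 0%N 1%N 3%N.
(* Subtracting half of (a01 + a23) times dx4 makes dx5 orthogonal to dx4 for the Pfaffian
   polarity. *)
subst a04 a14 a24 a34; rebase [:: 0'; 0'; 0'; 0'; [:: 1 *e[0, 1]; 1 *e[2, 3]];
    [:: ((a01 - a23) / 2) *e[0, 1]; b *e[0, 2]; f *e[1, 2]; e *e[0, 3]; c *e[1, 3];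
       (- ((a01 - a23) / 2)) *e[2, 3]]]
  [:: 5 :-> [:: 1 *e[5]; ((a01 + a23) / 2) *e[4]]] [:: 5 :-> [:: 1 *e[5]; (- ((a01 + a23) / 2)) *e[4]]].
move: ((a01 - a23) / 2) H => a H.
have [b0|b0] := eqVneq b 0; last exact: case4_02 H.
have [c0|c0] := eqVneq c 0; last first.
  rebase [:: 0'; 0'; 0'; 0'; [:: 1 *e[0, 1]; 1 *e[2, 3]];
      [:: a *e[0, 1]; c *e[0, 2]; (- e) *e[1, 2]; (- f) *e[0, 3]; b *e[1, 3]; (- a) *e[2, 3]]]
    [:: 0 :-> [:: (-1) *e[1]]; 1 :-> [:: 1 *e[0]]; 2 :-> [:: (-1) *e[3]]; 3 :-> [:: 1 *e[2]]]
    [:: 0 :-> [:: 1 *e[1]]; 1 :-> [:: (-1) *e[0]]; 2 :-> [:: 1 *e[3]]; 3 :-> [:: (-1) *e[2]]].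
  exact: case4_02 H.
have [e0|e0] := eqVneq e 0; last first.
  rebase [:: 0'; 0'; 0'; 0'; [:: 1 *e[0, 1]; 1 *e[2, 3]];
      [:: a *e[0, 1]; e *e[0, 2]; c *e[1, 2]; (- b) *e[0, 3]; (- f) *e[1, 3]; (- a) *e[2, 3]]]
    [:: 2 :-> [:: (-1) *e[3]]; 3 :-> [:: 1 *e[2]]] [:: 2 :-> [:: 1 *e[3]]; 3 :-> [:: (-1) *e[2]]].
  exact: case4_02 H.
have [f0|f0] := eqVneq f 0; last first.
  rebase [:: 0'; 0'; 0'; 0'; [:: 1 *e[0, 1]; 1 *e[2, 3]];
      [:: a *e[0, 1]; f *e[0, 2]; (- b) *e[1, 2]; c *e[0, 3]; (- e) *e[1, 3]; (- a) *e[2, 3]]]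
    [:: 0 :-> [:: (-1) *e[1]]; 1 :-> [:: 1 *e[0]]] [:: 0 :-> [:: 1 *e[1]]; 1 :-> [:: (-1) *e[0]]].
  exact: case4_02 H.
(* Only x0 x1 - x2 x3 is left; a shear that preserves dx4 creates the coefficient 2a on x0 x2. *)
subst b c e f; have [a0|a0] := eqVneq a 0; last first.
  rebase [:: 0'; 0'; 0'; 0'; [:: 1 *e[0, 1]; 1 *e[2, 3]];
      [:: a *e[0, 1]; (2 * a) *e[0, 2]; 0 *e[1, 2]; 0 *e[0, 3]; 0 *e[1, 3]; (- a) *e[2, 3]]]
    [:: 1 :-> [:: 1 *e[1]; 1 *e[2]]; 3 :-> [:: 1 *e[3]; 1 *e[0]]]
    [:: 1 :-> [:: 1 *e[1]; (-1) *e[2]]; 3 :-> [:: 1 *e[3]; (-1) *e[0]]].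
  by apply: case4_02 H; rewrite mulf_neq0.
subst a; leaf 3%N [::] [::].
Qed.

(** Shifts of x2, ..., x5 absorb the three lower terms. The term x0 x2 is cancelled in equal halves
    by the shift of x4 in x0 x4 and that of x3 in x2 x3. *)
Lemma case5_04 (a b c : F) :
  approx 6 [:: 0'; 0'; x01; 0'; [:: 1 *e[0, 2]; 1 *e[1, 3]];
    [:: a *e[0, 2]; c *e[1, 2]; b *e[0, 3]; 1 *e[0, 4]; 1 *e[2, 3]]] d -> classified d.
Proof.
move=> H; leaf 12%N
  [:: 2 :-> [:: 1 *e[2]; (- b) *e[0]]; 3 :-> [:: 1 *e[3]; c *e[1]; (a / 2) *e[0]];
     4 :-> [:: 1 *e[4]; (- (a / 2)) *e[2]]; 5 :-> [:: 1 *e[5]; (b * c) *e[2]]]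
  [:: 2 :-> [:: 1 *e[2]; b *e[0]]; 3 :-> [:: 1 *e[3]; (- c) *e[1]; (- (a / 2)) *e[0]];
     4 :-> [:: 1 *e[4]; (a / 2) *e[2]; (a / 2 * b) *e[0]];
     5 :-> [:: 1 *e[5]; (- (b * c)) *e[2]; (- (b ^+ 2 * c)) *e[0]]].
Qed.

Lemma case5 : approx 5 [:: 0'; 0'; x01; 0'; [:: 1 *e[0, 2]; 1 *e[1, 3]]] d -> classified d.
Proof.
case/approx6 => a01 [a02 [c [b [a13 [a23 [e [a14 [a24 [a34 /= H]]]]]]]]].
have a140 : a14 = 0 by from_jacobi 0%N 1%N 2%N.
have a240 : a24 = 0 by from_jacobi 0%N 1%N 4%N.
have a340 : a34 = 0 by from_jacobi 0%N 2%N 3%N.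
have /subr0_eq a23E : a23 - e = 0 by subst a14 a24 a34; from_jacobi 0%N 1%N 3%N.
subst a14 a24 a34 a23; have [e0|e0] := eqVneq e 0; last first.
  rebase [:: 0'; 0'; x01; 0'; [:: 1 *e[0, 2]; 1 *e[1, 3]];
      [:: ((a02 - a13) / e) *e[0, 2]; (c / e) *e[1, 2]; (b / e) *e[0, 3]; 1 *e[0, 4]; 1 *e[2, 3]]]
    [:: 5 :-> [:: e *e[5]; a01 *e[2]; a13 *e[4]]]
    [:: 5 :-> [:: e^-1 *e[5]; (- (a01 / e)) *e[2]; (- (a13 / e)) *e[4]]].
  exact: case5_04 H.
subst e; rebase [:: 0'; 0'; x01; 0'; [:: 1 *e[0, 2]; 1 *e[1, 3]];
    [:: (a02 - a13) *e[0, 2]; c *e[1, 2]; b *e[0, 3]]]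
  [:: 5 :-> [:: 1 *e[5]; a01 *e[2]; a13 *e[4]]] [:: 5 :-> [:: 1 *e[5]; (- a01) *e[2]; (- a13) *e[4]]].
move: (a02 - a13) H => a H.
(* Completing the square by shifting x1 along x0 removes the term in [a]; the parameter is (a^2 +
   4bc) / (2c)^2, a discriminant up to squares. *)
have [c0|c0] := eqVneq c 0; last first.
  rebase (nth [::] (fam (b / c + (a / c / 2) ^+ 2)) 3)
    [:: 1 :-> [:: 1 *e[1]; (- (a / c / 2)) *e[0]]; 2 :-> [:: 1 *e[2]; (a / c / 2) *e[3]];
       5 :-> [:: c *e[5]; (a / 2) *e[4]]]
    [:: 1 :-> [:: 1 *e[1]; (a / c / 2) *e[0]]; 2 :-> [:: 1 *e[2]; (- (a / c / 2)) *e[3]];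
       5 :-> [:: c^-1 *e[5]; (- (a / c / 2)) *e[4]]].
  exact: fam_leaf H.
(* Here dx4 - dx5 / a = (x1 - (b / a) x0) x3 is decomposable, which reveals the presentation with
   three closed generators first. *)
subst c; have [a0|a0] := eqVneq a 0; last first.
  leaf 22%N
    [:: 0 :-> [:: 1 *e[1]]; 1 :-> [:: 1 *e[0]; (b / a) *e[1]]; 2 :-> [:: (-1) *e[3]; (- (b / a)) *e[2]];
       3 :-> [:: 1 *e[2]]; 4 :-> [:: 1 *e[4]; (-1) *e[5]]; 5 :-> [:: (- a) *e[5]]]
    [:: 0 :-> [:: 1 *e[1]; (- (b / a)) *e[0]]; 1 :-> [:: 1 *e[0]]; 2 :-> [:: 1 *e[3]];
       3 :-> [:: (-1) *e[2]; (- (b / a)) *e[3]]; 4 :-> [:: 1 *e[4]; (- a^-1) *e[5]]; 5 :-> [:: (- a^-1) *e[5]]].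
subst a; have [b0|b0] := eqVneq b 0; last first.
  leaf 19%N [:: 5 :-> [:: b *e[5]]] [:: 5 :-> [:: b^-1 *e[5]]].
subst b; leaf 4%N [::] [::].
Qed.

Lemma case6 : approx 5 [:: 0'; 0'; x01; x02; [:: 1 *e[0, 3]; 1 *e[1, 2]]] d -> classified d.
Proof.
case/approx6 => a01 [a02 [a12 [a03 [a13 [a23 [a [b [a24 [a34 /= H]]]]]]]]].
have a240 : a24 = 0 by from_jacobi 0%N 1%N 4%N.
have a340 : a34 = 0 by from_jacobi 0%N 2%N 4%N.
have /subr0_eq a13E : a13 - a = 0 by subst a24 a34; from_jacobi 0%N 1%N 2%N.
have /eqP : a23 + b = 0 by subst a24 a34; from_jacobi 0%N 1%N 3%N.
rewrite addr_eq0 => /eqP a23E; subst a24 a34 a13 a23.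
rebase [:: 0'; 0'; x01; x02; [:: 1 *e[0, 3]; 1 *e[1, 2]];
    [:: (a12 - a03) *e[1, 2]; a *e[0, 4]; a *e[1, 3]; b *e[1, 4]; (- b) *e[2, 3]]]
  [:: 5 :-> [:: 1 *e[5]; a01 *e[2]; a02 *e[3]; a03 *e[4]]]
  [:: 5 :-> [:: 1 *e[5]; (- a01) *e[2]; (- a02) *e[3]; (- a03) *e[4]]].
move: (a12 - a03) H => c H; have [b0|b0] := eqVneq b 0; last first.
  (* Shifting x1 along x0 removes the terms in [a]. It changes x1 x2 by a multiple of dx3, so x4 is
     shifted along x3 to keep dx4, and x5 absorbs the exact terms. *)
  rebase [:: 0'; 0'; x01; x02; [:: 1 *e[0, 3]; 1 *e[1, 2]];
      [:: (c / b + (a / b) ^+ 2) *e[1, 2]; 1 *e[1, 4]; (-1) *e[2, 3]]]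
    [:: 1 :-> [:: 1 *e[1]; (- (a / b)) *e[0]]; 4 :-> [:: 1 *e[4]; (- (a / b)) *e[3]];
       5 :-> [:: b *e[5]; (- (a ^+ 2 / b)) *e[4]; (- (c * a / b)) *e[3]]]
    [:: 1 :-> [:: 1 *e[1]; (a / b) *e[0]]; 4 :-> [:: 1 *e[4]; (a / b) *e[3]];
       5 :-> [:: b^-1 *e[5]; (a ^+ 2 / b ^+ 2) *e[4]; (a ^+ 3 / b ^+ 3 + c * a / b ^+ 2) *e[3]]].
  (* The shifts of x4 in x1 x4 and of x3 in x2 x3 each cancel half of the term in [g]; together they
     preserve dx4. *)
  move: (c / b + _) H => g H; leaf 13%N
    [:: 3 :-> [:: 1 *e[3]; (- (g / 2)) *e[1]]; 4 :-> [:: 1 *e[4]; (- (g / 2)) *e[2]]]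
    [:: 3 :-> [:: 1 *e[3]; (g / 2) *e[1]]; 4 :-> [:: 1 *e[4]; (g / 2) *e[2]]].
subst b; have [a0|a0] := eqVneq a 0; last first.
  rebase [:: 0'; 0'; x01; x02; [:: 1 *e[0, 3]; 1 *e[1, 2]];
      [:: (c / a) *e[1, 2]; 1 *e[0, 4]; 1 *e[1, 3]]]
    [:: 5 :-> [:: a *e[5]]] [:: 5 :-> [:: a^-1 *e[5]]].
  move: (c / a) H => g H; leaf 14%N
    [:: 1 :-> [:: 1 *e[1]; (g / 2) *e[0]]; 4 :-> [:: 1 *e[4]; (g / 2) *e[3]];
       5 :-> [:: 1 *e[5]; g *e[4]; (g ^+ 2 / 2) *e[3]]]
    [:: 1 :-> [:: 1 *e[1]; (- (g / 2)) *e[0]]; 4 :-> [:: 1 *e[4]; (- (g / 2)) *e[3]];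
       5 :-> [:: 1 *e[5]; (- g) *e[4]]].
subst a; have [c0|c0] := eqVneq c 0; last first.
  leaf 23%N [:: 4 :-> [:: 1 *e[5]; 1 *e[4]]; 5 :-> [:: c *e[4]]]
    [:: 4 :-> [:: c^-1 *e[5]]; 5 :-> [:: 1 *e[4]; (- c^-1) *e[5]]].
subst c; leaf 5%N [::] [::].
Qed.

Lemma case7 : approx 5 [:: 0'; 0'; x01; x02; x03] d -> classified d.
Proof.
case/approx6 => a01 [a02 [b [a03 [a13 [a23 [a [c [a24 [a34 /= H]]]]]]]]].
have a130 : a13 = 0 by from_jacobi 0%N 1%N 2%N.
have a240 : a24 = 0 by from_jacobi 0%N 1%N 4%N.
have a340 : a34 = 0 by from_jacobi 0%N 2%N 4%N.
have /eqP : a23 + c = 0 by subst a24 a34; from_jacobi 0%N 1%N 3%N.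
rewrite addr_eq0 => /eqP a23E; subst a24 a34 a13 a23.
rebase [:: 0'; 0'; x01; x02; x03; [:: b *e[1, 2]; a *e[0, 4]; c *e[1, 4]; (- c) *e[2, 3]]]
  [:: 5 :-> [:: 1 *e[5]; a01 *e[2]; a02 *e[3]; a03 *e[4]]]
  [:: 5 :-> [:: 1 *e[5]; (- a01) *e[2]; (- a02) *e[3]; (- a03) *e[4]]].
have [c0|c0] := eqVneq c 0; last first.
  rebase [:: 0'; 0'; x01; x02; x03; [:: (b / c) *e[1, 2]; 1 *e[1, 4]; (- 1) *e[2, 3]]]
    [:: 1 :-> [:: 1 *e[1]; (- (a / c)) *e[0]]; 5 :-> [:: c *e[5]; (- (a * b / c)) *e[3]]]
    [:: 1 :-> [:: 1 *e[1]; (a / c) *e[0]]; 5 :-> [:: c^-1 *e[5]; (a * b / c ^+ 2) *e[3]]].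
  move: (b / c) H => g H; leaf 15%N
    [:: 3 :-> [:: 1 *e[3]; (- (g / 2)) *e[1]]; 4 :-> [:: 1 *e[4]; (- (g / 2)) *e[2]]]
    [:: 3 :-> [:: 1 *e[3]; (g / 2) *e[1]]; 4 :-> [:: 1 *e[4]; (g / 2) *e[2]]].
subst c; have [a0|a0] := eqVneq a 0; have [b0|b0] := eqVneq b 0.
- subst a b; leaf 6%N [::] [::].
- subst a; leaf 23%N [:: 5 :-> [:: b *e[4]]; 4 :-> [:: 1 *e[5]]] [:: 4 :-> [:: b^-1 *e[5]]; 5 :-> [:: 1 *e[4]]].
- subst b; leaf 17%N [:: 5 :-> [:: a *e[5]]] [:: 5 :-> [:: a^-1 *e[5]]].
(* Scaling x1, ..., x4 by t = a / b equalizes the coefficients a t and b t^2. *)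
leaf 16%N
  [:: 1 :-> [:: (a / b) *e[1]]; 2 :-> [:: (a / b) *e[2]]; 3 :-> [:: (a / b) *e[3]]; 4 :-> [:: (a / b) *e[4]];
     5 :-> [:: (a ^+ 2 / b) *e[5]]]
  [:: 1 :-> [:: (b / a) *e[1]]; 2 :-> [:: (b / a) *e[2]]; 3 :-> [:: (b / a) *e[3]]; 4 :-> [:: (b / a) *e[4]];
     5 :-> [:: (b / a ^+ 2) *e[5]]].
Qed.

(** Modulo x0, dx5 is the quadratic form with Gram matrix (p, q; q, r) on x1, x2. Completing the
    square leaves the parameter (p r - q^2) / p^2; if it is nonzero, the remaining x0 x4 is absorbed
    by shifting x2 along x0. *)
Lemma case8_13 (s a b p q r : F) : p != 0 ->
  approx 6 [:: 0'; 0'; 0'; x01; x02; [:: s *e[1, 2]; a *e[0, 3]; b *e[0, 4]; p *e[1, 3];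
    q *e[1, 4]; q *e[2, 3]; r *e[2, 4]]] d -> classified d.
Proof.
move=> p0 H.
rebase [:: 0'; 0'; 0'; x01; x02; [:: 1 *e[1, 3]; (r / p - (q / p) ^+ 2) *e[2, 4];
    (b / p - q * a / p ^+ 2) *e[0, 4]]]
  [:: 1 :-> [:: 1 *e[1]; (- (q / p)) *e[2]; (- (a / p)) *e[0]];
     3 :-> [:: 1 *e[3]; (- (q / p)) *e[4]; (- (s / p)) *e[2]]; 5 :-> [:: p *e[5]; (- (s * a / p)) *e[4]]]
  [:: 1 :-> [:: 1 *e[1]; (q / p) *e[2]; (a / p) *e[0]];
     3 :-> [:: 1 *e[3]; (q / p) *e[4]; (s / p) *e[2]]; 5 :-> [:: p^-1 *e[5]; (s * a / p ^+ 2) *e[4]]].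
move: (_ - _) (b / p - _) H => u g H; have [u0|u0] := eqVneq u 0; last first.
  rebase (nth [::] (fam u) 0) [:: 2 :-> [:: 1 *e[2]; (- (g / u)) *e[0]]] [:: 2 :-> [:: 1 *e[2]; (g / u) *e[0]]].
  exact: fam_leaf H.
subst u; have [g0|g0] := eqVneq g 0; first by subst g; leaf 22%N [::] [::].
leaf 18%N [:: 2 :-> [:: g^-1 *e[2]]; 4 :-> [:: g^-1 *e[4]]] [:: 2 :-> [:: g *e[2]]; 4 :-> [:: g *e[4]]].
Qed.

Lemma case8_03 (s a b : F) : a != 0 ->
  approx 6 [:: 0'; 0'; 0'; x01; x02; [:: s *e[1, 2]; a *e[0, 3]; b *e[0, 4]]] d -> classified d.
Proof.
move=> a0 H; rebase [:: 0'; 0'; 0'; x01; x02; [:: (s / a) *e[1, 2]; 1 *e[0, 3]]]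
  [:: 1 :-> [:: a^-1 *e[1]; (- (b / a)) *e[2]]; 3 :-> [:: a^-1 *e[3]; (- (b / a)) *e[4]]]
  [:: 1 :-> [:: a *e[1]; b *e[2]]; 3 :-> [:: a *e[3]; b *e[4]]].
move: (s / a) H => {}s H; have [s0|s0] := eqVneq s 0.
  subst s; leaf 20%N
    [:: 3 :-> [:: 1 *e[2]]; 2 :-> [:: 1 *e[3]]; 5 :-> [:: 1 *e[4]]; 4 :-> [:: 1 *e[5]]]
    [:: 3 :-> [:: 1 *e[2]]; 2 :-> [:: 1 *e[3]]; 5 :-> [:: 1 *e[4]]; 4 :-> [:: 1 *e[5]]].
leaf 19%N
  [:: 3 :-> [:: 1 *e[2]]; 2 :-> [:: s^-1 *e[3]]; 5 :-> [:: 1 *e[4]]; 4 :-> [:: s^-1 *e[5]]]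
  [:: 2 :-> [:: 1 *e[3]]; 3 :-> [:: s *e[2]]; 4 :-> [:: 1 *e[5]]; 5 :-> [:: s *e[4]]].
Qed.

Lemma case8 : approx 5 [:: 0'; 0'; 0'; x01; x02] d -> classified d.
Proof.
case/approx6 => a01 [a02 [s [a [p [a23 [b [q [r [a34 /= H]]]]]]]]].
have a340 : a34 = 0 by from_jacobi 0%N 1%N 4%N.
have /subr0_eq a23E : a23 - q = 0 by from_jacobi 0%N 1%N 2%N.
subst a34 a23; rebase [:: 0'; 0'; 0'; x01; x02; [:: s *e[1, 2]; a *e[0, 3]; b *e[0, 4]; p *e[1, 3];
    q *e[1, 4]; q *e[2, 3]; r *e[2, 4]]]
  [:: 5 :-> [:: 1 *e[5]; a01 *e[3]; a02 *e[4]]] [:: 5 :-> [:: 1 *e[5]; (- a01) *e[3]; (- a02) *e[4]]].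
have [p0|p0] := eqVneq p 0; last exact: case8_13 H.
have [r0|r0] := eqVneq r 0; last first.
  rebase [:: 0'; 0'; 0'; x01; x02; [:: (- s) *e[1, 2]; b *e[0, 3]; a *e[0, 4]; r *e[1, 3];
      q *e[1, 4]; q *e[2, 3]; p *e[2, 4]]]
    [:: 1 :-> [:: 1 *e[2]]; 2 :-> [:: 1 *e[1]]; 3 :-> [:: 1 *e[4]]; 4 :-> [:: 1 *e[3]]]
    [:: 1 :-> [:: 1 *e[2]]; 2 :-> [:: 1 *e[1]]; 3 :-> [:: 1 *e[4]]; 4 :-> [:: 1 *e[3]]].
  exact: case8_13 H.
(* A hyperbolic quadratic form with both diagonal entries zero: the shear by x1 creates the diagonal
   entry 2q. *)
have [q0|q0] := eqVneq q 0; last first.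
  subst p r; rebase [:: 0'; 0'; 0'; x01; x02; [:: s *e[1, 2]; (a + b) *e[0, 3]; b *e[0, 4];
      (2 * q) *e[1, 3]; q *e[1, 4]; q *e[2, 3]; 0 *e[2, 4]]]
    [:: 2 :-> [:: 1 *e[2]; 1 *e[1]]; 4 :-> [:: 1 *e[4]; 1 *e[3]]]
    [:: 2 :-> [:: 1 *e[2]; (-1) *e[1]]; 4 :-> [:: 1 *e[4]; (-1) *e[3]]].
  by apply: case8_13 H; rewrite mulf_neq0.
subst p q r; rebase [:: 0'; 0'; 0'; x01; x02; [:: s *e[1, 2]; a *e[0, 3]; b *e[0, 4]]] [::] [::].
have [a0|a0] := eqVneq a 0; last exact: case8_03 H.
have [b0|b0] := eqVneq b 0; last first.
  rebase [:: 0'; 0'; 0'; x01; x02; [:: (- s) *e[1, 2]; b *e[0, 3]; a *e[0, 4]]]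
    [:: 1 :-> [:: 1 *e[2]]; 2 :-> [:: 1 *e[1]]; 3 :-> [:: 1 *e[4]]; 4 :-> [:: 1 *e[3]]]
    [:: 1 :-> [:: 1 *e[2]]; 2 :-> [:: 1 *e[1]]; 3 :-> [:: 1 *e[4]]; 4 :-> [:: 1 *e[3]]].
  exact: case8_03 H.
subst a b; have [s0|s0] := eqVneq s 0; first by subst s; leaf 7%N [::] [::].
leaf 21%N [:: 5 :-> [:: s *e[5]]] [:: 5 :-> [:: s^-1 *e[5]]].
Qed.

(** Again a binary quadratic form, now on x0, x1; a change of determinant 1 completes the square and
    keeps dx2. *)
Lemma case9_03 (p q r : F) : p != 0 ->
  approx 6 [:: 0'; 0'; x01; x02; x12; [:: p *e[0, 3]; q *e[0, 4]; q *e[1, 3]; r *e[1, 4]]] d ->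
  classified d.
Proof.
move=> p0 H; rebase (nth [::] (fam (r / p - (q / p) ^+ 2)) 1)
  [:: 0 :-> [:: 1 *e[0]; (- (q / p)) *e[1]]; 3 :-> [:: 1 *e[3]; (- (q / p)) *e[4]]; 5 :-> [:: p *e[5]]]
  [:: 0 :-> [:: 1 *e[0]; (q / p) *e[1]]; 3 :-> [:: 1 *e[3]; (q / p) *e[4]]; 5 :-> [:: p^-1 *e[5]]].
exact: fam_leaf H.
Qed.

Lemma case9 : approx 5 [:: 0'; 0'; x01; x02; x12] d -> classified d.
Proof.
case/approx6 => a01 [a02 [a12 [p [a13 [a23 [q [r [a24 [a34 /= H]]]]]]]]].
have a230 : a23 = 0 by from_jacobi 0%N 1%N 3%N.
have a240 : a24 = 0 by from_jacobi 0%N 1%N 4%N.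
have a340 : a34 = 0 by from_jacobi 0%N 2%N 4%N.
have /subr0_eq a13E : a13 - q = 0 by from_jacobi 0%N 1%N 2%N.
subst a23 a24 a34 a13.
rebase [:: 0'; 0'; x01; x02; x12; [:: p *e[0, 3]; q *e[0, 4]; q *e[1, 3]; r *e[1, 4]]]
  [:: 5 :-> [:: 1 *e[5]; a01 *e[2]; a02 *e[3]; a12 *e[4]]]
  [:: 5 :-> [:: 1 *e[5]; (- a01) *e[2]; (- a02) *e[3]; (- a12) *e[4]]].
have [p0|p0] := eqVneq p 0; last exact: case9_03 H.
have [r0|r0] := eqVneq r 0; last first.
  rebase [:: 0'; 0'; x01; x02; x12; [:: r *e[0, 3]; (- q) *e[0, 4]; (- q) *e[1, 3]; p *e[1, 4]]]
    [:: 0 :-> [:: (-1) *e[1]]; 1 :-> [:: 1 *e[0]]; 3 :-> [:: (-1) *e[4]]; 4 :-> [:: 1 *e[3]]]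
    [:: 0 :-> [:: 1 *e[1]]; 1 :-> [:: (-1) *e[0]]; 3 :-> [:: 1 *e[4]]; 4 :-> [:: (-1) *e[3]]].
  exact: case9_03 H.
subst p r; have [q0|q0] := eqVneq q 0; last first.
  rebase [:: 0'; 0'; x01; x02; x12; [:: (2 * q) *e[0, 3]; q *e[0, 4]; q *e[1, 3]; 0 *e[1, 4]]]
    [:: 1 :-> [:: 1 *e[1]; 1 *e[0]]; 4 :-> [:: 1 *e[4]; 1 *e[3]]]
    [:: 1 :-> [:: 1 *e[1]; (-1) *e[0]]; 4 :-> [:: 1 *e[4]; (-1) *e[3]]].
  by apply: case9_03 H; rewrite mulf_neq0.
subst q; leaf 8%N [::] [::].
Qed.
End Dimension6.

(** * Completeness of the list and minimality of the models *)

Section Models.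
Variable F : fieldType.
Hypothesis two_neq0 : (2%:R : F) != 0.
Local Notation form := (seq (nat * nat * F)).
Implicit Types s : seq form.

Lemma classification d : is_minimal_algebra d -> classified (F := F) d.
Proof.
move=> md; have cd : is_cdga_differential d by case: md.
have [k [k9 H]] := red5 two_neq0 cd (approx_start two_neq0 md).
case: k k9 H => [|[|[|[|[|[|[|[|[|//]]]]]]]]] _.
- exact: case1.
- exact: case2.
- exact: case3.
- exact: case4.
- exact: case5.
- exact: case6.
- exact: case7.
- exact: case8.
- exact: case9.
Qed.

Definition triangular_check s := all (fun i => bounded i (nth [::] s i)) (iota 0 6).
Definition jacobi_goals s := conj_all [seq jac s (nth [::] s x.1) x.2.2.1 x.2.2.2 x.2.1 = 0 |
  x <- [seq (i, y) | i <- iota 0 6, y <- [seq (r, z) | r <- iota 0 6,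
    z <- [seq (p, q) | q <- iota 0 r, p <- iota 0 q]]]].

Lemma minimal_check s : triangular_check s -> jacobi_goals s -> is_minimal_algebra (alg s).
Proof.
move=> /allP ts /conj_allP js; apply: minimal_alg => [i i6|i r q p i6 r6 qr pq].
  by apply: ts; rewrite mem_iota.
apply: (js (i, (r, (p, q)))); apply/allpairsPdep; exists i, (r, (p, q)).
split; rewrite ?mem_iota //; apply/allpairsPdep; exists r, (p, q).
split; rewrite ?mem_iota //; apply/allpairsPdep; exists q, p.
by rewrite !mem_iota.
Qed.

Lemma dga_iso_refl n (d : ext F n -> ext F n) : dga_iso d d.
Proof. by exists id; split=> //; split=> //; exists id. Qed.

Lemma approx_refl s : approx 6 s (alg s).
Proof. by exists (fun _ _ _ => 0); rewrite /tail /= cats0; apply: dga_iso_refl. Qed.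

(** A diagonal rescaling of the generators suffices in each family. *)
Lemma fam_square k (v w : F) : (k < 4)%N -> w != 0 ->
  dga_iso (alg (nth [::] (fam (v * w ^+ 2)) k)) (alg (nth [::] (fam v) k)).
Proof.
move=> k4 w0; apply: approx_full; have H := approx_refl (nth [::] (fam (v * w ^+ 2)) k).
case: k k4 H => [|[|[|[|//]]]] _ H.
- rebase (nth [::] (fam v) 0) [:: 2 :-> [:: w^-1 *e[2]]; 4 :-> [:: w^-1 *e[4]]]
    [:: 2 :-> [:: w *e[2]]; 4 :-> [:: w *e[4]]].
  exact: H.
- rebase (nth [::] (fam v) 1)
    [:: 1 :-> [:: w^-1 *e[1]]; 2 :-> [:: w^-1 *e[2]]; 3 :-> [:: w^-1 *e[3]]; 4 :-> [:: (w ^+ 2)^-1 *e[4]]; 5 :-> [:: w^-1 *e[5]]]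
    [:: 1 :-> [:: w *e[1]]; 2 :-> [:: w *e[2]]; 3 :-> [:: w *e[3]]; 4 :-> [:: (w ^+ 2) *e[4]]; 5 :-> [:: w *e[5]]].
  exact: H.
- rebase (nth [::] (fam v) 2)
    [:: 1 :-> [:: w^-1 *e[1]]; 3 :-> [:: w^-1 *e[3]]; 4 :-> [:: w^-1 *e[4]]]
    [:: 1 :-> [:: w *e[1]]; 3 :-> [:: w *e[3]]; 4 :-> [:: w *e[4]]].
  exact: H.
rebase (nth [::] (fam v) 3)
  [:: 1 :-> [:: w *e[1]]; 2 :-> [:: w *e[2]]; 4 :-> [:: w *e[4]]; 5 :-> [:: (w ^+ 2) *e[5]]]
  [:: 1 :-> [:: w^-1 *e[1]]; 2 :-> [:: w^-1 *e[2]]; 4 :-> [:: w^-1 *e[4]]; 5 :-> [:: (w ^+ 2)^-1 *e[5]]].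
exact: H.
Qed.
End Models.

Ltac solve_jacobi := cbv beta iota zeta delta [jacobi_goals jac jterm conj_all foldr coef flatten cat
  map nth iota fst snd eqn andb forms fam]; repeat split; first [reflexivity | ring].

Lemma minimal_model (F : fieldType) (t : ('I_26 + 'I_4 * F)%type) : is_minimal_algebra (model t).
Proof.
case: t => [[k k26]|[[k k4] u]] /=; apply: minimal_check.
- by do 26?[case: k k26 => [|k] k26 //].
- do 26?[case: k k26 => [|k] k26; [solve_jacobi|]]; by [].
- by do 4?[case: k k4 => [|k] k4 //].
- do 4?[case: k k4 => [|k] k4; [solve_jacobi|]]; by [].
Qed.

(** * Separating the normal forms *)

Section Invariants.
Variable F : fieldType.
Hypothesis two_neq0 : (2%:R : F) != 0.
Local Notation form := (seq (nat * nat * F)).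
Implicit Types (l : form) (s : seq form).

Definition increasing m l := all (fun t => (t.1.1 < t.1.2) && (t.1.2 < m))%N l.
Definition fmx l : 'M[F]_6 := \matrix_(p, q) coef l p q.

Lemma increasing_bounded m l : increasing m l -> bounded m l.
Proof. by apply: sub_all => t /andP[jk km]; rewrite km (ltn_trans jk). Qed.

Lemma fmx_cons j k a l : increasing 6 ((j, k, a) :: l) ->
  fmx ((j, k, a) :: l) = a *: (delta_mx (inord j) (inord k) - delta_mx (inord k) (inord j)) + fmx l.
Proof.
move=> /andP[/andP[/= jk k6] _]; have j6 := ltn_trans jk k6.
have inE (x : 'I_6) m : (m < 6)%N -> (x == inord m) = eqn m x.
  by move=> m6; rewrite -val_eqE /= inordK // eq_sym.
apply/matrixP=> p q; rewrite !mxE /= !inE //.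
case: (@eqnP j p) => [jp|_] /=; last first.
  by rewrite andbC; case: andb => /=; ring.
rewrite (_ : eqn k p = false) ?andbF /=; last by apply/eqnP => kp; rewrite kp -jp ltnn in jk.
by case: eqn => /=; ring.
Qed.

Lemma fmx_skew l : increasing 6 l -> (fmx l)^T = - fmx l.
Proof.
elim: l => [|[[j k] a] l IH] il; first by apply/matrixP=> p q; rewrite !mxE oppr0.
rewrite fmx_cons // linearD linearZ /= linearB /= !trmx_delta opprD -IH; last by case/andP: il.
by rewrite -scalerN opprB.
Qed.

Lemma lform2 (u v : 'rV[F]_6) (p q : 'I_6) : (p < q)%N ->
  wedge (lform u) (lform v) [set p; q] = u 0 p * v 0 q - u 0 q * v 0 p.
Proof.
move=> pq; rewrite {1}/lform wedge_suml sum_ffunE.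
under eq_bigr => i _ do rewrite wedgeZl escaleE wedge_gen2 // !lformE mulrBr.
rewrite sumrB; congr (_ - _).
  rewrite (bigD1 p) //= eqxx mul1r big1 ?addr0 // => i /negPf->.
  by rewrite mul0r mulr0.
by rewrite (bigD1 q) //= eqxx mul1r big1 ?addr0 // => i /negPf->; rewrite mul0r mulr0.
Qed.

Fixpoint minors (f : nat -> nat -> F) l p q : F :=
  if l is (j, k, a) :: l' then a * (f j p * f k q - f j q * f k p) + minors f l' p q else 0.

Definition entry (P : 'M[F]_6) i j := P (inord i) (inord j).

Lemma aext_minors P l p q : bounded 6 l -> (p < q)%N -> (q < 6)%N ->
  aext P (fval l) [set inord p; inord q] = minors (entry P) l p q.
Proof.
move=> bl pq q6; elim: l bl => [|[[j k] a] l IH] /=.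
  by rewrite /fval big_nil (lin0 (aext_lin _)) ffunE.
move=> /andP[_ bl]; rewrite fval_cons (aext_lin P) addE escaleE IH //.
by rewrite aextM // !aext_gen // lform2 ?ltn_inord // !mxE.
Qed.

Lemma alg_lform s u p q : all (bounded 6) s -> (p < q)%N -> (q < 6)%N ->
  alg s (lform u) [set inord p; inord q] = \sum_(i < 6) u 0 i * coef (nth [::] s i) p q.
Proof.
move=> bs pq q6; rewrite /lform (lin_sum (alg_lin s)) sum_ffunE; apply: eq_bigr => i _.
rewrite (linZ (alg_lin s)) escaleE -[i in alg s (gen F i)]inord_val -/(e F i) alg_e //.
by rewrite fval_coef ?bounded_nth.
Qed.

Lemma iso_minors s s' : all (bounded 6) s -> all (bounded 6) s' -> dga_iso (alg s) (alg s') ->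
  exists2 P : 'M[F]_6, P \in unitmx & forall i p q, (i < 6)%N -> (p < q)%N -> (q < 6)%N ->
    minors (entry P) (nth [::] s i) p q = \sum_(j < 6) entry P i j * coef (nth [::] s' j) p q.
Proof.
move=> bs bs' /(iso_matrix two_neq0)[P uP PE]; exists P => // i p q i6 pq q6.
rewrite -aext_minors ?bounded_nth // -alg_e // PE alg_lform //.
by apply: eq_bigr => j _; rewrite mxE /entry inord_val.
Qed.

Lemma minors_mx P l (p q : 'I_6) : increasing 6 l ->
  (P^T *m fmx l *m P) p q = minors (entry P) l p q.
Proof.
elim: l => [|[[j k] a] l IH] il /=.
  have -> : fmx [::] = 0 by apply/matrixP=> p' q'; rewrite !mxE.
  by rewrite mulmx0 mul0mx mxE.
rewrite fmx_cons // mulmxDr mulmxDl [in LHS]mxE IH; last by case/andP: il.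
congr (_ + _); rewrite -scalemxAr -scalemxAl mxE; congr (_ * _).
have dl (m m' : 'I_6) : (P^T *m delta_mx m m' *m P) p q = P m p * P m' q.
  rewrite -(mul_delta_mx (0 : 'I_1)) mulmxA -mulmxA -rowE -colE mxE big_ord1 !mxE //.
by rewrite mulmxBr mulmxBl [LHS]mxE [X in _ + X]mxE !dl /entry !inord_val [P (inord k) p * _]mulrC.
Qed.

(** [iso_minors] is this identity above the diagonal; both sides are skew-symmetric, and 2 is
    invertible, which settles the rest. *)
Lemma iso_fmx s s' : all (increasing 6) s -> all (increasing 6) s' -> dga_iso (alg s) (alg s') ->
  exists2 P : 'M[F]_6, P \in unitmx & forall i : 'I_6,
    P^T *m fmx (nth [::] s i) *m P = \sum_j P i j *: fmx (nth [::] s' j).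
Proof.
have ib t : all (increasing 6) t -> all (bounded 6) t.
  by apply: sub_all => l; apply: increasing_bounded.
have ni t i : all (increasing 6) t -> increasing 6 (nth [::] t i).
  move=> it; have [/(mem_nth [::])/(allP it)//|le] := ltnP i (size t); by rewrite nth_default.
move=> is1 is2 /(iso_minors (ib _ is1) (ib _ is2))[P uP PE]; exists P => // i.
set M := LHS; set N := RHS.
have MT : M^T = - M by rewrite /M !trmx_mul trmxK fmx_skew ?ni // mulmxA mulmxN mulNmx.
have NT : N^T = - N.
  rewrite /N linear_sum -sumrN; apply: eq_bigr => j _ /=.
  by rewrite linearZ /= fmx_skew ?ni // scalerN.
have lt (p q : 'I_6) : (p < q)%N -> M p q = N p q.
  move=> pq; rewrite /M minors_mx ?ni // PE // /N summxE; apply: eq_bigr => j _.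
  by rewrite /entry !inord_val !mxE.
have sk (T : 'M[F]_6) : T^T = - T -> forall a b, T a b = - T b a.
  by move=> TT a b; have /matrixP/(_ b a) := TT; rewrite !mxE.
have diag (T : 'M[F]_6) a : T^T = - T -> T a a = 0.
  move=> /sk/(_ a a)/eqP; rewrite -addr_eq0 -mulr2n -mulr_natl mulf_eq0.
  by rewrite (negPf two_neq0) => /eqP.
apply/matrixP=> p q; case: (ltngtP p q) => [/lt//|qp|/val_inj->]; last by rewrite !diag.
by rewrite (sk _ MT) (sk _ NT) lt.
Qed.

(** The Lie bracket on the dual of degree 1, with the sign convention that the i-th coordinate of
    [x, y] is dx_i evaluated at (x, y). *)
Definition bracket s (x y : 'cV[F]_6) : 'cV[F]_6 :=
  \col_i (x^T *m fmx (nth [::] s i) *m y) 0 0.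

Lemma bracketE s x y (i : 'I_6) : bracket s x y i 0 =
  \sum_(j < 6) \sum_(k < 6) x j 0 * coef (nth [::] s i) j k * y k 0.
Proof.
rewrite !mxE exchange_big; apply: eq_bigr => k _; rewrite mxE mulr_suml.
by apply: eq_bigr => j _; rewrite !mxE.
Qed.

(** By duality the arrow is reversed: [P] is a Lie algebra morphism from the algebra of [s'] to that
    of [s]. *)
Lemma bracket_iso s s' P : (forall i : 'I_6,
    P^T *m fmx (nth [::] s i) *m P = \sum_j P i j *: fmx (nth [::] s' j)) ->
  forall x y, bracket s (P *m x) (P *m y) = P *m bracket s' x y.
Proof.
move=> PE x y; apply/colP=> i; rewrite [LHS]mxE trmx_mul [RHS]mxE.
transitivity ((x^T *m (P^T *m fmx (nth [::] s i) *m P) *m y) 0 0); first by rewrite !mulmxA.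
rewrite PE mulmx_sumr mulmx_suml summxE; apply: eq_bigr => j _.
by rewrite -scalemxAr -scalemxAl [LHS]mxE; congr (_ * _); rewrite [RHS]mxE.
Qed.

End Invariants.

(* Characteristic subspaces of a Lie algebra L: [Brk A B] is [A, B] and [Col A B] is
   {x | [x, A] <= B}. *)
Inductive csub := Full | Null | Brk of csub & csub | Col of csub & csub.

Definition linked (S : seq (seq (nat * nat))) m i j :=
  ((i, j) \in nth [::] S m) || ((j, i) \in nth [::] S m).

(* Each element of [eqs] is the support of a homogeneous linear equation; [solve eqs] lists
   unknowns that are forced to vanish, one at a time. *)
Definition prune (Z e : seq nat) := [seq i <- e | i \notin Z].
Definition solve (eqs : seq (seq nat)) : seq nat :=
  iter 6 (fun Z => undup (Z ++ flatten [seq if prune Z e is [:: i] then [:: i] else [::] | e <- eqs])) [::].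
(** Under this condition the solution space is the coordinate subspace of the unknowns not in
    [solve eqs], whatever the nonzero coefficients are; this makes the computation independent of
    the parameter. *)
Definition solved (eqs : seq (seq nat)) :=
  let Z := solve eqs in all (fun e => all (fun i => i \in Z) e) eqs.

Definition below6 (p : pred nat) := [seq i <- iota 0 6 | p i].

Lemma mem_below6 (p : pred nat) i : (i \in below6 p) = p i && (i < 6)%N.
Proof. by rewrite mem_filter mem_iota. Qed.

Lemma below6_uniq p : uniq (below6 p).
Proof. by rewrite filter_uniq ?iota_uniq. Qed.

(** Supports of the equations for a linear form that kills all brackets of basis vectors from [a]
    and [b]; its forced zeros span the bracket. *)
Definition brk_eqs S (a b : seq nat) :=
  [seq below6 (fun m => linked S m z.1 z.2) | z <- [seq (j, k) | j <- a, k <- b]].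
(** Supports of the equations for x: for k in [a] and m outside [b], the m-th coordinate of [x, e_k]
    vanishes. *)
Definition col_eqs S (a b : seq nat) :=
  [seq below6 (fun i => linked S z.2 i z.1) | z <- [seq (k, m) | k <- a, m <- below6 (fun m => m \notin b)]].

(* The coordinate subspace denoted by a term, provided the equations met on the way are [solved]. *)
Fixpoint csupp S (t : csub) : seq nat :=
  match t with
  | Full => below6 predT
  | Null => [::]
  | Brk A B => let Z := solve (brk_eqs S (csupp S A) (csupp S B)) in below6 (fun i => i \in Z)
  | Col A B => let Z := solve (col_eqs S (csupp S A) (csupp S B)) in below6 (fun i => i \notin Z)
  end.
Fixpoint computable S (t : csub) : bool :=
  match t with
  | Full | Null => true
  | Brk A B => [&& computable S A, computable S B & solved (brk_eqs S (csupp S A) (csupp S B))]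
  | Col A B => [&& computable S A, computable S B & solved (col_eqs S (csupp S A) (csupp S B))]
  end.

Arguments below6 : simpl never.
Arguments solve : simpl never.
Arguments solved : simpl never.
Arguments brk_eqs : simpl never.
Arguments col_eqs : simpl never.

(** * Invariance of the dimensions of characteristic subspaces *)

Section Characteristic.
Variable F : fieldType.
Hypothesis two_neq0 : (2%:R : F) != 0.
Local Notation form := (seq (nat * nat * F)).
Implicit Types (l : form) (s : seq form).

Definition monomials s := [seq [seq t.1 | t <- l] | l <- s].
(** Excludes cancellations, so that the listed monomials are exactly the support of the form. *)
Definition reduced l := uniq [seq t.1 | t <- l] /\ {in l, forall t, t.2 != 0}.

Lemma coef_neq0 l i j : increasing 6 l -> reduced l ->
  (coef l i j != 0) = ((i, j) \in [seq t.1 | t <- l]) || ((j, i) \in [seq t.1 | t <- l]).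
Proof.
move=> + [] ; elim: l => [|[[j0 k0] a] l IH] /=; first by rewrite eqxx.
move=> /andP[/= jk il] /andP[nl ul] nz; have a0 : a != 0 := nz _ (mem_head _ _).
have {}IH := IH il ul (fun t tl => nz t (mem_behead (s := _ :: _) tl)).
have rev : (k0, j0) \notin [seq t.1 | t <- l].
  apply/negP=> /mapP[t tl tE]; have /andP[] := allP il _ tl; rewrite -tE /= => kj _.
  by case/andP: jk => /(ltn_trans kj); rewrite ltnn.
rewrite !inE !xpair_eqE !eqnE ![_ == j0]eq_sym ![_ == k0]eq_sym.
case: (eqVneq j0 i) => [ji|nji] /=; case: (eqVneq k0 j) => [kj|nkj] /=.
- have /eqP -> : coef l i j == 0 by rewrite -[_ == 0]negbK IH -ji -kj (negPf nl) (negPf rev).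
  by rewrite addr0 a0.
- rewrite andbC; case: (eqVneq k0 i) => [ki|_] /=.
    by case/andP: jk; rewrite ji ki ltnn.
  by rewrite IH.
- case: (eqVneq j0 j) => [jj|_] /=.
    by case/andP: jk; rewrite jj kj ltnn.
  by rewrite IH.
case: (eqVneq j0 j) => [jj|_] /=; last by rewrite IH.
case: (eqVneq k0 i) => [ki|_] /=; last by rewrite IH.
have /eqP -> : coef l i j == 0 by rewrite -[_ == 0]negbK IH -ki -jj (negPf nl) (negPf rev).
by rewrite sub0r oppr_eq0 a0 orbT.
Qed.

(** The span of the brackets is described as a double annihilator, so that membership is a statement
    about linear equations, as in the case of [Col]. *)
Fixpoint csub_mem s t (x : 'cV[F]_6) : Prop :=
  match t with
  | Full => True
  | Null => x = 0
  | Brk A B => forall v : 'rV[F]_6, (forall y z, csub_mem s A y -> csub_mem s B z ->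
      v *m bracket s y z = 0) -> v *m x = 0
  | Col A B => forall y, csub_mem s A y -> csub_mem s B (bracket s x y)
  end.

Lemma csub_iso s s' P t x : P \in unitmx ->
  (forall x y, bracket s (P *m x) (P *m y) = P *m bracket s' x y) ->
  csub_mem s t (P *m x) <-> csub_mem s' t x.
Proof.
move=> uP PE; elim: t x => [|//|A IHA B IHB|A IHA B IHB] x //=.
- by split=> [/(congr1 (mulmx (invmx P)))|->]; rewrite ?mulKmx // mulmx0.
- split=> H v Hv.
    rewrite -[v](mulmxKV uP) -(mulmxA _ P); apply: H => y z.
    rewrite -[y](mulKVmx uP) -[z](mulKVmx uP) => /IHA yA /IHB zB.
    by rewrite PE mulmxA mulmxKV // Hv.
  rewrite mulmxA; apply: H => y z yA zB.
  by rewrite -mulmxA -PE Hv //; [apply/IHA | apply/IHB].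
split=> H y yA; first by apply/IHB; rewrite -PE; apply: H; apply/IHA.
rewrite -[y](mulKVmx uP) PE; apply/IHB/H/IHA; by rewrite mulKVmx.
Qed.

Definition coord (a : seq nat) (x : 'cV[F]_6) := forall i : 'I_6, val i \notin a -> x i 0 = 0.

Lemma solve_sound (eqs : seq (seq nat)) (x : 'I_6 -> F) :
  (forall e, e \in eqs -> exists2 c : 'I_6 -> F, (forall i, (c i != 0) = (val i \in e)) &
     \sum_i c i * x i = 0) ->
  forall i : 'I_6, val i \in solve eqs -> x i = 0.
Proof.
move=> He; rewrite /solve; set f := (f in iter _ f).
suff: forall m (i : 'I_6), val i \in iter m f [::] -> x i = 0 by apply.
elim=> //= m; set Z := iter _ _ _ => IH i.
rewrite mem_undup mem_cat => /orP[/IH//|/flattenP[u /mapP[e eE ->]]].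
case: {2 3}(prune Z e) (erefl (prune Z e)) => [//|k [|//]] eZ; rewrite inE => /eqP ik.
have [c cE c0] := He _ eE; have ie : val i \in e /\ val i \notin Z.
  have : val i \in prune Z e by rewrite eZ inE; apply/eqP.
  by rewrite mem_filter => /andP[].
(* All other unknowns of this equation either have coefficient zero or are already known to vanish,
   so the single term in i is zero. *)
move: c0; rewrite (bigD1 i) //= big1 ?addr0 => [/eqP|j ji].
  by rewrite mulf_eq0 (negPf (_ : c i != 0)) ?cE ?ie.1 // => /eqP.
case: (boolP (val j \in e)) => je; last by rewrite -cE negbK in je; rewrite (eqP je) mul0r.
case: (boolP (val j \in Z)) => jZ; first by rewrite IH ?mulr0.
have : val j \in prune Z e by rewrite mem_filter jZ.
rewrite eZ inE -ik => /eqP/val_inj E; by rewrite E eqxx in ji.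
Qed.

Section Structure.
Variable s : seq form.
Hypothesis s_inc : all (increasing 6) s.
Hypothesis s_red : forall l, l \in s -> reduced l.
Local Notation S := (monomials s).

Lemma linkedE m i j : (coef (nth [::] s m) i j != 0) = linked S m i j.
Proof.
have [ms|sm] := ltnP m (size s); last by rewrite /linked !nth_default ?size_map //= eqxx.
by rewrite /linked (nth_map [::]) // coef_neq0 ?(allP s_inc) ?mem_nth //; apply/s_red/mem_nth.
Qed.

Lemma bracket_delta (j k i : 'I_6) : bracket s (delta_mx j 0) (delta_mx k 0) i 0 = coef (nth [::] s i) j k.
Proof.
rewrite bracketE (bigD1 j) //= [X in _ + X]big1 ?addr0 => [|j' /negPf nj]; last first.
  by rewrite big1 // => k' _; rewrite mxE nj !mul0r.
rewrite (bigD1 k) //= big1 ?addr0 => [|k' /negPf nk]; last by rewrite [delta_mx k 0 _ _]mxE nk mulr0.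
by rewrite !mxE !eqxx mulr1 mul1r.
Qed.

Lemma coord_delta a (j : 'I_6) : val j \in a -> coord a (delta_mx j 0).
Proof.
move=> ja i ia; rewrite mxE; case: eqP => // ij; by rewrite ij ja in ia.
Qed.

Lemma csupp_lt t i : i \in csupp S t -> (i < 6)%N.
Proof. by case: t => [||A B|A B] //=; rewrite mem_below6 => /andP[]. Qed.

Lemma solvedP eqs e i : solved eqs -> e \in eqs -> i \in e -> i \in solve eqs.
Proof. by move=> /allP se ee ie; exact: (allP (se _ ee)). Qed.

(** Inclusion in one direction solves the equations with [solve_sound]; in the other, [solved] says
    that every unknown occurring in an equation is among the forced zeros, so each term of the
    relevant sum vanishes separately. *)
Lemma csuppP t x : computable S t -> (csub_mem s t x <-> coord (csupp S t) x).
Proof.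
elim: t x => [||A IHA B IHB|A IHA B IHB] x /=.
- by split=> // _ i; rewrite mem_below6 ltn_ord.
- split=> [-> i _|x0]; first by rewrite mxE.
  by apply/colP=> i; rewrite x0 // mxE.
- move: IHA IHB (@csupp_lt A) (@csupp_lt B); move: (csupp S A) (csupp S B) => a b.
  move=> IHA IHB a6 b6 /and3P[ga gb sol].
  split=> [H i|H v Hv].
    rewrite mem_below6 ltn_ord andbT => iZ.
    have := H (delta_mx 0 i); rewrite -rowE => H0.
    have <- : (row i x) 0 0 = x i 0 by rewrite mxE.
    rewrite H0 ?mxE // => y z /(IHA _ ga) ya /(IHB _ gb) zb; apply/rowP=> k; rewrite -rowE !ord1.
    rewrite mxE [RHS]mxE bracketE big1 // => p _; rewrite big1 // => q _.
    case: (boolP (val p \in a)) => pa; last by rewrite ya // !mul0r.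
    case: (boolP (val q \in b)) => qb; last by rewrite zb // mulr0.
    case: (eqVneq (coef (nth [::] s i) p q) 0) => [->|]; first by rewrite mulr0 mul0r.
    rewrite linkedE => lk; case/negP: iZ; apply: (solvedP sol (e := below6 (fun m => linked S m p q))).
      by apply/mapP; exists (val p, val q) => //; apply/allpairsP; exists (val p, val q).
    by rewrite mem_below6 lk ltn_ord.
  apply/rowP=> k; rewrite !ord1 mxE [RHS]mxE big1 // => i _.
  case: (boolP (val i \in solve (brk_eqs S a b))) => iZ; last first.
    by rewrite H ?mulr0 // mem_below6 (negPf iZ).
  rewrite (@solve_sound (brk_eqs S a b) (fun i => v 0 i)) ?mul0r // => e.
  move=> /mapP[z /allpairsP[[j m] [/= ja mb ->]] ->] /=.
  have j6 := a6 _ ja; have m6 := b6 _ mb.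
  exists (fun i : 'I_6 => coef (nth [::] s i) j m).
    by move=> i'; rewrite mem_below6 linkedE ltn_ord andbT.
  have yA : csub_mem s A (delta_mx (inord j) 0).
    by apply/(IHA _ ga)/coord_delta; rewrite /= inordK.
  have zB : csub_mem s B (delta_mx (inord m) 0).
    by apply/(IHB _ gb)/coord_delta; rewrite /= inordK.
  have /rowP/(_ 0) := Hv _ _ yA zB; rewrite mxE [RHS]mxE => v0; rewrite -[RHS]v0; apply: eq_bigr => i' _.
  by rewrite bracket_delta !inordK // mulrC.
move: IHA IHB (@csupp_lt A) (@csupp_lt B); move: (csupp S A) (csupp S B) => a b.
move=> IHA IHB a6 b6 /and3P[ga gb sol].
split=> [H i|H y /(IHA _ ga) ya].
  rewrite mem_below6 ltn_ord andbT negbK => iZ.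
  apply: (@solve_sound (col_eqs S a b) (fun i => x i 0)) iZ => // e.
  move=> /mapP[z /allpairsP[[k m] [/= ka mb ->]] ->] /=.
  have k6 := a6 _ ka; move: mb; rewrite mem_below6 => /andP[mnb m6].
  exists (fun i : 'I_6 => coef (nth [::] s m) i k).
    by move=> i'; rewrite mem_below6 linkedE ltn_ord andbT.
  have /(IHB _ gb)/(_ (inord m)) : csub_mem s B (bracket s x (delta_mx (inord k) 0)).
    by apply: H; apply/(IHA _ ga)/coord_delta; rewrite /= inordK.
  rewrite /= inordK // => /(_ mnb); rewrite bracketE => x0; rewrite -[RHS]x0; apply: eq_bigr => j _.
  rewrite (bigD1 (inord k)) //= big1 ?addr0 => [|k' /negPf nk]; last by rewrite [delta_mx _ _ _ _]mxE nk mulr0.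
  by rewrite mxE !eqxx !inordK // mulr1 mulrC.
apply/(IHB _ gb) => m mb; rewrite bracketE big1 // => p _; rewrite big1 // => q _.
case: (boolP (val q \in a)) => qa; last by rewrite ya // mulr0.
case: (eqVneq (coef (nth [::] s m) p q) 0) => [->|]; first by rewrite mulr0 mul0r.
rewrite linkedE => lk; rewrite H ?mul0r // mem_below6 negb_and negbK; apply/orP; left.
apply: (solvedP sol (e := below6 (fun i => linked S m i q))).
  apply/mapP; exists (val q, val m) => //; apply/allpairsP; exists (val q, val m); split=> //=.
  by rewrite mem_below6 mb ltn_ord.
by rewrite mem_below6 lk ltn_ord.
Qed.

Lemma csupp_uniq t : uniq (csupp S t).
Proof. by case: t => [||A B|A B] //=; rewrite below6_uniq. Qed.
End Structure.

Lemma coord_dim (P : 'M[F]_6) (a b : seq nat) : P \in unitmx -> uniq a -> uniq b ->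
  {in a, forall i, i < 6}%N -> {in b, forall i, i < 6}%N ->
  (forall x, coord b x -> coord a (P *m x)) -> (size b <= size a)%N.
Proof.
move=> uP ua ub a6 b6 ba.
(* The rows are the basis vectors indexed by [c], so the transpose embeds the coordinate
   subspace. *)
pose A (c : seq nat) : 'M[F]_(size c, 6) := \matrix_(i, j) (nth 0%N c i == j)%:R.
have AAT c : uniq c -> {in c, forall i, i < 6}%N -> A c *m (A c)^T = 1%:M.
  move=> uc c6; apply/matrixP=> i j; rewrite !mxE.
  have ci6 : (nth 0%N c i < 6)%N by apply/c6/mem_nth.
  rewrite (bigD1 (Ordinal ci6)) //= big1 ?addr0 => [|k].
    by rewrite !mxE /= eqxx mul1r eq_sym nth_uniq // -val_eqE.
  by rewrite -val_eqE /= eq_sym !mxE => /negPf->; rewrite mul0r.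
have ATA c (x : 'cV[F]_6) : uniq c -> coord c x -> (A c)^T *m (A c *m x) = x.
  move=> uc cx; apply/colP=> i; rewrite mxE; case: (boolP (val i \in c)) => ic; last first.
    rewrite cx // big1 // => k _; rewrite !mxE; case: eqP => [E|_]; last by rewrite mul0r.
    by case/negP: ic; rewrite /= -E mem_nth.
  have ks : (index (val i) c < size c)%N by rewrite index_mem.
  rewrite (bigD1 (Ordinal ks)) //= big1 ?addr0 => [|k nk].
    rewrite !mxE /= nth_index // eqxx mul1r (bigD1 i) //= big1 ?addr0 => [|j /negPf nj].
      by rewrite !mxE nth_index // eqxx mul1r.
    by rewrite !mxE /= nth_index // -[_ == _]/(i == j) eq_sym nj mul0r.
  rewrite !mxE; case: eqP => [E|_]; last by rewrite mul0r.
  by case/eqP: nk; apply: val_inj; rewrite /= -E index_uniq.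
have rb : \rank (P *m (A b)^T) = size b.
  have : (\rank (A b *m (A b)^T) <= \rank (P *m (A b)^T))%N.
    by rewrite -{1}[(A b)^T](mulKmx uP) (mulmxA (A b)); apply: mxrankM_maxr.
  by rewrite AAT // mxrank1 => le; apply/eqP; rewrite eqn_leq rank_leq_col.
(* The columns lie in the coordinate subspace of [a]; factoring through it bounds the rank, which is
   [size b], by [size a]. *)
have PE : P *m (A b)^T = (A a)^T *m (A a *m (P *m (A b)^T)).
  apply/matrixP=> i j.
  have colj (M : 'M[F]_(6, size b)) : M i j = (M *m (delta_mx j 0 : 'cV_(size b))) i 0 by rewrite -colE mxE.
  have cb : coord b ((A b)^T *m (delta_mx j 0 : 'cV_(size b))).
    by move=> k kb; rewrite -colE !mxE; case: eqP kb => // /= <-; rewrite mem_nth.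
  by rewrite colj [RHS]colj -!mulmxA ATA //; apply: ba.
rewrite -rb PE; apply: leq_trans (mxrankM_maxl _ _) _.
exact: rank_leq_col.
Qed.

Lemma iso_csupp_size s s' t : all (increasing 6) s -> all (increasing 6) s' ->
  (forall l, l \in s -> reduced l) -> (forall l, l \in s' -> reduced l) ->
  dga_iso (alg s) (alg s') -> computable (monomials s) t -> computable (monomials s') t ->
  size (csupp (monomials s) t) = size (csupp (monomials s') t).
Proof.
move=> is1 is2 rs rs' /(iso_fmx two_neq0 is1 is2)[P uP /bracket_iso PE] gs gs'.
have sub u i : i \in csupp (monomials u) t -> (i < 6)%N by exact: csupp_lt.
apply/eqP; rewrite eqn_leq; apply/andP; split; last first.
  apply: (@coord_dim P); rewrite ?csupp_uniq //; try exact: sub.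
  by move=> x /(csuppP is2 rs' _ gs')/(csub_iso _ _ uP PE)/(csuppP is1 rs _ gs).
apply: (@coord_dim (invmx P)); rewrite ?unitmx_inv ?csupp_uniq //; try exact: sub.
move=> x /(csuppP is1 rs _ gs) xs; apply/(csuppP is2 rs' _ gs')/(csub_iso _ _ uP PE).
by rewrite mulKVmx.
Qed.
End Characteristic.

(** * Recovery of the family parameter up to squares *)

Section FamilyIso.
Variable F : fieldType.
Hypothesis two_neq0 : (2%:R : F) != 0.
Local Notation form := (seq (nat * nat * F)).

(** A sum of six terms that reduces to an explicit polynomial expression, ready for [ring]. *)
Definition dot (f : nat -> F) (g : nat -> F) := foldr (fun j acc => f j * g j + acc) 0 (iota 0 6).

Lemma dotE (f g : nat -> F) : \sum_(j < 6) f j * g j = dot f g.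
Proof. by rewrite -(big_mkord xpredT (fun j => f j * g j)) unlock. Qed.

(** Invertibility in the only form used below: to show that an entry or a minor is nonzero, its
    vanishing is turned into an explicit kernel vector. *)
Lemma unit_kernel (P : 'M[F]_6) (x : nat -> F) : P \in unitmx ->
  (forall i, (i < 6)%N -> dot (entry P i) x = 0) -> forall j, (j < 6)%N -> x j = 0.
Proof.
move=> uP Px j j6; have : P *m (\col_(i < 6) x i) = 0.
  apply/colP=> i; rewrite mxE [RHS]mxE -[RHS](Px i) // -dotE; apply: eq_bigr => k _.
  by rewrite mxE /entry !inord_val.
move/(congr1 (mulmx (invmx P))); rewrite mulKmx // mulmx0 => /colP/(_ (Ordinal j6)).
by rewrite !mxE.
Qed.

Lemma iso_entries s s' : all (bounded 6) s -> all (bounded 6) s' -> dga_iso (alg s) (alg s') ->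
  exists f : nat -> nat -> F,
    (forall x, (forall i, (i < 6)%N -> dot (f i) x = 0) -> forall j, (j < 6)%N -> x j = 0) /\
    (forall i p q, (i < 6)%N -> (p < q)%N -> (q < 6)%N ->
      minors f (nth [::] s i) p q = dot (f i) (fun j => coef (nth [::] s' j) p q)).
Proof.
move=> bs bs' /(iso_minors two_neq0 bs bs')[P uP PE]; exists (entry P); split=> [x|i p q i6 pq q6].
  exact: unit_kernel.
rewrite PE //; exact: (dotE (entry P i) (fun j => coef (nth [::] s' j) p q)).
Qed.

Lemma eq_via (x y a b : F) : x = y -> a - b = x - y -> a = b.
Proof. by move=> -> /eqP; rewrite subrr subr_eq0 => /eqP. Qed.
End FamilyIso.

Ltac expand_minors E := cbv beta iota zeta delta [minors dot foldr coef nth iota eqn andb fam] in E.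
Ltac by_minor PE Z :=
  let E := fresh in have E := PE isT isT isT; expand_minors E;
  first [apply: (eq_via E); rewrite ?Z; ring | apply: (eq_via (esym E)); rewrite ?Z; ring].
Ltac by_kernel uP x j Z :=
  let E := fresh in
  have E : x j = 0; [apply: (uP x) => //;
    do 6?[case=> [_|]; first by (cbv beta iota zeta delta [dot foldr iota nth]; rewrite ?Z; ring)]; by []
  | revert E; rewrite /=].

Ltac by_minor0 PE :=
  let E := fresh in have E := PE isT isT isT; expand_minors E;
  first [apply: (eq_via E); ring | apply: (eq_via (esym E)); ring].

Local Notation "f $( i , j )" := (f i%N j%N) (at level 2, left associativity, only parsing).

Section Families.
Variable F : fieldType.
Hypothesis two_neq0 : (2%:R : F) != 0.

(** Modulo x0, dx5 is the quadratic form diag(1, u) on x1, x2. An isomorphism carries it to a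
    multiple of diag(1, v), and the determinants of the two differ by a square. *)
Lemma fam0_iso (u v : F) : v != 0 ->
  dga_iso (alg (nth [::] (fam u) 0)) (alg (nth [::] (fam v) 0)) ->
  exists w : F, w != 0 /\ u = v * w ^+ 2.
Proof.
move=> v0 /(iso_entries two_neq0 (s := nth [::] (fam u) 0) (s' := nth [::] (fam v) 0) isT isT)[f [uP PE]].
have z03 : f $(0, 3) = 0 by by_minor0 (PE 0 0 1)%N.
have z13 : f $(1, 3) = 0 by by_minor0 (PE 1 0 1)%N.
have z23 : f $(2, 3) = 0 by by_minor0 (PE 2 0 1)%N.
have z04 : f $(0, 4) = 0 by by_minor0 (PE 0 0 2)%N.
have z14 : f $(1, 4) = 0 by by_minor0 (PE 1 0 2)%N.
have z24 : f $(2, 4) = 0 by by_minor0 (PE 2 0 2)%N.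
have z05 : f $(0, 5) = 0 by by_minor0 (PE 0 1 3)%N.
have z15 : f $(1, 5) = 0 by by_minor0 (PE 1 1 3)%N.
have z25 : f $(2, 5) = 0 by by_minor0 (PE 2 1 3)%N.
have z35 : f $(3, 5) = 0 by by_minor (PE 3 1 3)%N (z03, z13).
have z45 : f $(4, 5) = 0 by by_minor (PE 4 1 3)%N (z03, z23).
have f55 : f $(5, 5) != 0.
  apply/negP => /eqP z55.
  by_kernel uP (nth (0 : F) [:: 0; 0; 0; 0; 0; 1]) 5%N (z05, z15, z25, z35, z45, z55).
  by move/eqP; rewrite oner_eq0.
have m1 : f $(0, 1) * f $(1, 2) - f $(0, 2) * f $(1, 1) = 0 by by_minor0 (PE 3 1 2)%N.
have m2 : f $(0, 1) * f $(2, 2) - f $(0, 2) * f $(2, 1) = 0 by by_minor0 (PE 4 1 2)%N.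
have e33 : f $(3, 3) = f $(0, 0) * f $(1, 1) - f $(0, 1) * f $(1, 0) by by_minor0 (PE 3 0 1)%N.
have e34 : f $(3, 4) = f $(0, 0) * f $(1, 2) - f $(0, 2) * f $(1, 0) by by_minor0 (PE 3 0 2)%N.
have e43 : f $(4, 3) = f $(0, 0) * f $(2, 1) - f $(0, 1) * f $(2, 0) by by_minor0 (PE 4 0 1)%N.
have e44 : f $(4, 4) = f $(0, 0) * f $(2, 2) - f $(0, 2) * f $(2, 0) by by_minor0 (PE 4 0 2)%N.
have q13 : f $(1, 1) * f $(3, 3) + u * f $(2, 1) * f $(4, 3) = f $(5, 5).
  by by_minor (PE 5 1 3)%N (z13, z23).
have q14 : f $(1, 1) * f $(3, 4) + u * f $(2, 1) * f $(4, 4) = 0 by by_minor (PE 5 1 4)%N (z14, z24).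
have q23 : f $(1, 2) * f $(3, 3) + u * f $(2, 2) * f $(4, 3) = 0 by by_minor (PE 5 2 3)%N (z13, z23).
have q24 : f $(1, 2) * f $(3, 4) + u * f $(2, 2) * f $(4, 4) = v * f $(5, 5).
  by by_minor (PE 5 2 4)%N (z14, z24).
pose D := f $(1, 1) * f $(2, 2) - f $(1, 2) * f $(2, 1).
(* Determinant of the 2 by 2 matrix identity formed by [q13], [q14], [q23], [q24]. *)
have detE : u * D * (f $(3, 3) * f $(4, 4) - f $(3, 4) * f $(4, 3)) = v * f $(5, 5) ^+ 2.
  transitivity ((f $(1, 1) * f $(3, 3) + u * f $(2, 1) * f $(4, 3)) * (f $(1, 2) * f $(3, 4) + u * f $(2, 2) * f $(4, 4))
    - (f $(1, 1) * f $(3, 4) + u * f $(2, 1) * f $(4, 4)) * (f $(1, 2) * f $(3, 3) + u * f $(2, 2) * f $(4, 3))).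
    by rewrite /D; ring.
  by rewrite q13 q14 q23 q24; ring.
have nz : v * f $(5, 5) ^+ 2 != 0 by rewrite mulf_neq0 // expf_neq0.
have D0 : D != 0 by apply/eqP => D0; move: nz; rewrite -detE D0 mulr0 mul0r eqxx.
have z01 : f $(0, 1) = 0.
  apply: (mulIf D0); rewrite mul0r; transitivity (f $(1, 1) * 0 - f $(2, 1) * 0 : F); last by ring.
  by rewrite -{1}m2 -m1 /D; ring.
have z02 : f $(0, 2) = 0.
  apply: (mulIf D0); rewrite mul0r; transitivity (f $(1, 2) * 0 - f $(2, 2) * 0 : F); last by ring.
  by rewrite -{1}m2 -m1 /D; ring.
have uE : u * (f $(0, 0) * D) ^+ 2 = v * f $(5, 5) ^+ 2.
  by rewrite -detE e33 e34 e43 e44 z01 z02 /D; ring.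
have w0 : f $(0, 0) * D != 0.
  by apply/eqP => w0; move: nz; rewrite -uE w0 expr0n mulr0 eqxx.
exists (f $(5, 5) / (f $(0, 0) * D)); split; first by rewrite mulf_neq0 ?invr_eq0.
by rewrite expr_div_n mulrA -uE mulfK // expf_neq0.
Qed.

(** The same comparison of determinants for the quadratic form diag(1, u) on x0, x1; the block on
    x3, x4 is the block on x0, x1 multiplied by its determinant, which is the entry at (2, 2). *)
Lemma fam1_iso (u v : F) :
  dga_iso (alg (nth [::] (fam u) 1)) (alg (nth [::] (fam v) 1)) ->
  exists w : F, w != 0 /\ u = v * w ^+ 2.
Proof.
move=> /(iso_entries two_neq0 (s := nth [::] (fam u) 1) (s' := nth [::] (fam v) 1) isT isT)[f [uP PE]].
have z02 : f $(0, 2) = 0 by by_minor0 (PE 0 0 1)%N.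
have z12 : f $(1, 2) = 0 by by_minor0 (PE 1 0 1)%N.
have z03 : f $(0, 3) = 0 by by_minor0 (PE 0 0 2)%N.
have z13 : f $(1, 3) = 0 by by_minor0 (PE 1 0 2)%N.
have z04 : f $(0, 4) = 0 by by_minor0 (PE 0 1 2)%N.
have z14 : f $(1, 4) = 0 by by_minor0 (PE 1 1 2)%N.
have z05 : f $(0, 5) = 0 by by_minor0 (PE 0 0 3)%N.
have z15 : f $(1, 5) = 0 by by_minor0 (PE 1 0 3)%N.
have z23 : f $(2, 3) = 0 by by_minor (PE 2 0 2)%N (z02, z12).
have z24 : f $(2, 4) = 0 by by_minor (PE 2 1 2)%N (z02, z12).
have z25 : f $(2, 5) = 0 by by_minor (PE 2 0 3)%N (z03, z13).
have z35 : f $(3, 5) = 0 by by_minor (PE 3 0 3)%N (z03, z23).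
have z45 : f $(4, 5) = 0 by by_minor (PE 4 0 3)%N (z13, z23).
have f55 : f $(5, 5) != 0.
  apply/negP => /eqP z55.
  by_kernel uP (nth (0 : F) [:: 0; 0; 0; 0; 0; 1]) 5%N (z05, z15, z25, z35, z45, z55).
  by move/eqP; rewrite oner_eq0.
have e22 : f $(2, 2) = f $(0, 0) * f $(1, 1) - f $(0, 1) * f $(1, 0) by by_minor0 (PE 2 0 1)%N.
have e33 : f $(3, 3) = f $(0, 0) * f $(2, 2) by by_minor (PE 3 0 2)%N z02.
have e34 : f $(3, 4) = f $(0, 1) * f $(2, 2) by by_minor (PE 3 1 2)%N z02.
have e43 : f $(4, 3) = f $(1, 0) * f $(2, 2) by by_minor (PE 4 0 2)%N z12.
have e44 : f $(4, 4) = f $(1, 1) * f $(2, 2) by by_minor (PE 4 1 2)%N z12.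
have q03 : f $(2, 2) * (f $(0, 0) ^+ 2 + u * f $(1, 0) ^+ 2) = f $(5, 5).
  by by_minor (PE 5 0 3)%N (z03, z13, e33, e43).
have q04 : f $(2, 2) * (f $(0, 0) * f $(0, 1) + u * f $(1, 0) * f $(1, 1)) = 0.
  by by_minor (PE 5 0 4)%N (z04, z14, e34, e44).
have q14 : f $(2, 2) * (f $(0, 1) ^+ 2 + u * f $(1, 1) ^+ 2) = v * f $(5, 5).
  by by_minor (PE 5 1 4)%N (z04, z14, e34, e44).
have D0 : f $(2, 2) != 0 by apply/eqP => D0; move: f55; rewrite -q03 D0 mul0r eqxx.
have uE : u * (f $(2, 2) ^+ 2) ^+ 2 = v * f $(5, 5) ^+ 2.
  transitivity (f $(5, 5) * (v * f $(5, 5)) - 0 ^+ 2); last by ring.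
  by rewrite -q14 -{1}q03 -q04 e22; ring.
exists (f $(5, 5) / f $(2, 2) ^+ 2); split; first by rewrite mulf_neq0 ?invr_eq0 ?expf_neq0.
by rewrite expr_div_n mulrA -uE mulfK // !expf_neq0.
Qed.

(** On the pencil of dx4 and dx5 the Pfaffian is the binary quadratic form X^2 - u Y^2. Isomorphic
    algebras have pencils whose forms agree up to a change of basis and a factor [q], so their
    discriminants agree up to the square of D / q. *)
Lemma fam2_iso (u v : F) :
  dga_iso (alg (nth [::] (fam u) 2)) (alg (nth [::] (fam v) 2)) ->
  exists w : F, w != 0 /\ u = v * w ^+ 2.
Proof.
move=> /(iso_entries two_neq0 (s := nth [::] (fam u) 2) (s' := nth [::] (fam v) 2) isT isT)[f [uP PE]].
have z04 : f $(0, 4) = 0 by by_minor0 (PE 0 0 1)%N.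
have z14 : f $(1, 4) = 0 by by_minor0 (PE 1 0 1)%N.
have z24 : f $(2, 4) = 0 by by_minor0 (PE 2 0 1)%N.
have z34 : f $(3, 4) = 0 by by_minor0 (PE 3 0 1)%N.
have z05 : f $(0, 5) = 0 by by_minor0 (PE 0 0 2)%N.
have z15 : f $(1, 5) = 0 by by_minor0 (PE 1 0 2)%N.
have z25 : f $(2, 5) = 0 by by_minor0 (PE 2 0 2)%N.
have z35 : f $(3, 5) = 0 by by_minor0 (PE 3 0 2)%N.
pose a p q := f 0%N p * f 1%N q - f 0%N q * f 1%N p + (f 2%N p * f 3%N q - f 2%N q * f 3%N p).
pose b p q := f 0%N p * f 2%N q - f 0%N q * f 2%N p + u * (f 1%N p * f 3%N q - f 1%N q * f 3%N p).
have a01 : a $(0, 1) = f $(4, 4) by rewrite /a; by_minor0 (PE 4 0 1)%N.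
have a23 : a $(2, 3) = f $(4, 4) by rewrite /a; by_minor0 (PE 4 2 3)%N.
have a02 : a $(0, 2) = f $(4, 5) by rewrite /a; by_minor0 (PE 4 0 2)%N.
have a13 : a $(1, 3) = v * f $(4, 5) by rewrite /a; by_minor0 (PE 4 1 3)%N.
have a03 : a $(0, 3) = 0 by rewrite /a; by_minor0 (PE 4 0 3)%N.
have a12 : a $(1, 2) = 0 by rewrite /a; by_minor0 (PE 4 1 2)%N.
have b01 : b $(0, 1) = f $(5, 4) by rewrite /b; by_minor0 (PE 5 0 1)%N.
have b23 : b $(2, 3) = f $(5, 4) by rewrite /b; by_minor0 (PE 5 2 3)%N.
have b02 : b $(0, 2) = f $(5, 5) by rewrite /b; by_minor0 (PE 5 0 2)%N.
have b13 : b $(1, 3) = v * f $(5, 5) by rewrite /b; by_minor0 (PE 5 1 3)%N.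
have b03 : b $(0, 3) = 0 by rewrite /b; by_minor0 (PE 5 0 3)%N.
have b12 : b $(1, 2) = 0 by rewrite /b; by_minor0 (PE 5 1 2)%N.
pose q := f $(4, 4) ^+ 2 - v * f $(4, 5) ^+ 2.
(* The Pfaffian polarities of the pencil spanned by the images of dx4 and dx5. *)
have bb : f $(5, 4) ^+ 2 - v * f $(5, 5) ^+ 2 = - u * q.
  transitivity (b $(0, 1) * b $(2, 3) - b $(0, 2) * b $(1, 3) + b $(0, 3) * b $(1, 2)).
    by rewrite b01 b23 b02 b13 b03 b12; ring.
  transitivity (- u * (a $(0, 1) * a $(2, 3) - a $(0, 2) * a $(1, 3) + a $(0, 3) * a $(1, 2))).
    by rewrite /a /b; ring.
  by rewrite a01 a23 a02 a13 a03 a12 /q; ring.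
have ab : f $(4, 4) * f $(5, 4) - v * f $(4, 5) * f $(5, 5) = 0.
  have : a $(0, 1) * b $(2, 3) + a $(2, 3) * b $(0, 1) - a $(0, 2) * b $(1, 3) - a $(1, 3) * b $(0, 2)
     + a $(0, 3) * b $(1, 2) + a $(1, 2) * b $(0, 3) = 0 by rewrite /a /b; ring.
  rewrite a01 a23 a02 a13 a03 a12 b01 b23 b02 b13 b03 b12 => E.
  apply: (mulfI two_neq0); rewrite mulr0; apply: (eq_via E); ring.
pose D := f $(4, 4) * f $(5, 5) - f $(4, 5) * f $(5, 4).
(* If D = 0, the vectors (f55, - f54) and then (f45, - f44) lie in the kernel of the block on x4,
   x5; the whole block vanishes, and so does the vector (1, 0). *)
have D0 : D != 0.
  apply/eqP => D0.
  have E4 : f $(4, 4) * f $(5, 5) = f $(4, 5) * f $(5, 4) by apply/eqP; rewrite -subr_eq0 -/D D0.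
  have ker x y : f $(4, 4) * x + f $(4, 5) * y = 0 -> f $(5, 4) * x + f $(5, 5) * y = 0 -> x = 0 /\ y = 0.
    move=> E E'; suff K : forall j, (j < 6)%N -> nth 0 [:: 0; 0; 0; 0; x; y] j = 0.
      by split; [exact: (K 4%N) | exact: (K 5%N)].
    apply: uP; do 4?[case=> [_|]; first by (cbv beta iota zeta delta [dot foldr iota nth];
      rewrite ?(z04, z14, z24, z34, z05, z15, z25, z35); ring)].
    case=> [_|]; first by (cbv beta iota zeta delta [dot foldr iota nth]; rewrite -[RHS]E; ring).
    case=> [_|]; first by (cbv beta iota zeta delta [dot foldr iota nth]; rewrite -[RHS]E'; ring).
    by [].
  have [z55 /eqP] : f $(5, 5) = 0 /\ - f $(5, 4) = 0.
    by apply: ker; [apply: (eq_via D0); rewrite /D; ring | ring].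
  rewrite oppr_eq0 => /eqP z54.
  have [z45 /eqP] : f $(4, 5) = 0 /\ - f $(4, 4) = 0 by apply: ker; rewrite ?z55 ?z54; ring.
  rewrite oppr_eq0 => /eqP z44.
  have [/eqP] : (1 : F) = 0 /\ (0 : F) = 0 by apply: ker; rewrite ?z44 ?z45 ?z54 ?z55; ring.
  by rewrite oner_eq0.
have qE : - u * q ^+ 2 = - v * D ^+ 2.
  transitivity (q * (f $(5, 4) ^+ 2 - v * f $(5, 5) ^+ 2) - (f $(4, 4) * f $(5, 4) - v * f $(4, 5) * f $(5, 5)) ^+ 2).
    by rewrite bb ab; ring.
  by rewrite /q /D; ring.
(* If q = 0, then v = 0 by [qE], so the first column of the block on x4, x5 vanishes, against D !=
   0. *)
have q0 : q != 0.
  apply/eqP => q0; move: qE; rewrite q0 expr0n mulr0 => /esym/eqP.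
  rewrite mulf_eq0 oppr_eq0 (negPf (expf_neq0 2 D0)) orbF => /eqP v0.
  move: q0 bb; rewrite /q v0 !mul0r !subr0 => /eqP; rewrite sqrf_eq0 => /eqP z44.
  rewrite z44 expr0n mulr0 => /eqP; rewrite sqrf_eq0 => /eqP z54.
  by move: D0; rewrite /D z44 z54 mul0r mulr0 subrr eqxx.
exists (D / q); split; first by rewrite mulf_neq0 ?invr_eq0.
rewrite expr_div_n mulrA; apply: (mulIf (expf_neq0 2 q0)); rewrite mulfVK ?expf_neq0 //.
by apply: oppr_inj; rewrite -!mulNr.
Qed.

(** The pair (dx4, dx5) is y x2 + N(y) x3 for y = x0, x1, with N(x0) = x1 and N(x1) = u x0. With B
    the block on x0, x1, an isomorphism gives (n + m N_u) B = d B N_v; traces force n = 0, and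
    determinants give u m^2 = v d^2. *)
Lemma fam3_iso (u v : F) :
  dga_iso (alg (nth [::] (fam u) 3)) (alg (nth [::] (fam v) 3)) ->
  exists w : F, w != 0 /\ u = v * w ^+ 2.
Proof.
move=> /(iso_entries two_neq0 (s := nth [::] (fam u) 3) (s' := nth [::] (fam v) 3) isT isT)[f [uP PE]].
have z02 : f $(0, 2) = 0 by by_minor0 (PE 0 0 1)%N.
have z12 : f $(1, 2) = 0 by by_minor0 (PE 1 0 1)%N.
have z32 : f $(3, 2) = 0 by by_minor0 (PE 3 0 1)%N.
have z04 : f $(0, 4) = 0 by by_minor0 (PE 0 0 2)%N.
have z14 : f $(1, 4) = 0 by by_minor0 (PE 1 0 2)%N.
have z34 : f $(3, 4) = 0 by by_minor0 (PE 3 0 2)%N.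
have z05 : f $(0, 5) = 0 by by_minor0 (PE 0 1 2)%N.
have z15 : f $(1, 5) = 0 by by_minor0 (PE 1 1 2)%N.
have z35 : f $(3, 5) = 0 by by_minor0 (PE 3 1 2)%N.
have z24 : f $(2, 4) = 0 by by_minor (PE 2 0 2)%N (z02, z12).
have z25 : f $(2, 5) = 0 by by_minor (PE 2 1 2)%N (z02, z12).
have e22 : f $(2, 2) = f $(0, 0) * f $(1, 1) - f $(0, 1) * f $(1, 0) by by_minor0 (PE 2 0 1)%N.
have m03 : f $(0, 0) * f $(1, 3) - f $(0, 3) * f $(1, 0) = 0 by by_minor (PE 2 0 3)%N z25.
have m13 : f $(0, 1) * f $(1, 3) - f $(0, 3) * f $(1, 1) = 0 by by_minor (PE 2 1 3)%N z24.
pose D := f $(4, 4) * f $(5, 5) - f $(4, 5) * f $(5, 4).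
have ker x y t : f $(2, 2) * t = 0 -> f $(4, 2) * t + f $(4, 4) * x + f $(4, 5) * y = 0 ->
    f $(5, 2) * t + f $(5, 4) * x + f $(5, 5) * y = 0 -> [/\ x = 0, y = 0 & t = 0].
  move=> E2 E4 E5; suff K : forall j, (j < 6)%N -> nth 0 [:: 0; 0; t; 0; x; y] j = 0.
    by split; [exact: (K 4%N) | exact: (K 5%N) | exact: (K 2%N)].
  apply: uP; do 2?[case=> [_|]; first by (cbv beta iota zeta delta [dot foldr iota nth];
    rewrite ?(z02, z12, z04, z14, z05, z15); ring)].
  case=> [_|]; first by (cbv beta iota zeta delta [dot foldr iota nth]; rewrite -[RHS]E2 z24 z25; ring).
  case=> [_|]; first by (cbv beta iota zeta delta [dot foldr iota nth]; rewrite z32 z34 z35; ring).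
  case=> [_|]; first by (cbv beta iota zeta delta [dot foldr iota nth]; rewrite -[RHS]E4; ring).
  case=> [_|]; first by (cbv beta iota zeta delta [dot foldr iota nth]; rewrite -[RHS]E5; ring).
  by [].
have D0 : D != 0.
  apply/eqP => D0.
  have [z55 /eqP] : [/\ f $(5, 5) = 0, - f $(5, 4) = 0 & (0 : F) = 0].
    by apply: ker; [ring | apply: (eq_via D0); rewrite /D; ring | ring].
  rewrite oppr_eq0 => /eqP z54 _.
  have [z45 /eqP] : [/\ f $(4, 5) = 0, - f $(4, 4) = 0 & (0 : F) = 0].
    by apply: ker; rewrite ?z55 ?z54; ring.
  rewrite oppr_eq0 => /eqP z44 _.
  have [/eqP] : [/\ (1 : F) = 0, (0 : F) = 0 & (0 : F) = 0].
    by apply: ker; rewrite ?z44 ?z45 ?z54 ?z55; ring.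
  by rewrite oner_eq0.
have d0 : f $(2, 2) != 0.
  apply/eqP => z22.
  (* Cramer's rule for the block on x4, x5: if the entry at (2, 2) vanished, this would be a kernel
     vector with third coordinate D. *)
  have [_ _ DE] := ker (f $(4, 5) * f $(5, 2) - f $(4, 2) * f $(5, 5)) (f $(4, 2) * f $(5, 4) - f $(4, 4) * f $(5, 2)) D
    ltac:(rewrite z22; ring) ltac:(rewrite /D; ring) ltac:(rewrite /D; ring).
  by rewrite DE eqxx in D0.
have z03 : f $(0, 3) = 0.
  apply: (mulIf d0); rewrite mul0r; transitivity (f $(0, 1) * 0 - f $(0, 0) * 0 : F); last by ring.
  by rewrite -{1}m03 -m13 e22; ring.
have z13 : f $(1, 3) = 0.
  apply: (mulIf d0); rewrite mul0r; transitivity (f $(1, 1) * 0 - f $(1, 0) * 0 : F); last by ring.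
  by rewrite -{1}m03 -m13 e22; ring.
pose n := f $(2, 3); pose m := f $(3, 3); pose d := f $(2, 2).
have q4 : n * f $(0, 1) + m * f $(1, 1) = d * f $(0, 0).
  transitivity f $(4, 4); first by rewrite /n /m; by_minor (PE 4 1 3)%N (z03, z13).
  by rewrite /d; by_minor (PE 4 0 2)%N (z02, z12, z32).
have q4' : n * f $(0, 0) + m * f $(1, 0) = v * d * f $(0, 1).
  transitivity (v * f $(4, 5)); first by rewrite /n /m; by_minor (PE 4 0 3)%N (z03, z13).
  by rewrite -mulrA; congr (_ * _); rewrite /d; by_minor (PE 4 1 2)%N (z02, z12, z32).
have q5 : n * f $(1, 1) + u * m * f $(0, 1) = d * f $(1, 0).
  transitivity f $(5, 4); first by rewrite /n /m; by_minor (PE 5 1 3)%N (z03, z13).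
  by rewrite /d; by_minor (PE 5 0 2)%N (z02, z12, z32).
have q5' : n * f $(1, 0) + u * m * f $(0, 0) = v * d * f $(1, 1).
  transitivity (v * f $(5, 5)); first by rewrite /n /m; by_minor (PE 5 0 3)%N (z03, z13).
  by rewrite -mulrA; congr (_ * _); rewrite /d; by_minor (PE 5 1 2)%N (z02, z12, z32).
(* Comparison of traces: N_v is traceless, and n + m N_u has trace 2n. *)
have n0 : n = 0.
  apply: (mulfI two_neq0); apply: (mulIf d0); rewrite mulr0 mul0r.
  transitivity (f $(1, 1) * (n * f $(0, 0) + m * f $(1, 0)) - f $(1, 0) * (n * f $(0, 1) + m * f $(1, 1))
    + f $(0, 0) * (n * f $(1, 1) + u * m * f $(0, 1)) - f $(0, 1) * (n * f $(1, 0) + u * m * f $(0, 0))).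
    by rewrite e22; ring.
  by rewrite q4 q4' q5 q5'; ring.
have m0 : m != 0.
  apply/eqP => m0; move: q4 q5; rewrite n0 m0 !mulr0 !mul0r !addr0 => /esym/eqP + /esym/eqP.
  rewrite !mulf_eq0 (negPf (d0 : d != 0)) /= => /eqP z00 /eqP z10.
  by move: d0; rewrite e22 z00 z10 mul0r mulr0 subrr eqxx.
exists (d / m); split; first by rewrite mulf_neq0 ?invr_eq0.
rewrite expr_div_n mulrA; apply: (mulIf (expf_neq0 2 m0)); rewrite mulfVK ?expf_neq0 //.
apply: (mulIf d0).
transitivity ((n * f $(0, 1) + m * f $(1, 1)) * (n * f $(1, 0) + u * m * f $(0, 0))
  - (n * f $(0, 0) + m * f $(1, 0)) * (n * f $(1, 1) + u * m * f $(0, 1))).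
  by rewrite n0 e22; ring.
rewrite q4 q4' q5 q5'; transitivity (v * d ^+ 2 * (f $(0, 0) * f $(1, 1) - f $(0, 1) * f $(1, 0))).
  by ring.
by rewrite -e22.
Qed.
End Families.

(** * Separation of the models by signatures *)

Definition derived := Brk Full Full.
Definition center := Col Full Null.
Definition center2 := Col Full center.

(* The dimensions of these subspaces separate all the models, except for the last two families and
   their degenerate members. *)
Definition probes := [:: derived; center; Col derived center; Col (Col center2 Null) center;
  Col (Col derived Null) (Brk Full derived)].

Definition signature S := [seq size (csupp S t) | t <- probes].

Section Separation.
Variable F : fieldType.
Hypothesis two_neq0 : (2%:R : F) != 0.
Local Notation index := ('I_26 + 'I_4 * F)%type.

Definition structure (t : index) :=
  match t with inl i => nth [::] (forms F) i | inr (k, u) => nth [::] (fam u) k end.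
Definition code (t : index) : nat := match t with inl i => i | inr (k, _) => (26 + k)%N end.
(** The monomial lists in the families do not depend on the parameter, so the value 1 represents all
    nonzero parameters and thirty supports are enough. *)
Definition supports := [seq monomials s | s <- forms F ++ fam (1 : F)].

Lemma support_structure t : monomials (structure t) = nth [::] supports (code t).
Proof.
case: t => [[k k26]|[[k k4] u]] /=.
  by do 26?[case: k k26 => [|k] k26 //].
by do 4?[case: k k4 => [|k] k4 //].
Qed.

Lemma structure_increasing t : all (increasing 6) (structure t).
Proof.
case: t => [[k k26]|[[k k4] u]] /=.
  by do 26?[case: k k26 => [|k] k26 //].
by do 4?[case: k k4 => [|k] k4 //].
Qed.

Lemma structure_reduced t : valid_index t -> forall l, l \in structure t -> reduced l.
Proof.
move=> vt; suff /allP H : all (fun l : seq (nat * nat * F) => uniq [seq x.1 | x <- l] &&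
    all (fun x => x.2 != 0) l) (structure t).
  by move=> l /H /andP[ul /allP nz].
have n1 : (-1 : F) != 0 by rewrite oppr_eq0 oner_neq0.
case: t vt => [[k k26] _|[[k k4] u] u0] /=.
  by do 26?[case: k k26 => [|k] k26; first by rewrite /= ?oner_neq0 ?n1 //].
have {}u0 : u != 0 := u0.
by do 4?[case: k k4 => [|k] k4; first by rewrite /= ?oner_neq0 ?u0 //].
Qed.

Lemma code_lt t : (code t < 30)%N.
Proof. by case: t => [i|[k u]] /=; [apply: ltn_trans (ltn_ord i) _ | rewrite (ltn_add2l 26 k 4)]. Qed.

(** The codes of the members at parameter zero of the last two families, each paired with its
    family. *)
Definition confused i j := ((i, j) \in [:: (24, 28); (25, 29)])%N.

Lemma signature_separates : all (fun i => all (fun j =>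
  (signature (nth [::] supports i) == signature (nth [::] supports j)) ==>
  [|| i == j, confused i j | confused j i]) (iota 0 30)) (iota 0 30).
Proof. by vm_compute. Qed.

Lemma probes_computable : all (fun S => all (computable S) probes) supports.
Proof. by vm_compute. Qed.

Lemma iso_code t t' : valid_index t -> valid_index t' -> dga_iso (model t) (model t') ->
  [|| code t == code t', confused (code t) (code t') | confused (code t') (code t)].
Proof.
have mE x : model x = alg (structure x) by case: x => [i|[]].
move=> vt vt'; rewrite !mE => tt'.
have pc x : all (computable (monomials (structure x))) probes.
  rewrite support_structure; apply: (allP probes_computable).
  by apply: mem_nth; rewrite size_map; apply: code_lt.
have sE : signature (monomials (structure t)) = signature (monomials (structure t')).
  rewrite /signature; elim: probes (pc t) (pc t') => //= p ps IH /andP[pt pst] /andP[pt' pst'].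
  congr (_ :: _); last exact: IH.
  apply: (iso_csupp_size two_neq0) tt' pt pt'; try exact: structure_increasing;
    exact: structure_reduced.
have := allP signature_separates (code t); rewrite mem_iota code_lt => /(_ isT)/allP/(_ (code t')).
by rewrite mem_iota code_lt => /(_ isT); rewrite -!support_structure sE eqxx.
Qed.

Lemma fam_iso (k : nat) (u v : F) : (k < 4)%N -> (v != 0) || (1 < k)%N ->
  dga_iso (alg (nth [::] (fam u) k)) (alg (nth [::] (fam v) k)) ->
  exists w : F, w != 0 /\ u = v * w ^+ 2.
Proof.
case: k => [|[|[|[|//]]]] _ /=; first by rewrite orbF => v0; apply: fam0_iso.
- by move=> _; apply: fam1_iso.
- by move=> _; apply: fam2_iso.
by move=> _; apply: fam3_iso.
Qed.

Lemma forms_fam0 i k : confused i (26 + k)%N ->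
  [/\ (1 < k < 4)%N, dga_iso (alg (nth [::] (forms F) i)) (alg (nth [::] (fam (0 : F)) k)) &
     dga_iso (alg (nth [::] (fam (0 : F)) k)) (alg (nth [::] (forms F) i))].
Proof.
rewrite /confused !inE !xpair_eqE => /orP[] /andP[/eqP-> /eqP kE].
  have -> : k = 2%N by apply: (@addnI 26); rewrite kE.
  split=> //; apply: approx_full.
    have H := approx_refl (nth [::] (forms F) 24); rebase (nth [::] (fam 0) 2) [::] [::]; exact: H.
  have H := approx_refl (nth [::] (fam (0 : F)) 2); rebase (nth [::] (forms F) 24) [::] [::]; exact: H.
have -> : k = 3%N by apply: (@addnI 26); rewrite kE.
split=> //; apply: approx_full.
  have H := approx_refl (nth [::] (forms F) 25); rebase (nth [::] (fam 0) 3) [::] [::]; exact: H.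
have H := approx_refl (nth [::] (fam (0 : F)) 3); rebase (nth [::] (forms F) 25) [::] [::]; exact: H.
Qed.

Lemma not_confused i j : (i < 26)%N -> (j < 26)%N -> confused i j = false.
Proof.
by move=> i26 j26; rewrite /confused !inE !xpair_eqE; apply/negbTE/negP => /orP[] /andP[_ /eqP jE];
  rewrite jE in j26.
Qed.

Lemma model_iso (t t' : index) : valid_index t -> valid_index t' ->
  (dga_iso (model t) (model t') <-> sq_rel t t').
Proof.
move=> vt vt'; split=> [tt'|]; last first.
  case: t t' vt vt' => [i|[k u]] [j|[k' v]] //= _ _ [->]; first exact: dga_iso_refl.
  by case=> w [w0 ->]; apply: fam_square.
have := iso_code vt vt' tt'; case: t t' vt vt' tt' => [i|[k u]] [j|[k' v]]; cbn [code model sq_rel valid_index]; move=> vt vt' tt'.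
- rewrite !not_confused // !orbF => /eqP; exact: val_inj.
- rewrite (ltn_eqF (leq_trans (ltn_ord i) (leq_addr k' 26))) orFb.
  case/orP=> [c|]; last first.
    rewrite /confused !inE !xpair_eqE => /orP[] /andP[_ /eqP iE]; have := ltn_ord i; by rewrite iE.
  (* The discrete form is the family at parameter zero, so an isomorphism would make the nonzero
     parameter a square multiple of zero. *)
  have [/andP[k1 k4] _ fi] := forms_fam0 c.
  have [w [w0 /esym/eqP]] := fam_iso k4 (introT orP (or_intror k1)) (dga_iso_trans fi tt').
  by rewrite mulf_eq0 (negPf vt') (negPf (expf_neq0 2 w0)).
- rewrite eq_sym (ltn_eqF (leq_trans (ltn_ord j) (leq_addr k 26))) orFb.
  case/orP=> [|c].
    rewrite /confused !inE !xpair_eqE => /orP[] /andP[_ /eqP jE]; have := ltn_ord j; by rewrite jE.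
  have [/andP[k1 k4] jf _] := forms_fam0 c.
  have [w [w0 uE]] := fam_iso k4 (introT orP (or_intror k1)) (dga_iso_trans tt' jf).
  by rewrite uE mul0r eqxx in vt.
have nc (x y : 'I_4) : confused (26 + x)%N (26 + y)%N = false.
  rewrite /confused !inE !xpair_eqE; apply/negbTE/negP => /orP[] /andP[/eqP xE _].
    by have := leq_addr x 26; rewrite xE.
  by have := leq_addr x 26; rewrite xE.
rewrite !nc !orbF eqn_add2l => /eqP/val_inj kk; subst k'; split=> //.
by apply: fam_iso tt'; rewrite ?ltn_ord ?vt'.
Qed.
End Separation.

Theorem theorem1p2 (F : fieldType) (hF : 2 \notin [pchar F]) :
  exists g : ('I_26 + 'I_4 * F)%type -> (ext F 6 -> ext F 6),
    [/\ (forall t, valid_index t -> is_minimal_algebra (g t)),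
        (forall d, is_minimal_algebra d ->
            exists t, valid_index t /\ dga_iso d (g t))
      & (forall t t', valid_index t -> valid_index t' ->
            (dga_iso (g t) (g t') <-> sq_rel t t'))].
Proof.
have two_neq0 : (2%:R : F) != 0 by apply: contra hF => /eqP h2; rewrite inE /= h2 eqxx.
exists (@model F); split=> [t _|d|t t']; first exact: minimal_model.
  exact: classification.
exact: model_iso.
Qed.
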